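(* Let $X_i=I_{i,1}Z_{i,1}+\dots+I_{i,k}Z_{i,k}$, $i\ge1$, where $(Z_{i,1})_i,\dots,(Z_{i,k})_i$ are independent Markov processes with stationary marginal densities $m^{(1)},\dots,m^{(k)}$, with $m^{(l)}(x)=p(x\mid\theta_l)$, and $(I_{i,1},\dots,I_{i,k})\sim\mathrm{Multinomial}(1,p_1,\dots,p_k)$, independent over $i$ and independent of the $Z$'s. Let $m=\sum_l p_l m^{(l)}$ be the marginal density of $X_i$, i.e. the mixture with mixing density $f$ given by $f(\theta_l)=p_l$ on the finite set $\Theta=\{\theta_1,\dots,\theta_k\}$. Suppose there exist $c_0>0$ and $0<\rho<1$ such that for each $l=1,\dots,k$ and all $n\ge1$ $$\sup_i\int\Big(\frac{m^{(l)}(x_{i+n}\mid x_{1:i})}{m^{(l)}(x_{i+n})}-1\Big)^2m(x_{i+n})\,m(x_{1:i})=\sup_i\int\Big(\frac{m^{(l)}(x_{i+n}\mid x_i)}{m^{(l)}(x_{i+n})}-1\Big)^2m(x_{i+n})\,m(x_i)\le c_0\rho^{2n},$$ where the integrals are with respect to $\nu$ in each of the variables $x_{i+n}$ and $x_{1:i}=(x_1,\dots,x_i)$ (respectively $x_{i+n}$ and $x_i$), $m(x_{1:i})$ is the joint density of $(X_1,\dots,X_i)$, and $m^{(l)}(\cdot\mid x_{1:i})$, $m^{(l)}(\cdot\mid x_i)$ are the conditional densities of $Z_{i+n,l}$ given $(Z_{1,l},\dots,Z_{i,l})=x_{1:i}$ and given $Z_{i,l}=x_i$ (these agree by the Markov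 property). Assume conditions B1, B2, B3, B4, C1, C2, C3 stated in the context, and that the initial estimate $f_0$ has the same support as $f$. Then the predictive recursion estimator $f_n$ based on $X_1,X_2,\dots$ (defined in the context) converges to the true mixing density $f$ with probability one as $n\to\infty$.
   Context: Setting. $\nu$ and $\mu$ are sigma-finite measures on the sample space $\chi$ and on the parameter space; densities on $\chi$ are with respect to $\nu$ and mixing densities are with respect to $\mu$. $\Theta$ is a finite subset of a Euclidean space, $\widehat\Theta\supseteq\Theta$ is a closed convex set, and for each $\theta\in\widehat\Theta$, $p(\cdot\mid\theta)$ is a probability density on $\chi$ with respect to $\nu$. Predictive recursion (PR). Starting from an initial mixing density $f_0$ and positive weights $w_i$, define for $i\ge1$ $$f_i(\theta)=(1-w_i)f_{i-1}(\theta)+w_i\frac{p(X_i\mid\theta)f_{i-1}(\theta)}{m_{i-1}(X_i)},\qquad m_{i-1}(x)=\int p(x\mid\theta)f_{i-1}(\theta)\,d\mu(\theta);$$ each iterate $f_i$ is a mixing (probability) density and $m_i$ is the corresponding marginal density. It is assumed that $K_0=\int f\log(f/f_0)\,d\mu$ and $K_0^*=\int m\log(m/m_0)\,d\nu$ are finite. Conditions. There are a finite set $\Theta_H\subset\widehat\Theta$ and a compact set $\chi_c\subset\chi$ such that: C1. For some constant $c_u>1$: for any $x\notin\chi_c$ there exist $\theta_1^x,\theta_2^x\in\Theta_H$ with $\sup_{\theta,\theta'\in\Theta}\frac{p(x\mid\theta)}{p(x\mid\theta')}\le c_u\frac{p(x\mid\theta_2^x)}{p(x\mid\theta_1^x)}$.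 C2. There is $a>0$ with $\inf_{x\in\chi_c,\theta\in\Theta}p(x\mid\theta)>a$. C3. There is $b<\infty$ with $\sup_{x\in\chi_c,\theta\in\Theta}p(x\mid\theta)<b$. B1. $w_i\downarrow0$ and $w_i\sim i^{-\alpha}$ with $\alpha\in(0.5,1]$. B2 (for each latent process). There is $b_0>0$ (without loss of generality $b_0\ge1$) such that for each component $r\in\{1,\dots,k\}$, all $n_1\le n$, all distinct $j_1,\dots,j_{n_1}\in\{1,\dots,n\}$ and all $\theta_{l_1},\theta_{l_2}\in\widehat\Theta$ ($l=1,\dots,n_1$), $E\big[\big(\prod_{l=1}^{n_1}\frac{p(Z_{j_l,r}\mid\theta_{l_1})}{p(Z_{j_l,r}\mid\theta_{l_2})}\big)^2\big]\le b_0^{2n_1}\prod_{l=1}^{n_1}E\big[\big(\frac{p(Z_{j_l,r}\mid\theta_{l_1})}{p(Z_{j_l,r}\mid\theta_{l_2})}\big)^2\big]$. B3. $\sup_{\theta_1,\theta_2,\theta_3\in\widehat\Theta}E_{\theta_3}\big[\big(\frac{p(X\mid\theta_1)}{p(X\mid\theta_2)}\big)^2\big]<B<\infty$, where $E_{\theta_3}$ is expectation under $X\sim p(\cdot\mid\theta_3)$. B4. For each $x\in\chi$ the map $\theta\mapsto p(x\mid\theta)$ is bounded and continuous.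
   Formalization: The formal theorem adds identifiability: f is the only mixing density on Θ whose marginal equals m ν-almost everywhere. Without it the claim fails, e.g. if p(·|θ) does not depend on θ, when f_n = f_0 for all n. *)

(* Defs.v *)
From HB Require Import structures.
From mathcomp Require Export all_boot all_order all_algebra.
From mathcomp Require Export all_classical all_reals all_analysis.

Set Implicit Arguments.
Unset Strict Implicit.
Unset Printing Implicit Defensive.

Import Order.TTheory GRing.Theory Num.Theory.
Import numFieldNormedType.Exports.

Local Open Scope classical_set_scope.
Local Open Scope ring_scope.

(* A sequence indexed by i = 1, 2, ... in the mathematics is a function on
   nat here, entry i standing for the mathematical index i + 1. *)

Notation borel T := (g_sigma_algebraType (@open T)).

Section densities.
Context {d : measure_display} {T : measurableType d} {R : realType}.
Variable nu : {measure set T -> \bar R}.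

Definition density (D : set T) (g : T -> R) : Prop :=
  [/\ measurable_fun D g, forall x, D x -> 0 <= g x &
      (\int[nu]_(x in D) (g x)%:E = 1)%E].

(* The integrand is 0 where f is; the conventions on r / 0 and ln 0 play no
   role as long as f vanishes wherever g does. *)
Definition relative_entropy (D : set T) (f g : T -> R) : \bar R :=
  (\int[nu]_(x in D) (f x * ln (f x / g x))%:E)%E.

(* Iterated integral of F over D^n, with respect to nu in each variable. *)
Fixpoint integral_tuple (D : set T) (n : nat) :
    (n.-tuple T -> \bar R) -> \bar R :=
  match n with
  | 0 => fun F => F [tuple]
  | m.+1 => fun F =>
      (\int[nu]_(x in D)
         integral_tuple D (fun t : m.-tuple T => F [tuple of x :: t]))%E
  end.

End densities.

Definition path_of {Omega T : Type} (Z : nat -> Omega -> T) (n : nat)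
    (omega : Omega) : n.-tuple T :=
  [tuple Z j omega | j < n].

Definition tuples_in {T : Type} (D : set T) (n : nat) : set (n.-tuple T) :=
  [set t | forall j, D (tnth t j)].
Arguments tuples_in {T} D n _.

Section laws.
Context {dO : measure_display} {Omega : measurableType dO} {R : realType}.
Variable P : probability Omega R.

Section one_space.
Context {d : measure_display} {T : measurableType d}.

Definition has_density (nu : {measure set T -> \bar R}) (D : set T)
    (Z : Omega -> T) (g : T -> R) : Prop :=
  forall A, measurable A ->
    (P (Z @^-1` A) = \int[nu]_(x in D `&` A) (g x)%:E)%E.

Definition joint_density (nu : {measure set T -> \bar R}) (D : set T)
    (Z : nat -> Omega -> T) (n : nat) (g : n.-tuple T -> R) : Prop :=
  [/\ measurable_fun (tuples_in D n) g,
      forall t, tuples_in D n t -> 0 <= g t &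
      forall A : set (n.-tuple T), measurable A ->
        (P (path_of Z n @^-1` A) =
         integral_tuple nu D (fun t => (g t * \1_A t)%:E))%E].

(* c s y is (a version of) the conditional density at y of V given U = s. *)
Definition conditional_density {d' : measure_display} {S : measurableType d'}
    (nu : {measure set T -> \bar R}) (DS : set S) (D : set T)
    (U : Omega -> S) (V : Omega -> T) (c : S -> T -> R) : Prop :=
  [/\ measurable_fun (DS `*` D) (fun z => c z.1 z.2),
      forall s y, DS s -> D y -> 0 <= c s y &
      forall A B, measurable A -> measurable B ->
        (P (U @^-1` A `&` V @^-1` B) =
         \int[P]_(omega in U @^-1` A)
            \int[nu]_(y in D `&` B) (c (U omega) y)%:E)%E].

Definition sigma_of {J : Type} (D : set J) (Y : J -> Omega -> T) :
    set_system Omega :=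
  <<s \bigcup_(j in D) g_sigma_algebra_preimage (Y j) >>.

(* Given Z_0, ..., Z_s, the conditional probability of Z_t \in B is a function
   of Z_s alone. *)
Definition markov_process (Z : nat -> Omega -> T) : Prop :=
  forall (s t : nat) (B : set T), (s <= t)%N -> measurable B ->
    exists2 g : T -> R, measurable_fun setT g &
      forall C, sigma_of [set j | (j <= s)%N] Z C ->
        (P (C `&` Z t @^-1` B) = \int[P]_(omega in C) (g (Z s omega))%:E)%E.

End one_space.

Definition mutually_independent {J : eqType} (G : J -> set_system Omega) :
    Prop :=
  forall (s : seq J) (A : J -> set Omega), uniq s ->
    (forall j, j \in s -> G j (A j)) ->
    (P (\big[setI/setT]_(j <- s) A j) = \prod_(j <- s) P (A j))%E.

Definition independent (G H : set_system Omega) : Prop :=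
  forall A B, G A -> H B -> (P (A `&` B) = P A * P B)%E.

Definition multinomial_pmf (n k : nat) (prob : 'I_k -> R) (v : 'I_k -> nat) : R :=
  if (\sum_l v l == n)%N
  then (n`!)%:R / (\prod_l (v l)`!)%:R * \prod_l prob l ^+ v l
  else 0.

Definition multinomial_distributed (n k : nat) (prob : 'I_k -> R)
    (N : 'I_k -> Omega -> nat) : Prop :=
  forall v : 'I_k -> nat,
    P [set omega | forall l, N l omega = v l] = (multinomial_pmf n prob v)%:E.

End laws.

(* Extended-real valued: r / 0 = +oo for r > 0, and 0 / 0 = 0. *)
Definition likelihood_ratio {X T : Type} {R : realType} (p : X -> T -> R)
    (x : X) (t1 t2 : T) : \bar R :=
  ((p x t1)%:E / (p x t2)%:E)%E.

Section mixtures.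
Context {dX dT : measure_display} {X : measurableType dX}
  {T : measurableType dT} {R : realType}.
Variables (nu : {measure set X -> \bar R}) (mu : {measure set T -> \bar R}).
(* chi is the sample space; Theta is the set on which mixing densities live. *)
Variables (chi : set X) (Theta : set T) (p : X -> T -> R).

Definition marginal (g : T -> R) (x : X) : R :=
  \int[mu]_(t in Theta) (p x t * g t).

Fixpoint predictive_recursion (w : nat -> R) (f0 : T -> R) (x : nat -> X)
    (n : nat) : T -> R :=
  match n with
  | 0 => f0
  | m.+1 => fun t =>
      let g := predictive_recursion w f0 x m in
      (1 - w m) * g t + w m * (p (x m) t * g t / marginal g (x m))
  end.

(* f is the only mixing density on Theta producing the marginal of f. *)
Definition identifiable (f : T -> R) : Prop :=
  forall g, density mu Theta g ->
    {ae nu, forall x, chi x -> marginal g x = marginal f x} ->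
    forall t, Theta t -> g t = f t.

Definition ratio_dominated (chic : set X) (ThetaH : set T) (cu : R) : Prop :=
  forall x, chi x -> ~ chic x ->
    exists t1 t2, [/\ ThetaH t1, ThetaH t2 &
      (ereal_sup [set likelihood_ratio p x t.1 t.2 | t in Theta `*` Theta] <=
       cu%:E * likelihood_ratio p x t2 t1)%E].

Definition ratio_second_moment_bounded (ThetaHat : set T) : Prop :=
  exists B : R,
    (ereal_sup [set \int[nu]_(x in chi)
                      (likelihood_ratio p x t.1.1 t.1.2 ^+ 2 * (p x t.2)%:E)
               | t in ThetaHat `*` ThetaHat `*` ThetaHat] < B%:E)%E.

End mixtures.

Definition ratio_products_bounded {dO dX : measure_display}
    {Omega : measurableType dO} {X : measurableType dX} {T : Type}
    {R : realType} (P : probability Omega R) (ThetaHat : set T)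
    (p : X -> T -> R) (Z : nat -> Omega -> X) (b0 : R) : Prop :=
  forall (n1 n : nat) (j : 'I_n1 -> 'I_n) (t1 t2 : 'I_n1 -> T),
    (n1 <= n)%N -> injective j ->
    (forall l, ThetaHat (t1 l)) -> (forall l, ThetaHat (t2 l)) ->
    (\int[P]_omega
        (\prod_(l < n1) likelihood_ratio p (Z (j l) omega) (t1 l) (t2 l)) ^+ 2
     <= (b0 ^+ (2 * n1))%:E *
        \prod_(l < n1)
           \int[P]_omega
              likelihood_ratio p (Z (j l) omega) (t1 l) (t2 l) ^+ 2)%E.

(* w i is the weight of index i + 1, so it is compared with (i + 1)^(-alpha).
   The bound w i <= 1 makes every iterate of the recursion nonnegative. *)
Definition pr_weights {R : realType} (alpha : R) (w : nat -> R) : Prop :=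
  [/\ forall i, 0 < w i <= 1,
      nonincreasing_seq w,
      w i @[i --> \oo] --> (0 : R) &
      (w i / i.+1%:R `^ (- alpha)) @[i --> \oo] --> (1 : R)].

(* Main.v *)
From HB Require Import structures.
Require Import Defs.
From mathcomp Require Import all_boot all_order all_algebra.
From mathcomp Require Import all_classical all_reals all_analysis measurable_realfun.
From mathcomp Require Import ring lra zify.

Set Implicit Arguments.
Unset Strict Implicit.
Unset Printing Implicit Defensive.

Import Order.TTheory GRing.Theory Num.Theory.
Import numFieldNormedType.Exports.

Local Open Scope classical_set_scope.
Local Open Scope ring_scope.

(** Write [y_n] for the vector of the likelihoods [p (X_n | theta_l)] and [f_n] for the
    vector of the values of the n-th iterate at the points [theta_l]. For a
    nonnegative vector [g], let [h(g, y) = <f, y> / <g, y>] be the likelihood ratio of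
    the true mixture to the mixture [g], and let [R(y)] be the sum of all the ratios
    of two coordinates of [y].

    A step of the recursion multiplies the l-th coordinate by
    [1 + w_n (y_l / <f_n, y> - 1)]. It moves [f_n] by at most [2 w_n] in the l1
    distance, whatever the observation is ([pr_step_dist]), and the
    Kullback-Leibler divergence [K_n] of [f_n] from [f] satisfies
    [K_{n+1} <= K_n + w_n (1 - h(f_n, y_n)) + 2 w_n^2 R(y_n)^2] ([kl_step]). The
    quadratic terms are almost surely summable. For a fixed [g] the mean of
    [h(g, y)] is at least 1, with equality only if [g = f], by identifiability;
    by compactness it exceeds 1 by a fixed margin over all [g] of divergence at
    least [e] ([mean_lratio_gap]). So [K_n] is driven to 0 if [h(f_n, y_n)] may be
    replaced by its mean at a frozen [f_n].

    To freeze [f_n], time is cut into windows of total weight about [d]. Within a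
    window the iterate stays within [4 d] of its value at the beginning of the
    window, which is within [d] of a point [g] of a fixed finite grid. As a function
    of [g], the ratio [h] is bounded by [R] and Lipschitz with constant [R^2], so
    the replacement costs at most [min (R, 5 d R^2)], a square integrable function
    of mean of order [d]. Only fixed functions of the observations remain, so
    the dependence of [f_n] on the past never enters. For each of the countably
    many functions, the centred weighted sums over the windows tend to 0 almost
    surely ([windowed_lln]): the covariances decay geometrically, so the variance
    over a window is at most a constant times the sum of [w_i^2] over it; the
    windows are disjoint and the squares of the weights are summable, hence so are
    the variances. Over each late window that it enters above [e], the divergence
    therefore drops by a fixed multiple of [d], up to an error of order [d^2];
    it ends below a multiple of [e] and stays there ([pr_converges]).

    The covariances come from the law of a pair [(X_i, X_{i+n})]. Its density with
    respect to the product of [nu] with itself is explicit in the component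
    densities and their transition densities, and its excess over the product of
    the marginals is controlled by the mixing integral ([observed_pair_moment]).
    Finally the second moments of the likelihood ratios force the component
    densities to be positive on the same set up to a null set ([ae_support]), so
    that all the ratios are almost surely finite, and they make [R] square
    integrable. *)

(** * Likelihood vectors and one step of the recursion *)

Section likelihood_vectors.
Context {R : realType} {k : nat}.
Implicit Types (f g v y : 'I_k -> R) (w : R).

Definition mix g y : R := \sum_l g l * y l.
Definition spread y : R := \sum_l \sum_l' y l / y l'.
Definition l1dist g g' : R := \sum_l `|g l - g' l|.
(** Grid points obtained by rounding up leave the simplex; the bounds below only
    need the total mass to be at least 1. *)
Definition heavy g : Prop := (forall l, 0 <= g l) /\ 1 <= \sum_l g l.
Definition simplex g : Prop := (forall l, 0 <= g l) /\ \sum_l g l = 1.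
Definition lratio f g y : R := mix f y / mix g y.
(** The bound [c * spread y ^+ 2] alone is merely integrable under the moment
    condition; capping it by [spread y] makes it square integrable. *)
Definition osc (c : R) y : R := Num.min (spread y) (c * spread y ^+ 2).

Lemma simplex_heavy g : simplex g -> heavy g.
Proof. by move=> [g0 g1]; split => //; rewrite g1. Qed.

Lemma heavy_exists g : heavy g -> exists l, 0 < g l.
Proof.
move=> [g0 g1]; apply/existsP; rewrite -[X in is_true X]negbK negb_exists.
apply/negP => /forallP g_le0; move: g1.
rewrite big1 ?ler10// => l _; apply/eqP; rewrite eq_le g0 andbT.
by rewrite leNgt g_le0.
Qed.

Lemma mix_ge0 g y : (forall l, 0 <= g l) -> (forall l, 0 <= y l) -> 0 <= mix g y.
Proof. by move=> g0 y0; apply: sumr_ge0 => l _; rewrite mulr_ge0. Qed.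

Lemma mix_gt0 g y : heavy g -> (forall l, 0 < y l) -> 0 < mix g y.
Proof.
move=> hg y0; have [l gl] := heavy_exists hg.
rewrite /mix (bigD1 l)//= ltr_pwDl ?mulr_gt0// sumr_ge0// => i _.
by rewrite mulr_ge0// ?(proj1 hg)// ltW.
Qed.

Lemma ratio_le_spread y l l' : (forall i, 0 < y i) -> y l / y l' <= spread y.
Proof.
move=> y0; rewrite /spread (bigD1 l)//= (bigD1 l')//=.
have nn i j : 0 <= y i / y j by rewrite divr_ge0 ?ltW.
by rewrite -addrA lerDl addr_ge0// sumr_ge0// => i _; apply: sumr_ge0.
Qed.

Lemma spread_ge0 y : (forall l, 0 <= y l) -> 0 <= spread y.
Proof. by move=> y0; do 2!apply: sumr_ge0 => ? _; rewrite divr_ge0. Qed.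

Lemma spread_ge1 y (l : 'I_k) : (forall i, 0 < y i) -> 1 <= spread y.
Proof. by move=> y0; rewrite -(@divff _ (y l)) ?gt_eqF// ratio_le_spread. Qed.

(** A mixture of mass at least 1 is at least the smallest component, and
    [spread y] dominates every ratio of components. *)
Lemma le_mix_spread g y l : heavy g -> (forall i, 0 < y i) ->
  y l <= spread y * mix g y.
Proof.
move=> [g0 g1] y0; rewrite /mix mulr_sumr.
apply: (@le_trans _ _ (\sum_i g i * y l)).
  by rewrite -mulr_suml ler_peMl// ltW.
apply: ler_sum => i _; rewrite [leRHS]mulrCA ler_wpM2l//.
by rewrite -ler_pdivrMr// ratio_le_spread.
Qed.

Lemma lratio_ge0 f g y : (forall l, 0 <= f l) -> heavy g ->
  (forall i, 0 < y i) -> 0 <= lratio f g y.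
Proof.
move=> f0 hg y0; apply: divr_ge0; last exact/ltW/mix_gt0.
by apply: mix_ge0 => // l; exact: ltW.
Qed.

Lemma lratio_le_spread f g y : simplex f -> heavy g ->
  (forall i, 0 < y i) -> lratio f g y <= spread y.
Proof.
move=> [f0 f1] hg y0; rewrite ler_pdivrMr ?mix_gt0// {1}/mix.
rewrite -[leRHS]mul1r -f1 mulr_suml.
by apply: ler_sum => l _; rewrite ler_wpM2l// le_mix_spread.
Qed.

Lemma lratio_lip f g g' y : simplex f -> heavy g -> heavy g' ->
  (forall i, 0 < y i) ->
  `|lratio f g y - lratio f g' y| <= l1dist g g' * spread y ^+ 2.
Proof.
move=> sf hg hg' y0.
have m0 := mix_gt0 hg y0; have m0' := mix_gt0 hg' y0.
have -> : lratio f g y - lratio f g' y =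
    lratio f g y * ((mix g' y - mix g y) / mix g' y).
  by rewrite /lratio; field; rewrite !gt_eqF.
rewrite normrM ger0_norm ?lratio_ge0 ?(proj1 sf)//; last by case: sf.
have -> : l1dist g g' * spread y ^+ 2 = spread y * (l1dist g g' * spread y).
  by ring.
apply: ler_pM => //; first by apply: lratio_ge0 => //; case: sf.
  exact: lratio_le_spread.
rewrite normrM normfV (gtr0_norm m0') ler_pdivrMr//.
rewrite /l1dist -mulrA mulr_suml /mix -sumrB.
apply: le_trans (ler_norm_sum _ _ _) _; apply: ler_sum => l _.
rewrite -mulrBl normrM distrC (gtr0_norm (y0 l)) ler_wpM2l//.
exact: le_mix_spread.
Qed.

(** Both ratios lie in the interval from 0 to [spread y], which gives the other
    half of the minimum. *)
Lemma lratio_osc f g g' y c : simplex f -> heavy g -> heavy g' ->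
  (forall i, 0 < y i) -> l1dist g g' <= c ->
  `|lratio f g y - lratio f g' y| <= osc c y.
Proof.
move=> sf hg hg' y0 lc; rewrite le_min; apply/andP; split.
  have f0 := proj1 sf.
  have := lratio_ge0 f0 hg y0; have := lratio_ge0 f0 hg' y0.
  have := lratio_le_spread sf hg y0; have := lratio_le_spread sf hg' y0.
  by move=> *; rewrite ler_norml; lra.
by apply: le_trans (lratio_lip _ _ _ _) _ => //; rewrite ler_wpM2r ?sqr_ge0.
Qed.

Definition pr_step w y v : 'I_k -> R :=
  fun l => (1 - w) * v l + w * (y l * v l / mix v y).

Lemma pr_step_simplex w y v : 0 <= w <= 1 -> (forall i, 0 < y i) ->
  simplex v -> simplex (pr_step w y v).
Proof.
move=> /andP[w0 w1] y0 sv; have m0 := mix_gt0 (simplex_heavy sv) y0.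
case: sv => v0 v1; split.
  move=> l; rewrite addr_ge0 ?mulr_ge0// ?subr_ge0// ?invr_ge0 ltW//.
rewrite big_split/= -!mulr_sumr v1 mulr1 -mulr_suml.
under eq_bigr do rewrite mulrC.
by rewrite divff ?gt_eqF// mulr1 subrK.
Qed.

Lemma pr_step_gt0 w y v l : 0 < w <= 1 -> (forall i, 0 < y i) ->
  simplex v -> 0 < v l -> 0 < pr_step w y v l.
Proof.
move=> /andP[w0 w1] y0 sv vl; have m0 := mix_gt0 (simplex_heavy sv) y0.
by rewrite ltr_wpDl ?mulr_ge0 ?mulr_gt0 ?invr_gt0// ?subr_ge0// ltW.
Qed.

(** The posterior weights [v l * y l / mix v y] form a probability vector, so
    a step moves the iterate by a bounded multiple of its weight, whatever the
    observation is. *)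
Lemma pr_step_dist w y v : 0 <= w <= 1 -> (forall i, 0 < y i) ->
  simplex v -> l1dist (pr_step w y v) v <= 2 * w.
Proof.
move=> /andP[w0 w1] y0 sv; have m0 := mix_gt0 (simplex_heavy sv) y0.
case: sv => v0 v1.
apply: (@le_trans _ _ (\sum_l w * (v l + v l * y l / mix v y))).
  apply: ler_sum => l _; rewrite /pr_step.
  have -> : (1 - w) * v l + w * (y l * v l / mix v y) - v l =
     w * (v l * y l / mix v y - v l) by ring.
  rewrite normrM ger0_norm// ler_wpM2l//.
  have v0l := v0 l.
  have q0 : 0 <= v l * y l / mix v y.
    by rewrite divr_ge0 ?(ltW m0)// mulr_ge0// ltW.
  by rewrite ler_norml; lra.
rewrite -mulr_sumr big_split/= v1 -mulr_suml -/(mix v y) divff ?gt_eqF//.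
by rewrite mulrC.
Qed.

Definition kl f v : R := \sum_l f l * ln (f l / v l).

Lemma ln1D_ge (t : R) : - 2^-1 <= t -> t - 2 * t ^+ 2 <= ln (1 + t).
Proof.
move=> ht; have t0 : 0 < 1 + t by lra.
have : ln (1 + t)^-1 <= (1 + t)^-1 - 1.
  have := @le_ln1Dx R ((1 + t)^-1 - 1); rewrite subrKC; apply.
  by rewrite ltrBrDl subrr invr_gt0.
rewrite lnV ?posrE// => le1.
suff : t - 2 * t ^+ 2 <= 1 - (1 + t)^-1 by lra.
have -> : 1 - (1 + t)^-1 = t / (1 + t) by field; rewrite gt_eqF.
rewrite ler_pdivlMr//; nra.
Qed.

(** The l-th coordinate is multiplied by [1 + w * (y l / mix v y - 1)]; the
    bound [ln1D_ge] on the logarithm gives the drift and the quadratic rest,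
    since [`|y l / mix v y - 1| <= spread y]. *)
Lemma kl_step f v y w : simplex f -> simplex v ->
  (forall l, 0 < f l -> 0 < v l) -> (forall i, 0 < y i) -> 0 < w <= 2^-1 ->
  kl f (pr_step w y v) <=
  kl f v + w * (1 - lratio f v y) + 2 * (w ^+ 2 * spread y ^+ 2).
Proof.
move=> [f0 f1] sv fv y0 /andP[w0 w2].
have hv := simplex_heavy sv; have m0 := mix_gt0 hv y0.
have -> : kl f v + w * (1 - lratio f v y) + 2 * (w ^+ 2 * spread y ^+ 2) =
  \sum_l f l * (ln (f l / v l) + w * (1 - y l / mix v y)
                + 2 * (w ^+ 2 * spread y ^+ 2)).
  under [RHS]eq_bigr do rewrite !mulrDr.
  rewrite !big_split/= -[X in _ = _ + X]mulr_suml f1 mul1r; congr (_ + _ + _).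
  rewrite mulrBr mulr1 -[X in _ = X + _]mulr_suml f1 mul1r; congr (_ + _).
  rewrite /lratio {1}/mix mulr_suml mulr_sumr -sumrN.
  by apply: eq_bigr => l _; ring.
apply: ler_sum => l _.
have [->|fl] := eqVneq (f l) 0; first by rewrite !mul0r.
have {}fl : 0 < f l by rewrite lt_neqAle eq_sym fl f0.
rewrite ler_wpM2l//.
have vl := fv _ fl.
set u := y l / mix v y.
have u0 : 0 < u by rewrite divr_gt0.
have us : u <= spread y by rewrite ler_pdivrMr// le_mix_spread.
have s1 := spread_ge1 l y0.
have -> : pr_step w y v l = v l * (1 + w * (u - 1)).
  by rewrite /pr_step /u; field; rewrite gt_eqF.
have t0 : 0 < 1 + w * (u - 1) by nra.
have -> : ln (f l / (v l * (1 + w * (u - 1)))) =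
    ln (f l / v l) - ln (1 + w * (u - 1)).
  by rewrite invfM mulrA lnM ?posrE ?divr_gt0 ?invr_gt0// lnV ?posrE.
have ht : - 2^-1 <= w * (u - 1) by nra.
have := ln1D_ge ht.
have : (w * (u - 1)) ^+ 2 <= w ^+ 2 * spread y ^+ 2.
  rewrite exprMn ler_wpM2l ?sqr_ge0//.
  nra.
lra.
Qed.

(** Through [ln t <= t - 1] at the square root of [v / f], the divergence
    dominates the squared Hellinger distance. *)
Lemma kl_hellinger f v l : simplex f -> simplex v ->
  (forall l, 0 < f l -> 0 < v l) -> (v l - f l) ^+ 2 <= 4 * kl f v.
Proof.
move=> [f0 f1] [v0 v1] fv.
have hell i : 2 * f i - 2 * (Num.sqrt (f i) * Num.sqrt (v i)) <= f i * ln (f i / v i).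
  have [->|fi] := eqVneq (f i) 0; first by rewrite sqrtr0 !mul0r !mulr0 subrr.
  have {}fi : 0 < f i by rewrite lt_neqAle eq_sym fi f0.
  have vi := fv _ fi.
  set s := Num.sqrt (f i); set r := Num.sqrt (v i).
  have s0 : 0 < s by rewrite sqrtr_gt0.
  have r0 : 0 < r by rewrite sqrtr_gt0.
  have -> : f i = s ^+ 2 by rewrite sqr_sqrtr// ltW.
  have -> : v i = r ^+ 2 by rewrite sqr_sqrtr// ltW.
  have -> : s ^+ 2 / r ^+ 2 = (r / s)^-1 ^+ 2.
    by field; rewrite !gt_eqF.
  rewrite lnXn ?invr_gt0 ?divr_gt0// lnV ?posrE ?divr_gt0//.
  have : ln (r / s) <= r / s - 1.
    have := @le_ln1Dx R (r / s - 1); rewrite subrKC; apply.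
    by rewrite ltrBrDl subrr divr_gt0.
  move=> h.
  have -> : 2 * s ^+ 2 - 2 * (s * r) = s ^+ 2 * (- (r / s - 1) *+ 2).
    by field; rewrite gt_eqF.
  by rewrite ler_wpM2l ?sqr_ge0// lerMn2r/= lerN2.
have K : \sum_i (Num.sqrt (f i) - Num.sqrt (v i)) ^+ 2 <= kl f v.
  apply: (@le_trans _ _ (\sum_i (2 * f i - 2 * (Num.sqrt (f i) * Num.sqrt (v i))))).
    have -> : \sum_i (2 * f i - 2 * (Num.sqrt (f i) * Num.sqrt (v i))) =
      \sum_i (f i - 2 * (Num.sqrt (f i) * Num.sqrt (v i)) + v i).
      rewrite big_split/= [in RHS]big_split/= [X in _ = X + _]big_split/=.
      by rewrite v1 -mulr_sumr f1; ring.
    apply: ler_sum => i _.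
    by rewrite sqrrB !sqr_sqrtr// -mulr_natl.
  exact: ler_sum.
have : (Num.sqrt (f l) - Num.sqrt (v l)) ^+ 2 <= kl f v.
  apply: le_trans K; rewrite [leRHS](bigD1 l)//= lerDl sumr_ge0// => i _.
  exact: sqr_ge0.
have fl1 : f l <= 1 by rewrite -f1 (bigD1 l)//= lerDl sumr_ge0.
have vl1 : v l <= 1 by rewrite -v1 (bigD1 l)//= lerDl sumr_ge0.
have s0 := sqrtr_ge0 (f l); have r0 := sqrtr_ge0 (v l).
have s1 : Num.sqrt (f l) <= 1 by rewrite -sqrtr1 ler_wsqrtr.
have r1 : Num.sqrt (v l) <= 1 by rewrite -sqrtr1 ler_wsqrtr.
have -> : (v l - f l) ^+ 2 =
    (Num.sqrt (f l) - Num.sqrt (v l)) ^+ 2 * (Num.sqrt (f l) + Num.sqrt (v l)) ^+ 2.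
  rewrite -[in LHS](@sqr_sqrtr _ (f l))// -[in LHS](@sqr_sqrtr _ (v l))//; ring.
move: s0 r0 s1 r1; set s := Num.sqrt (f l); set r := Num.sqrt (v l).
move=> s0 r0 s1 r1 h; apply: (@le_trans _ _ ((s - r) ^+ 2 * 4)).
  rewrite ler_wpM2l ?sqr_ge0//.
  have : (s + r) ^+ 2 <= 2 ^+ 2 by rewrite ler_pXn2r ?nnegrE//; lra.
  lra.
by rewrite mulrC ler_wpM2l.
Qed.

Lemma kl_le f v e : simplex f -> (forall l, `|v l - f l| <= e) ->
  (forall l, 0 < f l -> 2 * e <= f l) -> kl f v <= 2 * k%:R * e.
Proof.
move=> [f0 f1] ve ef.
have -> : 2 * k%:R * e = \sum_(l < k) (2 * e).
  by rewrite sumr_const card_ord mulrAC mulr_natr.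
apply: ler_sum => l _.
have e0 : 0 <= e by apply: le_trans (ve l).
have [->|fl] := eqVneq (f l) 0; first by rewrite mul0r mulr_ge0.
have {}fl : 0 < f l by rewrite lt_neqAle eq_sym fl f0.
have := ve l; rewrite ler_norml => /andP[ve1 ve2].
have e2 := ef _ fl.
have vf : f l / 2 <= v l by lra.
have vl : 0 < v l by lra.
have : ln (f l / v l) <= f l / v l - 1.
  have := @le_ln1Dx R (f l / v l - 1); rewrite subrKC; apply.
  by rewrite ltrBrDl subrr divr_gt0.
move=> h; apply: (@le_trans _ _ (f l * (f l / v l - 1))).
  by rewrite ler_wpM2l.
have -> : f l * (f l / v l - 1) = f l * (f l - v l) / v l.
  by field; rewrite gt_eqF.
by rewrite ler_pdivrMr//; nra.
Qed.

End likelihood_vectors.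

(** * Windows of bounded total weight *)

Section windows.
Context {R : realType}.
Implicit Types (w x : nat -> R).

Lemma windows_exist w (delta : R) : (forall i, 0 < w i) ->
  w i @[i --> \oo] --> (0 : R) ->
  (forall A : R, exists n, A <= \sum_(0 <= i < n) w i) -> 0 < delta ->
  exists a : nat -> nat,
    [/\ forall j, (a j < a j.+1)%N,
        forall j, delta <= \sum_(a j <= i < a j.+1) w i &
        \forall j \near \oo, \sum_(a j <= i < a j.+1) w i <= 2 * delta].
Proof.
move=> w0 wc wdiv d0.
have ex n : exists m, delta <= \sum_(n <= i < m) w i.
  have [m hm] := wdiv (delta + \sum_(0 <= i < n) w i).
  exists m; have [nm|mn] := leqP n m.
    by move: hm; rewrite (big_cat_nat (leq0n n) nm)/=; lra.
  have : \sum_(0 <= i < m) w i <= \sum_(0 <= i < n) w i.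
    by rewrite (big_cat_nat (leq0n m) (ltnW mn))/= lerDl sumr_ge0// => i _; rewrite ltW.
  by lra.
(* The next window ends as soon as the weight reaches [delta]; by minimality it
   overshoots by at most its last weight, which tends to 0. *)
pose next n := ex_minn (ex n).
have nextP n : [/\ (n < next n)%N, delta <= \sum_(n <= i < next n) w i &
    exists2 i, (n <= i)%N & \sum_(n <= i < next n) w i <= delta + w i].
  rewrite /next; case: ex_minnP => m hm mmin.
  have nm : (n < m)%N.
    by rewrite ltnNge; apply/negP => mn; move: hm; rewrite big_geq// leNgt d0.
  split => //; exists m.-1; first by lia.
  have mS : m = m.-1.+1 by lia.
  rewrite mS big_nat_recr/=; last by lia.
  rewrite lerD2r leNgt; apply/negP => /ltW /mmin; lia.
pose a j := iter j next 0%N; exists a.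
have aS j : a j.+1 = next (a j) by [].
have aj j : (j <= a j)%N.
  elim: j => // j IH; rewrite aS; have [+ _ _] := nextP (a j).
  exact: leq_ltn_trans.
split.
- by move=> j; have [] := nextP (a j).
- by move=> j; have [] := nextP (a j).
- have /cvgrPdist_le /(_ delta d0)[N _ hN] := wc.
  exists N => // j Nj; rewrite aS.
  have [_ _ [i ij /le_trans]] := nextP (a j); apply.
  have := hN i (leq_trans Nj (leq_trans (aj j) ij)).
  by rewrite sub0r normrN ger0_norm ?(ltW (w0 i))//; lra.
Qed.

(** A sequence that drops by a fixed amount whenever it is at least [e], and
    otherwise grows by at most [s], must go below [e] and is then trapped. *)
Lemma eventually_below x (J : nat) (eta e s : R) : 0 < eta -> 0 <= s ->
  (forall j, (J <= j)%N -> e <= x j -> x j.+1 <= x j - eta) ->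
  (forall j, (J <= j)%N -> x j.+1 <= x j + s) ->
  \forall j \near \oo, x j <= e + s.
Proof.
move=> eta0 s0 dec inc.
have [j0 Jj0 xj0] : exists2 j, (J <= j)%N & x j <= e + s.
  apply: contrapT => H.
  have hgt j : (J <= j)%N -> e + s < x j.
    by move=> Jj; rewrite ltNge; apply/negP => xj; apply: H; exists j.
  have lin n : x (J + n)%N <= x J - n%:R * eta.
    elim: n => [|n IH]; first by rewrite addn0 mul0r subr0.
    rewrite addnS (le_trans (dec _ _ _)) ?leq_addr//.
      by have := hgt (J + n)%N (leq_addr _ _); lra.
    by rewrite -natr1; lra.
  pose n := (Num.truncn ((x J - e - s) / eta)).+1.
  have := lin n; have := hgt (J + n)%N (leq_addr _ _).
  have : (x J - e - s) / eta < n%:R by rewrite truncnS_gt.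
  rewrite ltr_pdivrMr//; lra.
exists j0 => // j /= j0j; rewrite -(subnKC j0j).
elim: (j - j0)%N => [|n IH]; first by rewrite addn0.
rewrite addnS; have Jn : (J <= j0 + n)%N by rewrite (leq_trans Jj0) ?leq_addr.
have [ex|xe] := leP e (x (j0 + n)%N).
  by have := dec _ Jn ex; lra.
by have := inc _ Jn; lra.
Qed.

Lemma between_windows (a : nat -> nat) (J n : nat) :
  (forall j, (a j < a j.+1)%N) -> (a J <= n)%N ->
  exists2 j, (J <= j)%N & (a j <= n < a j.+1)%N.
Proof.
move=> aS Jn.
have aj j : (j <= a j)%N.
  by elim: j => // j IH; apply: leq_ltn_trans (aS j).
have ex : exists j, (n < a j)%N by exists n.+1; exact: aj.
have amono : {homo a : i j / (i <= j)%N}.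
  by apply: homo_leq => // [|i]; [exact: leq_trans|exact/ltnW].
case: (ex_minnP ex) => m nm mmin.
have Jm : (J < m)%N.
  by rewrite ltnNge; apply/negP => /amono; lia.
exists m.-1; first by lia.
rewrite prednK ?nm ?andbT; last by lia.
by rewrite leqNgt; apply/negP => /mmin; lia.
Qed.

Lemma bounded_series_windows (u : nat -> R) (C : R) (a : nat -> nat) :
  (forall i, 0 <= u i) -> (forall n, \sum_(0 <= i < n) u i <= C) ->
  (forall j, (a j < a j.+1)%N) ->
  \sum_(a j <= i < a j.+1) u i @[j --> \oo] --> (0 : R).
Proof.
move=> u0 uC aS.
have aj j : (j <= a j)%N.
  by elim: j => // j IH; apply: leq_ltn_trans (aS j).
have : cvgn (series u).
  apply: nondecreasing_is_cvgn.
    by apply/nondecreasing_seqP => n; rewrite /series/= big_nat_recr//= lerDl.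
  by exists C => _ [n _ <-]; exact: uC.
move=> /cauchy_cvgP /cauchy_seriesP cu.
apply/cvgrPdist_lt => e e0; have := cu e e0.
move=> -[[A B] /= [[N _ AN] [M _ BM]] AB].
exists (maxn N M) => // j /= hj.
rewrite sub0r normrN; have := AB (a j, a j.+1); apply; split => /=.
  by apply: AN => /=; have := aj j; lia.
by apply: BM => /=; have := aj j; have := aS j; lia.
Qed.

End windows.

(** * Convergence along a fixed sequence of observations *)

Section pathwise.
Context {R : realType} {k : nat}.
Variables (f : 'I_k -> R) (y : nat -> 'I_k -> R) (w : nat -> R).
Variable v : nat -> 'I_k -> R.
Hypothesis sf : simplex f.
Hypothesis y0 : forall n l, 0 < y n l.
Hypothesis w01 : forall n, 0 < w n <= 1.
Hypothesis wc : w i @[i --> \oo] --> (0 : R).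
Hypothesis sv0 : simplex (v 0%N).
Hypothesis fv0 : forall l, 0 < f l -> 0 < v 0%N l.
Hypothesis vS : forall n l, v n.+1 l = pr_step (w n) (y n) (v n) l.

Let vSE n : v n.+1 = pr_step (w n) (y n) (v n).
Proof. by apply/funext => l; exact: vS. Qed.

Lemma pr_simplex n : simplex (v n).
Proof.
elim: n => // n IH; rewrite vSE; apply: pr_step_simplex => //.
by have /andP[/ltW-> ->] := w01 n.
Qed.

Lemma pr_gt0 n l : 0 < f l -> 0 < v n l.
Proof.
move=> fl; elim: n => [|n IH]; first exact: fv0.
by rewrite vSE; apply: pr_step_gt0 => //; exact: pr_simplex.
Qed.

Lemma pr_support n l : v 0%N l = 0 -> v n l = 0.
Proof.
by move=> v0; elim: n => // n IH; rewrite vS /pr_step IH !(mulr0,mul0r) addr0.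
Qed.

Lemma l1dist_triangle (g h g' : 'I_k -> R) :
  l1dist g g' <= l1dist g h + l1dist h g'.
Proof.
rewrite /l1dist -big_split; apply: ler_sum => l _ /=.
by rewrite -[X in `|X|](subrKA (h l)) ler_normD.
Qed.

Lemma pr_moves n i : (n <= i)%N -> l1dist (v i) (v n) <= 2 * \sum_(n <= t < i) w t.
Proof.
move=> ni; rewrite -(subnKC ni); elim: (i - n)%N => [|d IH].
  rewrite addn0 big_geq// mulr0 /l1dist big1// => l _.
  by rewrite subrr normr0.
rewrite addnS (le_trans (l1dist_triangle _ (v (n + d)%N) _))//.
rewrite big_nat_recr ?leq_addr//= mulrDr addrC lerD// vSE.
apply: pr_step_dist => //; last exact: pr_simplex.
by have /andP[/ltW-> ->] := w01 (n + d)%N.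
Qed.

(* In the application these are the expectations of the likelihood ratio and
   of its oscillation under the law of the observations. *)
Variables (ratio_mean : ('I_k -> R) -> R) (osc_mean : R -> R) (L : R).
Hypothesis L0 : 0 <= L.
Hypothesis ratio_mean_lip : forall g g', heavy g -> heavy g' ->
  `|ratio_mean g - ratio_mean g'| <= L * l1dist g g'.
Hypothesis osc_mean_le : forall c, 0 <= c -> osc_mean c <= c * L.
Hypothesis ratio_mean_gap : forall e, 0 < e -> exists2 c, 0 < c &
  forall g, simplex g -> (forall l, 0 < f l -> 0 < g l) ->
    (forall l, v 0%N l = 0 -> g l = 0) -> e <= kl f g -> 1 + c <= ratio_mean g.
Variable C : R.
Hypothesis sumC : forall n,
  \sum_(0 <= i < n) w i ^+ 2 * spread (y i) ^+ 2 <= C.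

Definition mesh (N : nat) : R := N.+1%:R^-1.
Definition grid (N : nat) (c : 'I_k -> nat) : 'I_k -> R :=
  fun l => (c l)%:R / (k * N.+1)%:R.

(** Rounding up keeps the mass at least 1, so that the bounds for [heavy] vectors
    apply; there are finitely many grid points for each [N]. *)
Lemma grid_above N g : simplex g ->
  exists c : {ffun 'I_k -> 'I_(k * N.+1).+2},
    heavy (grid N (fun l => c l)) /\ l1dist (grid N (fun l => c l)) g <= mesh N.
Proof.
move=> [g0 g1]; pose M : R := (k * N.+1)%:R.
have k0 : (0 < k)%N.
  have [l _] := heavy_exists (simplex_heavy (conj g0 g1)).
  exact: leq_ltn_trans (ltn_ord l).
have M0 : 0 < M by rewrite ltr0n muln_gt0 k0.
pose c := [ffun l => inord (Num.truncn (g l * M)).+1 : 'I_(k * N.+1).+2].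
have cE l : c l = (Num.truncn (g l * M)).+1 :> nat.
  rewrite ffunE inordK// !ltnS truncn_le_nat.
  have gl : g l <= 1 by rewrite -g1 (bigD1 l)//= lerDl sumr_ge0.
  by rewrite -natr1 ltr_pwDr// ler_piMl// ltW.
have le1 l : g l <= grid N (fun l => c l) l.
  by rewrite /grid cE ler_pdivlMr// ltW// truncnS_gt.
have le2 l : grid N (fun l => c l) l <= g l + M^-1.
  rewrite /grid cE ler_pdivrMr// mulrDl mulVf ?gt_eqF// -natr1 lerD2r.
  by rewrite truncn_le mulr_ge0// ltW.
exists c; split; first split.
- by move=> l; rewrite (le_trans _ (le1 l)).
- by rewrite -g1 ler_sum.
- rewrite /l1dist; apply: (@le_trans _ _ (\sum_(l < k) M^-1)).
    apply: ler_sum => l _; have := le1 l; have := le2 l.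
    have : 0 < M^-1 by rewrite invr_gt0.
    move: (grid _ _ _) (M^-1) => x z *; rewrite ler_norml; lra.
  rewrite sumr_const card_ord /mesh /M natrM invfM -[leLHS]mulr_natl mulrA.
  by rewrite divff ?mul1r// pnatr_eq0 -lt0n.
Qed.

(** Within a window of weight at most [2 * mesh N] the iterate moves by at most
    [4 * mesh N]; rounding its starting value adds one more [mesh N]. *)
Definition osc_width (N : nat) : R := 5 * mesh N.

Variable a : nat -> nat -> nat.
Hypothesis a_mono : forall N j, (a N j < a N j.+1)%N.
Hypothesis a_ge : forall N j, mesh N <= \sum_(a N j <= i < a N j.+1) w i.
Hypothesis a_le : forall N,
  \forall j \near \oo, \sum_(a N j <= i < a N j.+1) w i <= 2 * mesh N.
Hypothesis lln_ratio : forall N (c : {ffun 'I_k -> 'I_(k * N.+1).+2}),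
  heavy (grid N (fun l => c l)) ->
  \sum_(a N j <= i < a N j.+1) w i * (lratio f (grid N (fun l => c l)) (y i)
                              - ratio_mean (grid N (fun l => c l))) @[j --> \oo] --> (0 : R).
Hypothesis lln_osc : forall N,
  \sum_(a N j <= i < a N j.+1) w i * (osc (osc_width N) (y i)
                              - osc_mean (osc_width N)) @[j --> \oo] --> (0 : R).

Let K n := kl f (v n).
Let rem i := w i ^+ 2 * spread (y i) ^+ 2.

Lemma mesh_gt0 N : 0 < mesh N.
Proof. by rewrite invr_gt0. Qed.

Lemma rem_ge0 i : 0 <= rem i.
Proof. by rewrite mulr_ge0 ?sqr_ge0. Qed.

Lemma kl_telescope n n' : (n <= n')%N ->
  (forall i, (n <= i)%N -> w i <= 2^-1) ->
  K n' <= K n + \sum_(n <= i < n') w i * (1 - lratio f (v i) (y i))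
          + 2 * \sum_(n <= i < n') rem i.
Proof.
move=> nn' wn; rewrite -(subnKC nn'); elim: (n' - n)%N => [|d IH].
  by rewrite addn0 !big_geq// mulr0 !addr0.
rewrite addnS !big_nat_recr ?leq_addr//=.
have := @kl_step _ _ f (v (n + d)) (y (n + d)) (w (n + d)) sf
  (pr_simplex _) (fun l => @pr_gt0 (n + d) l) (y0 _).
rewrite wn ?leq_addr// andbT => /(_ (proj1 (andP (w01 _)))).
rewrite -vSE -/(K _) -/(K _).
rewrite /rem in IH *; lra.
Qed.

(** Likelihood ratios are nonnegative, so the drift is at most the weight. *)
Lemma kl_within_window n n' : (n <= n')%N ->
  (forall i, (n <= i)%N -> w i <= 2^-1) ->
  K n' <= K n + \sum_(n <= i < n') w i + 2 * \sum_(n <= i < n') rem i.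
Proof.
move=> nn' wn; apply: le_trans (kl_telescope nn' wn) _.
rewrite lerD2r lerD2l; apply: ler_sum => i _.
have w0 : 0 < w i by have /andP[] := w01 i.
rewrite ler_piMr ?(ltW w0)// gerDl oppr_le0.
by apply: lratio_ge0 (y0 i); [case: sf|exact/simplex_heavy/pr_simplex].
Qed.

(** Over a window the ratio at the moving iterate is replaced by the ratio at a
    fixed grid point, at the price of the oscillation; both are then centred.
    What remains is the mean drift, of order the weight of the window, against
    an error quadratic in [mesh N]. *)
Lemma kl_over_window N j (c : {ffun 'I_k -> 'I_(k * N.+1).+2}) (eta : R) :
  let g := grid N (fun l => c l) in
  heavy g -> l1dist g (v (a N j)) <= mesh N ->
  (forall i, (a N j <= i)%N -> w i <= 2^-1) ->
  \sum_(a N j <= i < a N j.+1) w i <= 2 * mesh N ->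
  0 <= eta -> 1 + eta <= ratio_mean (v (a N j)) ->
  K (a N j.+1) <= K (a N j) - mesh N * eta + 12 * L * mesh N ^+ 2
    - \sum_(a N j <= i < a N j.+1) w i * (lratio f g (y i) - ratio_mean g)
    + \sum_(a N j <= i < a N j.+1) w i * (osc (osc_width N) (y i)
                                   - osc_mean (osc_width N))
    + 2 * \sum_(a N j <= i < a N j.+1) rem i.
Proof.
move=> g hg gv wn Wle eta0 Teta.
have aa : (a N j <= a N j.+1)%N by exact/ltnW.
apply: le_trans (kl_telescope aa wn) _.
rewrite lerD2r -!addrA lerD2l !addrA.
set W := \sum_(a N j <= i < a N j.+1) w i in Wle *.
have Wge : mesh N <= W by exact: a_ge.
have m0 := mesh_gt0 N.
have eo0 : osc_mean (osc_width N) <= 5 * mesh N * L.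
  by apply: osc_mean_le; rewrite mulr_ge0// ltW.
have Tg : ratio_mean (v (a N j)) <= ratio_mean g + L * mesh N.
  have := ratio_mean_lip (simplex_heavy (pr_simplex (a N j))) hg.
  rewrite ler_norml => /andP[_]; rewrite lerBlDl => /le_trans; apply.
  rewrite lerD2l ler_wpM2l//.
  by rewrite /l1dist in gv *; under eq_bigr do rewrite distrC.
apply: (@le_trans _ _ (W * (1 - ratio_mean g + osc_mean (osc_width N))
    - \sum_(a N j <= i < a N j.+1) w i * (lratio f g (y i) - ratio_mean g)
    + \sum_(a N j <= i < a N j.+1) w i * (osc (osc_width N) (y i)
                                   - osc_mean (osc_width N)))).
  rewrite /W mulr_suml -sumrN -!big_split/=.
  apply: ler_sum_nat => i /andP[ai ia].
  have w0 : 0 < w i by have /andP[] := w01 i.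
  have : 1 - lratio f (v i) (y i) <= 1 - lratio f g (y i) + osc (osc_width N) (y i).
    have : l1dist (v i) g <= osc_width N.
      apply: le_trans (l1dist_triangle _ (v (a N j)) _) _.
      have := pr_moves ai.
      have : \sum_(a N j <= t < i) w t <= W.
        rewrite /W (big_cat_nat ai (ltnW ia))/= lerDl sumr_ge0// => t _.
        by have /andP[/ltW] := w01 t.
      have : l1dist (v (a N j)) g <= mesh N.
        by rewrite /l1dist in gv *; under eq_bigr do rewrite distrC.
      by rewrite /osc_width; lra.
    move=> /(lratio_osc sf (simplex_heavy (pr_simplex i)) hg (y0 i)).
    rewrite ler_norml => /andP[]; lra.
  move=> /(ler_wpM2l (ltW w0)); lra.
rewrite !lerD2r.
have : W * (1 - ratio_mean g + osc_mean (osc_width N)) <= W * (- eta + 6 * L * mesh N).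
  by rewrite ler_wpM2l ?(le_trans (ltW m0))//; lra.
move=> /le_trans; apply.
have : mesh N * eta <= W * eta by rewrite ler_wpM2r.
have : W * (6 * L * mesh N) <= (2 * mesh N) * (6 * L * mesh N).
  by rewrite ler_wpM2r// !mulr_ge0// ltW.
rewrite expr2; lra.
Qed.

(** Given [e], the mesh is chosen so that the quadratic error of a window is a
    fraction of the drift forced by [ratio_mean_gap]; the centred sums are
    eventually negligible, uniformly over the finite grid. Hence the divergence
    drops by a fixed amount over each late window that it enters above [e]. *)
Theorem pr_converges l : v n l @[n --> \oo] --> f l.
Proof.
(* Windows start below [4 * e] eventually, and inside a window the divergence grows
   by at most [3 * e]. *)
suff Ksmall e : 0 < e -> \forall n \near \oo, K n <= 7 * e.
  apply/cvgrPdist_le => e e0.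
  have e280 : 0 < e ^+ 2 / 28 by rewrite divr_gt0// exprn_gt0.
  apply: filterS (Ksmall _ e280) => n Kn.
  have := kl_hellinger l sf (pr_simplex n) (fun l => @pr_gt0 n l).
  rewrite -/(K n) distrC => h.
  rewrite -(@ler_pXn2r _ 2) ?nnegrE ?normr_ge0 ?(ltW e0)// real_normK ?num_real//.
  lra.
move=> e0.
have [c c0 hc] := ratio_mean_gap e0.
have [N hN1 hN2] : exists2 N, 12 * L * mesh N <= c / 4 & mesh N <= e.
  pose A := 48 * L / c + e^-1.
  have e1 : 0 < e^-1 by rewrite invr_gt0.
  have Lc : 0 <= 48 * L / c by rewrite divr_ge0 ?mulr_ge0// ltW.
  have hA : A < (Num.truncn A).+1%:R by exact: truncnS_gt.
  exists (Num.truncn A); rewrite /mesh.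
    rewrite ler_pdivrMr// -ler_pdivrMl ?divr_gt0//.
    rewrite (_ : (c / 4)^-1 * (12 * L) = 48 * L / c); last first.
      by field; rewrite gt_eqF.
    by rewrite ltW// (le_lt_trans _ hA)// lerDl ltW.
  rewrite -[leRHS]invrK lef_pV2 ?posrE//.
  by rewrite ltW// (le_lt_trans _ hA)// lerDr.
have m0 := mesh_gt0 N.
have e1 : 0 < mesh N * c / 16 by rewrite !mulr_gt0// invr_gt0.
have e2 : 0 < Num.min (mesh N * c / 16) (e / 2).
  by rewrite lt_min e1 divr_gt0.
have rem_cvg : \sum_(a N j <= i < a N j.+1) rem i @[j --> \oo] --> (0 : R).
  by apply: (@bounded_series_windows _ _ C) => //; exact: rem_ge0.
have E1 : \forall j \near \oo, forall d : {ffun 'I_k -> 'I_(k * N.+1).+2},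
    heavy (grid N (fun l => d l)) ->
    `|\sum_(a N j <= i < a N j.+1) w i * (lratio f (grid N (fun l => d l)) (y i)
        - ratio_mean (grid N (fun l => d l)))| <= mesh N * c / 16.
  apply: filter_forall => c'.
  have [h|h] := pselect (heavy (grid N (fun l => c' l))); last exact: nearW.
  have /cvgrPdist_le/(_ _ e1) := lln_ratio h.
  by apply: filterS => j; rewrite sub0r normrN.
have /cvgrPdist_le/(_ _ e1) E2 := @lln_osc N.
have /cvgrPdist_le/(_ _ e2) E3 := rem_cvg.
have h2 : (0 : R) < 2^-1 by [].
have /cvgrPdist_le/(_ _ h2) E4 := wc.
have [J HJ] : exists J, forall j, (J <= j)%N ->
    [/\ forall i, (a N j <= i)%N -> w i <= 2^-1,
        \sum_(a N j <= i < a N j.+1) w i <= 2 * mesh N,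
        forall d : {ffun 'I_k -> 'I_(k * N.+1).+2},
          heavy (grid N (fun l => d l)) ->
          `|\sum_(a N j <= i < a N j.+1) w i * (lratio f (grid N (fun l => d l)) (y i)
        - ratio_mean (grid N (fun l => d l)))| <= mesh N * c / 16,
        `|\sum_(a N j <= i < a N j.+1) w i * (osc (osc_width N) (y i)
             - osc_mean (osc_width N))| <= mesh N * c / 16 &
        \sum_(a N j <= i < a N j.+1) rem i <= Num.min (mesh N * c / 16) (e / 2)].
  have [J1 _ H1] := E1; have [J2 _ H2] := E2; have [J3 _ H3] := E3.
  have [J4 _ H4] := E4; have [J5 _ H5] := a_le N.
  exists (maxn J1 (maxn J2 (maxn J3 (maxn J4 J5)))) => j hj; split.
  - move=> i ai.
    have aj : (j <= a N j)%N.
      by elim: (j) => // j' IH; apply: leq_ltn_trans (a_mono _ _).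
    have /= : `|0 - w i| <= 2^-1 by apply: H4 => /=; lia.
    by rewrite sub0r normrN; apply: le_trans; exact: ler_norm.
  - by apply: H5 => /=; lia.
  - by apply: H1 => /=; lia.
  - by have := H2 j; rewrite /= sub0r normrN; apply; lia.
  - have : `|0 - \sum_(a N j <= i < a N j.+1) rem i| <= Num.min (mesh N * c / 16) (e / 2).
      by apply: H3 => /=; lia.
    by rewrite sub0r normrN; apply: le_trans; exact: ler_norm.
have inc j n : (J <= j)%N -> (a N j <= n <= a N j.+1)%N ->
    K n <= K (a N j) + 3 * e.
  move=> /HJ[wn Wle _ _ +] /andP[an na]; rewrite le_min => /andP[_ rle].
  have := kl_within_window an wn.
  have : \sum_(a N j <= i < n) w i <= 2 * mesh N.
    apply: le_trans Wle; rewrite (big_cat_nat an na)/= lerDl sumr_ge0// => i _.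
    by have /andP[/ltW] := w01 i.
  have : \sum_(a N j <= i < n) rem i <= e / 2.
    apply: le_trans rle; rewrite (big_cat_nat an na)/= lerDl sumr_ge0// => i _.
    exact: rem_ge0.
  by lra.
have dec j : (J <= j)%N -> e <= K (a N j) ->
    K (a N j.+1) <= K (a N j) - mesh N * c / 4.
  move=> /HJ[wn Wle lr lo +] Ke; rewrite le_min => /andP[rle _].
  have [c' [hg gv]] := grid_above N (pr_simplex (a N j)).
  have Tc : 1 + c <= ratio_mean (v (a N j)).
    apply: hc => //; first exact: pr_simplex.
      by move=> l' fl; exact: pr_gt0.
    by move=> l' v0; exact: pr_support.
  have := kl_over_window hg gv wn Wle (ltW c0) Tc.
  have := lr _ hg; rewrite ler_norml => /andP[lr1 lr2].
  move: lo; rewrite ler_norml => /andP[lo1 lo2].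
  have : 12 * L * mesh N ^+ 2 <= mesh N * c / 4.
    have -> : 12 * L * mesh N ^+ 2 = mesh N * (12 * L * mesh N) by ring.
    by rewrite -[leRHS]mulrA ler_wpM2l ?(ltW m0)//.
  by lra.
have [J' _ HJ'] : \forall j \near \oo, K (a N j) <= e + 3 * e.
  apply: (@eventually_below _ (fun j => K (a N j)) J (mesh N * c / 4)).
  - by rewrite !mulr_gt0// invr_gt0.
  - by rewrite mulr_ge0// ltW.
  - exact: dec.
  - by move=> j Jj; apply: inc => //; rewrite leqnn ltnW.
exists (a N (maxn J J')) => // n /= an.
have [j Jj /andP[jn nj]] := between_windows (a_mono N) an.
have := inc j n; rewrite jn (ltnW nj) => /(_ _ isT) h.
have := HJ' j; rewrite /= => h'.
have := h _; have := h' _; move: Jj; rewrite geq_max => /andP[-> ->] /(_ isT) + /(_ isT).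
by lra.
Qed.

End pathwise.

(** * Integration against densities *)

Section integrals.
Local Open Scope ereal_scope.
Context {d : measure_display} {T : measurableType d} {R : realType}.
Import HBNNSimple.

(** The integral of a nonnegative function is a supremum over the simple functions
    below it, hence is monotone with no measurability assumption. This serves
    for integrands that involve extended-real quotients. *)
Lemma le_integral_sup (mu : {measure set T -> \bar R}) (D : set T)
    (f g : T -> \bar R) :
  (forall x, D x -> 0 <= f x) -> (forall x, D x -> f x <= g x) ->
  \int[mu]_(x in D) f x <= \int[mu]_(x in D) g x.
Proof.
move=> f0 fg; rewrite !(integral_mkcond D).
have f0' x : 0 <= (f \_ D) x by apply: erestrict_ge0.
have fg' x : (f \_ D) x <= (g \_ D) x by apply: lee_restrict.
rewrite !ge0_integralTE//; last by move=> x; apply: le_trans (fg' x).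
apply: le_ereal_sup => _ [h hf <-]; exists h => // x.
exact: le_trans (hf x) (fg' x).
Qed.

Lemma integral_density (mu1 mu2 : {measure set T -> \bar R}) (k : T -> R)
    (g : T -> \bar R) :
  (forall x, (0 <= k x)%R) -> measurable_fun setT k ->
  (forall A, measurable A -> mu1 A = \int[mu2]_(x in A) (k x)%:E) ->
  measurable_fun setT g -> (forall x, 0 <= g x) ->
  \int[mu1]_x g x = \int[mu2]_x (g x * (k x)%:E).
Proof.
move=> k0 mk mu12 mg g0.
pose h := nnsfun_approx measurableT mg.
have hg x : (h n x)%:E @[n --> \oo] --> g x.
  by apply: cvg_nnsfun_approx => // y _; exact: g0.
have ndh m n x : (m <= n)%N -> (h m x <= h n x)%R.
  by move=> mn; exact/lefP/nd_nnsfun_approx.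
have mEk : measurable_fun setT (EFin \o k) by exact/measurable_EFinP.
transitivity (limn (fun n => \int[mu1]_x (h n x)%:E)).
  rewrite -monotone_convergence//.
  - by apply: eq_integral => x _; apply/esym/cvg_lim => //; exact: hg.
  - by move=> n; exact/measurable_EFinP.
  - by move=> n x _; rewrite lee_fin.
  - by move=> x _ m n mn; rewrite lee_fin; exact: ndh.
transitivity (limn (fun n => \int[mu2]_x ((h n x)%:E * (k x)%:E))); last first.
  rewrite -monotone_convergence//.
  - apply: eq_integral => x _; apply/cvg_lim => //; exact: cvgeZr.
  - by move=> n; apply: emeasurable_funM => //; exact/measurable_EFinP.
  - by move=> n x _; rewrite mule_ge0// lee_fin.
  - by move=> x _ m n mn; rewrite lee_wpmul2r ?lee_fin//; exact: ndh.
congr (limn _); apply/funext => n.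
rewrite integralT_nnsfun sintegralE.
transitivity (\int[mu2]_x (\sum_(r \in range (h n))
    (r%:E * ((\1_(h n @^-1` [set r]) x)%:E * (k x)%:E)))).
  rewrite ge0_integral_fsum//; last 2 first.
  - move=> r; apply: emeasurable_funM => //; apply: emeasurable_funM => //.
    exact/measurable_EFinP.
  - move=> r x _; rewrite muleA mule_ge0// ?lee_fin//.
    exact: nnfun_muleindic_ge0.
  apply: eq_fsbigr => r /set_mem [x _ rx].
  rewrite ge0_integralZl_EFin//.
  - rewrite mu12//; congr (_ * _).
    rewrite [LHS]integral_mkcond; apply: eq_integral => y _.
    rewrite patchE indicE; case: ifP => yh; rewrite ?(mem_set, yh) ?mul1e ?mul0e//.
  - by move=> y _; rewrite mule_ge0// lee_fin.
  - by apply: emeasurable_funM => //; exact/measurable_EFinP.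
  - by rewrite -rx.
apply: eq_integral => x _; rewrite [in RHS]fimfunE -fsumEFin//.
rewrite ge0_mule_fsuml//; last by move=> r; exact: nnfun_muleindic_ge0.
by apply: eq_fsbigr => r _; rewrite muleA.
Qed.

(** The sum of the series has a finite expectation. *)
Lemma ae_bounded_series (P : probability T R) (u : nat -> T -> R) (C : R) :
  (forall i, measurable_fun setT (u i)) -> (forall i x, (0 <= u i x)%R) ->
  (forall n, \sum_(0 <= i < n) \int[P]_x (u i x)%:E <= C%:E) ->
  {ae P, forall x, exists C' : R,
    forall n, (\sum_(0 <= i < n) u i x <= C')%R}.
Proof.
move=> mu u0 uC.
pose S x := \sum_(0 <= i <oo) (u i x)%:E.
have S0 x : 0 <= S x by apply: nneseries_ge0 => i _ _; rewrite lee_fin.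
have mE i : measurable_fun setT (EFin \o u i) by exact/measurable_EFinP.
have iS : \int[P]_x S x <= C%:E.
  rewrite /S integral_nneseries//; last by move=> i x _; rewrite lee_fin.
  apply: lime_le; last by apply: nearW => n; exact: uC.
  apply: is_cvg_nneseries => i _ _; apply: integral_ge0 => x _.
  by rewrite lee_fin.
have mS : measurable_fun setT S.
  rewrite /S (_ : (fun x => _) =
      (fun x => \sum_(0 <= i <oo | i \in xpredT) (u i x)%:E)); last first.
    by apply/funext => x; apply: eq_eseriesl.
  apply: ge0_emeasurable_sum => [i x _ _|i _]; last exact: mE.
  by rewrite lee_fin.
have : P.-integrable setT S.
  apply/integrableP; split => //.
  under eq_integral do rewrite gee0_abs//.
  by apply: le_lt_trans iS _; rewrite ltry.
move=> /(integrable_ae measurableT); apply: filterS => x /(_ Logic.I) Sfin.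
exists (fine (S x)) => n; rewrite -lee_fin fineK//.
rewrite -sumEFin; apply: nneseries_lim_ge => i _ _; exact: u0.
Qed.

Lemma ae_forall_countable (P : {measure set T -> \bar R}) (I : countType)
    (Q : I -> T -> Prop) :
  (forall i, {ae P, forall x, Q i x}) -> {ae P, forall x, forall i, Q i x}.
Proof.
move=> PQ.
have : {ae P, forall x, forall n, if unpickle n is Some i then Q i x else True}.
  by apply/ae_foralln => n; case: unpickle => [i|]; [exact: PQ|exact: aeW].
apply: filterS => x H i; have := H (pickle i); by rewrite pickleK.
Qed.

End integrals.

Section density_measure.
Context {d : measure_display} {T : measurableType d} {R : realType}.
Local Open Scope ereal_scope.
Variables (mu : {measure set T -> \bar R}) (k : T -> R).
Hypotheses (k0 : forall x, (0 <= k x)%R) (mk : measurable_fun setT k).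

(** The proofs are arguments so that the instance below can find them. *)
Definition with_density (_ : forall x, (0 <= k x)%R)
  (_ : measurable_fun setT k) (A : set T) : \bar R :=
  \int[mu]_(x in A) (k x)%:E.

Let nu := with_density k0 mk.

Let nu0 : nu set0 = 0. Proof. exact: integral_set0. Qed.

Let nu_ge0 A : 0 <= nu A.
Proof. by apply: integral_ge0 => x _; rewrite lee_fin. Qed.

Let nu_sigma_additive : semi_sigma_additive nu.
Proof.
move=> F mF tF mUF; rewrite /nu /with_density ge0_integral_bigcup//.
- apply: (@is_cvg_nneseries _ (fun i => \int[mu]_(x in F i) (k x)%:E)).
  by move=> i _ _; exact: nu_ge0.
- by apply/measurable_EFinP; apply: measurable_funTS.
- by move=> x _; rewrite lee_fin.
Qed.

HB.instance Definition _ := isMeasure.Build _ _ _ nu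
  nu0 nu_ge0 nu_sigma_additive.

End density_measure.

Section rectangles.
Context {d1 d2 : measure_display} {T1 : measurableType d1}
  {T2 : measurableType d2} {R : realType}.
Local Open Scope ereal_scope.

Lemma measure_rectangles_unique (m1 m2 : {measure set (T1 * T2) -> \bar R}) :
  m1 setT < +oo ->
  (forall A B, measurable A -> measurable B -> m1 (A `*` B) = m2 (A `*` B)) ->
  forall C, measurable C -> m1 C = m2 C.
Proof.
move=> m1T m12 C mC.
apply: (measure_unique [set A `*` B | A in measurable & B in measurable]
  (fun=> setT)) => //.
- exact: measurable_prod_measurableType.
- move=> _ _ [A mA [B mB <-]] [A' mA' [B' mB' <-]]; rewrite -setXI.
  by exists (A `&` A'); [exact: measurableI|exists (B `&` B') => //; exact: measurableI].
- by move=> _; exists setT => //; exists setT => //; rewrite setXTT.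
- by rewrite bigcup_const//; exists 0%N.
- by move=> _ [A mA [B mB <-]]; exact: m12.
Qed.

Context {dO : measure_display} {Omega : measurableType dO}.
Variable P : probability Omega R.
Variables (nu1 : {sigma_finite_measure set T1 -> \bar R})
  (nu2 : {sigma_finite_measure set T2 -> \bar R}).
Variables (U : Omega -> T1) (V : Omega -> T2) (q : T1 * T2 -> R).
Hypotheses (mU : measurable_fun setT U) (mV : measurable_fun setT V).
Hypotheses (q0 : forall z, (0 <= q z)%R) (mq : measurable_fun setT q).
Hypothesis law : forall A B, measurable A -> measurable B ->
  P (U @^-1` A `&` V @^-1` B) =
  \int[nu1]_(x in A) \int[nu2]_(y in B) (q (x, y))%:E.

Let UV omega := (U omega, V omega).
Let mUV : measurable_fun setT UV. Proof. exact: measurable_fun_pair. Qed.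
Let UV_mixin := isMeasurableFun.Build _ _ _ _ UV mUV.
Let UV_pack : {mfun Omega >-> (T1 * T2)%type} := HB.pack UV UV_mixin.

(** The law of the pair and the measure with density [q] agree on rectangles, which
    generate the product sigma-algebra and are stable under intersection. *)
Lemma expectation_pair (g : T1 * T2 -> \bar R) :
  measurable_fun setT g -> (forall z, 0 <= g z) ->
  \int[P]_omega g (U omega, V omega) =
  \int[nu1 \x nu2]_z (g z * (q z)%:E).
Proof.
move=> mg g0.
have mqE : measurable_fun setT (EFin \o q) by exact/measurable_EFinP.
have law_rect A B : measurable A -> measurable B ->
    distribution P UV_pack (A `*` B) = with_density (nu1 \x nu2) q0 mq (A `*` B).
  move=> mA mB; rewrite /distribution /pushforward/=.
  rewrite (_ : UV @^-1` (A `*` B) = U @^-1` A `&` V @^-1` B)//.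
  rewrite law// /with_density [RHS]integral_mkcond.
  rewrite fubini_tonelli1//; last 2 first.
  - by apply/(measurable_restrictT _ (measurableX mA mB)); exact: measurable_funTS.
  - by move=> z; apply: erestrict_ge0 => z' _; rewrite lee_fin.
  rewrite [LHS]integral_mkcond; apply: eq_integral => x _.
  rewrite patchE; case: ifPn => xA.
    rewrite [LHS]integral_mkcond; apply: eq_integral => y _.
    rewrite !patchE; case: ifPn => yB.
      by rewrite (mem_set (conj (set_mem xA) (set_mem yB) : (A `*` B) (x, y))).
    by rewrite memNset//; case=> /= _; rewrite notin_setE in yB.
  apply/esym/integral0_eq => y _; rewrite patchE memNset//.
  by case=> /= + _; rewrite notin_setE in xA.
have lawUV C : measurable C -> distribution P UV_pack C = \int[nu1 \x nu2]_(z in C) (q z)%:E.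
  move=> mC.
  apply: (@measure_rectangles_unique (distribution P UV_pack)
     (with_density (nu1 \x nu2) q0 mq)) => //.
  by rewrite /= /distribution /pushforward preimage_setT probability_setT ltry.
transitivity (\int[distribution P UV_pack]_z g z).
  by rewrite ge0_integral_pushforward.
exact: (integral_density q0 mq lawUV).
Qed.

End rectangles.

(** * A law of large numbers over windows *)

Section windowed_lln.
Context {R : realType} {dO : measure_display} {Omega : measurableType dO}.
Variable P : probability Omega R.

Definition gap (i j : nat) : nat := (i - j + (j - i))%N.

(** The sum from 0 to [n], times [1 - rho], is bounded by induction on [n]: up to [i]
    the exponents decrease and the geometric sum is exact up to [rho ^+ i.+1],
    beyond [i] they increase from 0. *)
Lemma geometric_gap_sum (rho : R) (i m n : nat) : 0 < rho < 1 ->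
  \sum_(m <= j < n) rho ^+ gap i j <= 2 / (1 - rho).
Proof.
move=> /andP[r0 r1]; have r10 : 0 < 1 - rho by rewrite subr_gt0.
apply: (@le_trans _ _ (\sum_(0 <= j < n) rho ^+ gap i j)).
  have [mn|/ltnW nm] := leqP m n; last first.
    by rewrite big_geq// sumr_ge0// => j _; rewrite exprn_ge0// ltW.
  rewrite [leRHS](big_cat_nat (leq0n m) mn)/= lerDr sumr_ge0// => j _.
  by rewrite exprn_ge0// ltW.
rewrite ler_pdivlMr// mulrC.
suff H : (1 - rho) * \sum_(0 <= j < n) rho ^+ gap i j <=
    if (n <= i)%N then rho ^+ (i.+1 - n) else 2 - rho ^+ (n - i).
  apply: le_trans H _; case: ifP => _.
    by apply: (@le_trans _ _ 1); [rewrite exprn_ile1// ltW|rewrite ler1n].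
  by rewrite gerDl oppr_le0 exprn_ge0// ltW.
elim: n => [|n IH]; first by rewrite big_geq// mulr0 exprn_ge0// ltW.
rewrite big_nat_recr//= mulrDr; move: IH; case: (ltngtP n i) => ni IH.
- have -> : gap i n = (i - n)%N by rewrite /gap; lia.
  have e1 : (i.+1 - n = (i - n).+1)%N by lia.
  have e2 : (i.+1 - n.+1 = i - n)%N by lia.
  rewrite e1 exprS in IH; rewrite e2; lra.
- have -> : gap i n = (n - i)%N by rewrite /gap; lia.
  have e1 : (n.+1 - i = (n - i).+1)%N by lia.
  rewrite e1 exprS.
  have : 0 <= rho ^+ (n - i) by rewrite exprn_ge0// ltW.
  nra.
- subst n; have -> : gap i i = 0%N by rewrite /gap subnn.
  move: IH; rewrite subSnn expr1 expr0 => IH.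
  lra.
Qed.

Variables (Y : nat -> Omega -> R) (e C rho : R) (w : nat -> R).
Hypothesis mY : forall i, measurable_fun setT (Y i).
Hypothesis Y0 : forall i omega, 0 <= Y i omega.
Hypothesis e0 : 0 <= e.
Hypothesis C0 : 0 <= C.
Hypothesis rho01 : 0 < rho < 1.
Hypothesis meanY : forall i, (\int[P]_omega (Y i omega)%:E = e%:E)%E.
Hypothesis covY : forall i j,
  (\int[P]_omega (Y i omega * Y j omega)%:E <= (e ^+ 2 + C * rho ^+ gap i j)%:E)%E.
Hypothesis w0 : forall i, 0 <= w i.

(** The cross terms are bounded by [w i * w j <= (w i ^+ 2 + w j ^+ 2) / 2], after
    which the geometric factors are summed in one of the two indices. All the
    integrals are of nonnegative functions: the square of the centred sum is
    completed by [2 * M * S] before integrating. *)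
Lemma window_second_moment m n :
  (\int[P]_omega ((\sum_(m <= i < n) w i * (Y i omega - e)) ^+ 2)%:E <=
   (2 * C / (1 - rho) * \sum_(m <= i < n) w i ^+ 2)%:E)%E.
Proof.
have /andP[r0 r1] := rho01; have r10 : 0 < 1 - rho by rewrite subr_gt0.
set B := 2 * C / (1 - rho) * \sum_(m <= i < n) w i ^+ 2.
pose S omega := \sum_(m <= i < n) w i * Y i omega.
pose M := \sum_(m <= i < n) w i * e.
have M0 : 0 <= M by apply: sumr_ge0 => i _; rewrite mulr_ge0.
have mS : measurable_fun setT S.
  by apply: measurable_sum => i; exact: measurable_funM.
have S0 omega : 0 <= S omega by apply: sumr_ge0 => i _; rewrite mulr_ge0.
have SM omega : \sum_(m <= i < n) w i * (Y i omega - e) = S omega - M.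
  by rewrite -sumrB; apply: eq_bigr => i _; rewrite mulrBr.
under eq_integral do rewrite SM.
have mE (h : Omega -> R) : measurable_fun setT h ->
  measurable_fun setT (fun x => (h x)%:E) by move=> ?; exact/measurable_EFinP.
have iS : (\int[P]_omega (S omega)%:E = M%:E)%E.
  transitivity (\sum_(m <= i < n) \int[P]_omega (w i * Y i omega)%:E)%E.
    rewrite -ge0_integral_sum//.
    - by apply: eq_integral => omega _; rewrite sumEFin.
    - by move=> i; apply: mE; exact: measurable_funM.
    - by move=> i omega _; rewrite lee_fin mulr_ge0.
  rewrite -sumEFin; apply: eq_bigr => i _.
  under eq_integral do rewrite EFinM.
  rewrite ge0_integralZl_EFin//; first by rewrite meanY.
  - by move=> omega _; rewrite lee_fin.
  - exact: mE.
have iS2 : (\int[P]_omega (S omega ^+ 2)%:E <= (M ^+ 2 + B)%:E)%E.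
  have -> : (\int[P]_omega (S omega ^+ 2)%:E =
     \sum_(m <= i < n) \sum_(m <= j < n)
       (w i * w j)%:E * \int[P]_omega (Y i omega * Y j omega)%:E)%E.
    transitivity (\int[P]_omega (\sum_(m <= i < n) \sum_(m <= j < n)
       (w i * w j)%:E * (Y i omega * Y j omega)%:E))%E.
      apply: eq_integral => omega _; rewrite expr2 /S mulr_suml -sumEFin.
      apply: eq_bigr => i _; rewrite mulr_sumr -sumEFin.
      by apply: eq_bigr => j _; rewrite -EFinM; congr EFin; ring.
    have m1 i j : measurable_fun setT
        (fun omega => (w i * w j)%:E * (Y i omega * Y j omega)%:E)%E.
      apply: emeasurable_funM => //; apply: mE; exact: measurable_funM.
    have p1 i j omega : (0 <= (w i * w j)%:E * (Y i omega * Y j omega)%:E)%E.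
      by rewrite -EFinM lee_fin !mulr_ge0.
    rewrite ge0_integral_sum//; last 2 first.
    - by move=> i; exact: emeasurable_sum.
    - by move=> i omega _; exact: sume_ge0.
    apply: eq_bigr => i _; rewrite ge0_integral_sum//.
    apply: eq_bigr => j _; rewrite ge0_integralZl_EFin//.
    - by move=> omega _; rewrite lee_fin mulr_ge0.
    - by apply: mE; exact: measurable_funM.
    - by rewrite mulr_ge0.
  apply: (@le_trans _ _ (\sum_(m <= i < n) \sum_(m <= j < n)
       (w i * w j * (e ^+ 2 + C * rho ^+ gap i j))%:E)%E).
    apply: lee_sum => i _; apply: lee_sum => j _.
    by rewrite [leRHS]EFinM lee_wpmul2l ?lee_fin ?mulr_ge0.
  under eq_bigr do rewrite sumEFin.
  rewrite sumEFin lee_fin.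
  apply: (@le_trans _ _ (M ^+ 2 + C * \sum_(m <= i < n) \sum_(m <= j < n)
     (w i ^+ 2 / 2 * rho ^+ gap i j + w j ^+ 2 / 2 * rho ^+ gap i j))).
    have -> : M ^+ 2 = \sum_(m <= i < n) \sum_(m <= j < n) (w i * e) * (w j * e).
      by rewrite expr2 /M mulr_suml; apply: eq_bigr => i _; rewrite mulr_sumr.
    rewrite mulr_sumr -big_split/=; apply: ler_sum => i _.
    rewrite mulr_sumr -big_split/=; apply: ler_sum => j _.
    have g0 : 0 <= rho ^+ gap i j by rewrite exprn_ge0// ltW.
    have : w i * w j <= w i ^+ 2 / 2 + w j ^+ 2 / 2.
      by have := sqr_ge0 (w i - w j); rewrite sqrrB; lra.
    move=> /(ler_wpM2r g0) /(ler_wpM2l C0); lra.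
  rewrite lerD2l.
  have dbl : \sum_(m <= i < n) \sum_(m <= j < n) w i ^+ 2 / 2 * rho ^+ gap i j <=
     \sum_(m <= i < n) w i ^+ 2 / 2 * (2 / (1 - rho)).
    apply: ler_sum => i _; rewrite -mulr_sumr.
    by rewrite ler_wpM2l ?divr_ge0 ?sqr_ge0// geometric_gap_sum.
  have -> : B = C * (2 * \sum_(m <= i < n) w i ^+ 2 / 2 * (2 / (1 - rho))).
    rewrite /B -mulr_suml -mulr_suml; field.
    by rewrite gt_eqF.
  rewrite ler_wpM2l//.
  under eq_bigr do rewrite big_split.
  rewrite big_split/= mulr_natl mulr2n lerD//.
  rewrite exchange_big/=; apply: le_trans dbl.
  by apply: ler_sum => i _; apply: ler_sum => j _; rewrite /gap addnC.
have key : (\int[P]_omega ((S omega - M) ^+ 2)%:E + (2 * M ^+ 2)%:E =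
    \int[P]_omega (S omega ^+ 2)%:E + (M ^+ 2)%:E)%E.
  have -> : (2 * M ^+ 2)%:E = (\int[P]_omega (2 * M * S omega)%:E)%E.
    under eq_integral do rewrite EFinM.
    rewrite ge0_integralZl_EFin//.
    - by rewrite iS -EFinM; congr EFin; ring.
    - by move=> omega _; rewrite lee_fin.
    - exact: mE.
    - by rewrite mulr_ge0.
  have -> : (M ^+ 2)%:E = (\int[P]_omega (M ^+ 2)%:E)%E.
    by rewrite [RHS]integral_cst// [X in (_ * X)%E](@probability_setT _ _ _ P) mule1.
  rewrite -!ge0_integralD//.
  - by apply: eq_integral => omega _; rewrite -!EFinD; congr EFin; ring.
  - by move=> omega _; rewrite lee_fin sqr_ge0.
  - by apply: mE; exact: measurable_funX.
  - by move=> omega _; rewrite lee_fin sqr_ge0.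
  - by move=> omega _; rewrite lee_fin sqr_ge0.
  - by apply: mE; apply: measurable_funX; exact: measurable_funB.
  - by move=> omega _; rewrite lee_fin !mulr_ge0.
  - by apply: mE; exact: measurable_funM.
have := leeD2r (M ^+ 2)%:E iS2; rewrite -key -EFinD.
rewrite -leeBrDr// -EFinB => /le_trans; apply.
by rewrite lee_fin; lra.
Qed.

(** The windows are disjoint, so their variances add up to at most a constant
    times the sum of all the squared weights; the squares of the centred sums are
    then almost surely summable. *)
Theorem windowed_lln (A : R) (a : nat -> nat) :
  (forall n, \sum_(0 <= i < n) w i ^+ 2 <= A) ->
  (forall j, (a j < a j.+1)%N) ->
  {ae P, forall omega,
    \sum_(a j <= i < a j.+1) w i * (Y i omega - e) @[j --> \oo] --> (0 : R)}.
Proof.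
move=> wA aS.
have /andP[r0 r1] := rho01; have r10 : 0 < 1 - rho by rewrite subr_gt0.
pose D j omega := \sum_(a j <= i < a j.+1) w i * (Y i omega - e).
have mD j : measurable_fun setT (fun omega => D j omega ^+ 2).
  apply: measurable_funX; apply: measurable_sum => i.
  by apply: measurable_funM => //; exact: measurable_funB.
have a0 n : (a 0 <= a n)%N.
  by elim: n => // n IH; apply: leq_trans IH (ltnW (aS n)).
have tele n : \sum_(0 <= j < n) \sum_(a j <= i < a j.+1) w i ^+ 2 <= A.
  have -> : \sum_(0 <= j < n) \sum_(a j <= i < a j.+1) w i ^+ 2 =
      \sum_(a 0 <= i < a n) w i ^+ 2.
    elim: n => [|n IH]; first by rewrite !big_geq.
    by rewrite big_nat_recr//= IH -big_cat_nat// ltnW.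
  apply: le_trans (wA (a n)).
  rewrite [leRHS](big_cat_nat (leq0n (a 0)) (a0 n))/= lerDr sumr_ge0// => i _.
  exact: sqr_ge0.
have : {ae P, forall omega, exists C' : R,
    forall n, \sum_(0 <= j < n) D j omega ^+ 2 <= C'}.
  apply: (@ae_bounded_series _ _ _ P (fun j omega => D j omega ^+ 2)
    (2 * C / (1 - rho) * A)) => //.
  - by move=> j omega; exact: sqr_ge0.
  - move=> n; apply: (@le_trans _ _ (\sum_(0 <= j < n)
      (2 * C / (1 - rho) * \sum_(a j <= i < a j.+1) w i ^+ 2)%:E)%E).
      by apply: lee_sum => j _; exact: window_second_moment.
    rewrite sumEFin lee_fin -mulr_sumr ler_wpM2l//.
    by rewrite !mulr_ge0// invr_ge0 ltW.
apply: filterS => omega [C' hC'].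
have D2 : D j omega ^+ 2 @[j --> \oo] --> (0 : R).
  have := @bounded_series_windows _ (fun j => D j omega ^+ 2) C' id
    (fun j => sqr_ge0 _) hC' (fun j => leqnn _).
  by under eq_fun do rewrite big_nat1.
apply/cvgrPdist_lt => eps eps0.
have /cvgrPdist_lt /(_ _ (exprn_gt0 2 eps0)) := D2.
apply: filterS => j; rewrite !sub0r !normrN normrX -/(D j omega).
by rewrite ltr_pXn2r ?nnegrE// ltW.
Qed.

End windowed_lln.

(** * The mean likelihood ratio *)

Lemma measurable_inv_pos {d : measure_display} {S : measurableType d}
    {R : realType} (h : S -> R) :
  (forall x, 0 < h x) -> measurable_fun setT h ->
  measurable_fun setT (fun x => (h x)^-1).
Proof.
move=> h0 mh.
rewrite (_ : (fun x => (h x)^-1) = (fun x => expR (- ln (h x)))); last first.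
  by apply/funext => x; rewrite expRN lnK ?posrE.
apply: measurableT_comp; first exact: measurable_expR.
apply: measurable_funN.
by apply: measurableT_comp => //; exact: measurable_ln.
Qed.

Section row_vectors.
Context {R : realType} {k : nat}.

Lemma coord_le_norm (u : 'rV[R]_k) l : `|u ord0 l| <= `|u|.
Proof.
rewrite [leRHS]/Num.Def.normr /= mx_normrE.
exact: (le_bigmax 0 (fun ij : 'I_1 * 'I_k => `|u ij.1 ij.2|) (ord0, l)).
Qed.

Lemma l1dist_le_norm (u t : 'rV[R]_k) :
  l1dist (u ord0) (t ord0) <= k%:R * `|u - t|.
Proof.
have -> : k%:R * `|u - t| = \sum_(l < k) `|u - t|.
  by rewrite sumr_const card_ord mulr_natl.
by apply: ler_sum => l _; have := coord_le_norm (u - t) l; rewrite !mxE.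
Qed.

Lemma lipschitz_within_continuous (A : set 'rV[R]_k) (phi : 'rV[R]_k -> R) (C : R) :
  0 <= C ->
  (forall u t, A u -> A t -> `|phi u - phi t| <= C * `|u - t|) ->
  {within A, continuous phi}.
Proof.
move=> C0 lip; apply/subspace_continuousP => u Au.
apply/cvgrPdist_lt => e e0; rewrite near_withinE.
have C1 : 0 < C + 1 by rewrite ltr_wpDl.
apply/nbhs_ballP; exists (e / (C + 1)); first by rewrite /= divr_gt0.
move=> t; rewrite -ball_normE/= => ut At.
apply: le_lt_trans (lip _ _ Au At) _.
rewrite ltr_pdivlMr// in ut; apply: le_lt_trans ut.
by rewrite mulrC ler_wpM2l// lerDl.
Qed.

Lemma lipschitz_closed (phi : 'rV[R]_k -> R) (C : R) (D : set R) :
  0 <= C -> (forall u t, `|phi u - phi t| <= C * `|u - t|) ->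
  closed D -> closed (phi @^-1` D).
Proof.
move=> C0 lip cD; apply: preimage_closed => // u _.
apply: (iffRL (continuous_subspace_setT phi)).
by apply: (lipschitz_within_continuous C0) => *; exact: lip.
Qed.

End row_vectors.

Section expected_ratio.
Context {R : realType} {k : nat} {dO : measure_display}.
Context {Omega : measurableType dO}.
Variable P : probability Omega R.
Variables (y : Omega -> 'I_k -> R) (f : 'I_k -> R) (L : R).
Hypothesis my : forall l, measurable_fun setT (y ^~ l).
Hypothesis y0 : forall omega l, 0 < y omega l.
Hypothesis sf : simplex f.
Hypothesis spreadL : (\int[P]_omega (spread (y omega) ^+ 2)%:E <= L%:E)%E.

Definition mean (h : ('I_k -> R) -> R) : R :=
  fine (\int[P]_omega (h (y omega))%:E).

Lemma measurable_mix g : measurable_fun setT (fun omega => mix g (y omega)).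
Proof. by apply: measurable_sum => l; exact: measurable_funM. Qed.

Lemma measurable_spread : measurable_fun setT (fun omega => spread (y omega)).
Proof.
apply: measurable_sum => l; apply: measurable_sum => l'.
by apply: measurable_funM => //; exact: measurable_inv_pos.
Qed.

Lemma measurable_lratio g : heavy g ->
  measurable_fun setT (fun omega => lratio f g (y omega)).
Proof.
move=> hg; apply: measurable_funM; first exact: measurable_mix.
apply: measurable_inv_pos; last exact: measurable_mix.
by move=> omega; exact: mix_gt0.
Qed.

Lemma spread1 omega : 1 <= spread (y omega).
Proof. by have [l _] := heavy_exists (simplex_heavy sf); exact: spread_ge1 l _. Qed.

Lemma osc_ge0 c omega : 0 <= c -> 0 <= osc c (y omega).
Proof.
move=> c0; rewrite le_min; have s1 := spread1 omega.
by rewrite (le_trans ler01 s1)/= mulr_ge0 ?sqr_ge0.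
Qed.

Lemma osc_le_spread c omega : osc c (y omega) <= spread (y omega).
Proof. by rewrite ge_min lexx. Qed.

Lemma measurable_EFin (h : Omega -> R) : measurable_fun setT h ->
  measurable_fun setT (fun omega => (h omega)%:E).
Proof. by move=> mh; exact/measurable_EFinP. Qed.

Lemma measurable_spread2 : measurable_fun setT (fun omega => spread (y omega) ^+ 2).
Proof. by apply: measurable_funX; exact: measurable_spread. Qed.

Lemma second_moment_le (h : ('I_k -> R) -> R) :
  (forall omega, 0 <= h (y omega) <= spread (y omega)) ->
  (\int[P]_omega (h (y omega) ^+ 2)%:E <= L%:E)%E.
Proof.
move=> hs; apply: le_trans spreadL; apply: le_integral_sup => omega _.
  by rewrite lee_fin sqr_ge0.
have /andP[h0 h1] := hs omega.
by rewrite lee_fin ler_pXn2r// nnegrE (le_trans h0).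
Qed.

Lemma meanE (h : ('I_k -> R) -> R) :
  (forall omega, 0 <= h (y omega) <= spread (y omega)) ->
  (\int[P]_omega (h (y omega))%:E = (mean h)%:E)%E.
Proof.
move=> hs; rewrite /mean fineK// ge0_fin_numE; last first.
  by apply: integral_ge0 => omega _; rewrite lee_fin; have /andP[] := hs omega.
apply: (@le_lt_trans _ _ L%:E); last exact: ltry.
apply: le_trans spreadL; apply: le_integral_sup => omega _;
  have /andP[h0 h1] := hs omega; first by rewrite lee_fin.
by rewrite lee_fin (le_trans h1)// expr2 ler_peMr ?spread1// (le_trans h0).
Qed.

Lemma mean_ge0 (h : ('I_k -> R) -> R) :
  (forall omega, 0 <= h (y omega)) -> 0 <= mean h.
Proof.
move=> h0; apply: fine_ge0; apply: integral_ge0 => omega _.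
by rewrite lee_fin.
Qed.

Lemma L_ge0 : 0 <= L.
Proof.
rewrite -lee_fin; apply: le_trans spreadL; apply: integral_ge0 => omega _.
by rewrite lee_fin sqr_ge0.
Qed.

Lemma lratio_bounds g omega : heavy g ->
  0 <= lratio f g (y omega) <= spread (y omega).
Proof.
move=> hg; rewrite lratio_le_spread// andbT.
by apply: lratio_ge0 => //; case: sf.
Qed.

Lemma osc_bounds c omega : 0 <= c ->
  0 <= osc c (y omega) <= spread (y omega).
Proof. by move=> c0; rewrite osc_ge0//= osc_le_spread. Qed.

Lemma mean_osc_le c : 0 <= c -> mean (osc c) <= c * L.
Proof.
move=> c0; rewrite -lee_fin -meanE; last by move=> omega; exact: osc_bounds.
apply: (@le_trans _ _ (\int[P]_omega (c%:E * (spread (y omega) ^+ 2)%:E)))%E.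
  apply: le_integral_sup => omega _; first by rewrite lee_fin osc_ge0.
  by rewrite -EFinM lee_fin ge_min lexx orbT.
rewrite ge0_integralZl_EFin//.
- by rewrite EFinM lee_wpmul2l// lee_fin.
- by move=> omega _; rewrite lee_fin sqr_ge0.
- by apply: measurable_EFin; exact: measurable_spread2.
Qed.

Lemma mean_lratio_lip g g' : heavy g -> heavy g' ->
  `|mean (lratio f g) - mean (lratio f g')| <= L * l1dist g g'.
Proof.
have half g1 g2 : heavy g1 -> heavy g2 ->
    mean (lratio f g1) <= mean (lratio f g2) + L * l1dist g1 g2.
  move=> h1 h2; rewrite -lee_fin EFinD -!meanE; last 2 first.
  - by move=> omega; exact: lratio_bounds.
  - by move=> omega; exact: lratio_bounds.
  have d0 : 0 <= l1dist g1 g2 by apply: sumr_ge0.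
  apply: (@le_trans _ _ (\int[P]_omega ((lratio f g2 (y omega))%:E +
     (l1dist g1 g2)%:E * (spread (y omega) ^+ 2)%:E)))%E.
    apply: le_integral_sup => omega _.
      by rewrite lee_fin; have /andP[] := lratio_bounds omega h1.
    rewrite -EFinM -EFinD lee_fin -lerBlDl.
    exact: le_trans (ler_norm _) (lratio_lip sf h1 h2 (y0 omega)).
  have m2 : measurable_fun setT (fun omega => (spread (y omega) ^+ 2)%:E).
    by apply: measurable_EFin; exact: measurable_spread2.
  rewrite ge0_integralD//.
  - rewrite leeD2l// ge0_integralZl_EFin//.
      by rewrite mulrC EFinM lee_wpmul2l// lee_fin.
    by move=> omega _; rewrite lee_fin sqr_ge0.
  - by move=> omega _; rewrite lee_fin; have /andP[] := lratio_bounds omega h2.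
  - by apply: measurable_EFin; exact: measurable_lratio.
  - by move=> omega _; rewrite -EFinM lee_fin mulr_ge0 ?sqr_ge0.
  - by apply: emeasurable_funM.
move=> hg hg'; have := half _ _ hg hg'; have := half _ _ hg' hg.
have -> : l1dist g' g = l1dist g g' by apply: eq_bigr => l _; rewrite distrC.
by move=> *; rewrite ler_norml; lra.
Qed.

Hypothesis inv_le1 : forall g, simplex g ->
  (\int[P]_omega (mix g (y omega) / mix f (y omega))%:E <= 1)%E.
Hypothesis ident : forall g, simplex g -> (forall l, f l = 0 -> g l = 0) ->
  {ae P, forall omega, mix g (y omega) = mix f (y omega)} ->
  forall l, g l = f l.

(** With [h] the ratio, [h + h^-1 - 2 = (h - 1) ^+ 2 / h >= 0], and [h^-1] has mean at
    most 1. A mean of [h] at most 1 would thus force [h = 1] almost surely, which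
    identifies the mixing vector. *)
Lemma mean_lratio_gt1 g : simplex g -> (forall l, f l = 0 -> g l = 0) ->
  (exists l, g l != f l) -> 1 < mean (lratio f g).
Proof.
move=> sg fg [l gl]; rewrite ltNge; apply/negP => Tle.
suff H : {ae P, forall omega, mix g (y omega) = mix f (y omega)}.
  by move: gl; rewrite (ident sg fg H) eqxx.
have hg := simplex_heavy sg; have hf := simplex_heavy sf.
pose h omega := lratio f g (y omega).
have mg omega : 0 < mix g (y omega) by exact: mix_gt0.
have mf omega : 0 < mix f (y omega) by exact: mix_gt0.
have h0 omega : 0 < h omega by rewrite divr_gt0.
have hV omega : (h omega)^-1 = mix g (y omega) / mix f (y omega).
  by rewrite invf_div.
have mh : measurable_fun setT h by exact: measurable_lratio.
have mV : measurable_fun setT (fun omega => (h omega)^-1).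
  exact: measurable_inv_pos.
pose D omega := (h omega - 1) ^+ 2 * (h omega)^-1.
have D0 omega : 0 <= D omega by rewrite mulr_ge0 ?sqr_ge0// invr_ge0 ltW.
have mD : measurable_fun setT D.
  by apply: measurable_funM => //; apply: measurable_funX; exact: measurable_funB.
have E : (\int[P]_omega (D omega)%:E + 2%:E =
    \int[P]_omega (h omega)%:E + \int[P]_omega ((h omega)^-1)%:E)%E.
  have -> : 2%:E = (\int[P]_omega (2 : R)%:E)%E.
    by rewrite [RHS]integral_cst// [X in (_ * X)%E](@probability_setT _ _ _ P) mule1.
  rewrite -!ge0_integralD//.
  - apply: eq_integral => omega _; rewrite -!EFinD; congr EFin.
    by rewrite /D; field; rewrite gt_eqF.
  - by move=> omega _; rewrite lee_fin ltW.
  - exact: measurable_EFin.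
  - by move=> omega _; rewrite lee_fin invr_ge0 ltW.
  - exact: measurable_EFin.
  - by move=> omega _; rewrite lee_fin.
  - exact: measurable_EFin.
have D00 : (\int[P]_omega (D omega)%:E = 0)%E.
  apply/eqP; rewrite eq_le integral_ge0 ?andbT; last first.
    by move=> omega _; rewrite lee_fin.
  have : (\int[P]_omega (D omega)%:E + 2%:E <= 0 + 2%:E)%E.
    rewrite E add0e -[2]/(1 + 1) EFinD leeD//.
      by rewrite /h meanE ?lee_fin// => omega; exact: lratio_bounds.
    under eq_integral do rewrite hV.
    exact: inv_le1.
  by rewrite leeD2rE.
have /ae_eq_integral_abs : (\int[P]_omega `|(D omega)%:E| = 0)%E.
  by rewrite -[RHS]D00; apply: eq_integral => omega _; rewrite gee0_abs ?lee_fin.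
move=> /(_ measurableT (measurable_EFin mD)).
apply: filterS => omega /(_ Logic.I) [] /eqP.
rewrite mulf_eq0 sqrf_eq0 invr_eq0 (gt_eqF (h0 omega)) orbF subr_eq0 => /eqP h1.
by move: h1; rewrite /h /lratio => /divr1_eq.
Qed.

(** Vectors of divergence at least [e] stay away from [f] in the l1 distance, by
    [kl_le]. On the compact set of such vectors the mean ratio is continuous and
    exceeds 1, so its minimum does. *)
Lemma mean_lratio_gap e : 0 < e -> exists2 c, 0 < c &
  forall g, simplex g -> (forall l, f l = 0 -> g l = 0) ->
    e <= kl f g -> 1 + c <= mean (lratio f g).
Proof.
move=> e0; have [f0 f1] := sf.
(* At l1 distance less than [eta] from [f], [kl_le] makes the divergence less
   than [e]. *)
have [eta eta0 [etaf etae]] : exists2 eta, 0 < eta &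
    (forall l, 0 < f l -> 2 * eta <= f l) /\ 2 * k%:R * eta < e.
  pose m := \big[Num.min/1]_(l | 0 < f l) f l.
  have m0 : 0 < m by apply: lt_bigmin.
  pose q := e / (4 * k.+1%:R).
  have q0 : 0 < q by rewrite divr_gt0// mulr_gt0.
  exists (Num.min (m / 2) q); first by rewrite lt_min divr_gt0.
  split.
    move=> l fl; have : m <= f l by apply: bigmin_le_cond.
    have : Num.min (m / 2) q <= m / 2 by rewrite ge_min lexx.
    lra.
  apply: (@le_lt_trans _ _ (2 * k%:R * q)).
    by rewrite ler_wpM2l// ?mulr_ge0// ge_min lexx orbT.
  rewrite /q mulrA ltr_pdivrMr ?mulr_gt0// mulrC ltr_pM2l//.
  by rewrite -natr1; have := ler0n R k; lra.
pose A : set 'rV[R]_k := [set u | [/\ forall l, 0 <= u ord0 l,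
  \sum_l u ord0 l = 1, forall l, f l = 0 -> u ord0 l = 0 &
  eta <= l1dist (u ord0) f]].
have farA (g : 'I_k -> R) : simplex g -> (forall l, f l = 0 -> g l = 0) ->
    e <= kl f g -> A (\row_l g l).
  move=> [g0 g1] fg eg; rewrite /A/=; split.
  - by move=> l; rewrite mxE.
  - by rewrite -g1; apply: eq_bigr => l _; rewrite mxE.
  - by move=> l; rewrite mxE; exact: fg.
  - rewrite leNgt; apply/negP => lt.
    have : kl f g <= 2 * k%:R * eta.
      apply: kl_le => // l; apply: le_trans (ltW lt).
      rewrite /l1dist (bigD1 l)//= mxE lerDl sumr_ge0//.
    by move=> /(le_trans eg); rewrite leNgt etae.
have rowE (g : 'I_k -> R) : (\row_l g l : 'rV[R]_k) ord0 = g.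
  by apply/funext => l; rewrite mxE.
have [A0|A0] := pselect (A !=set0); last first.
  exists 1 => // g sg fg eg; exfalso; apply: A0; exists (\row_l g l).
  exact: farA.
have As u : A u -> simplex (u ord0) by case.
have cA : compact A.
  apply: bounded_closed_compact.
    exists 1; split => // M M1 u [u0 u1 _ _]; apply: le_trans (ltW M1).
    rewrite /Num.Def.normr /= mx_normrE; apply: bigmax_le => // -[i j] _ /=.
    rewrite ord1 ger0_norm// -u1 (bigD1 j)//= lerDl sumr_ge0//.
  have -> : A = \bigcap_(l in [set: 'I_k]) [set u : 'rV[R]_k | 0 <= u ord0 l]
      `&` [set u | \sum_l u ord0 l = 1]
      `&` \bigcap_(l in [set l | f l = 0]) [set u : 'rV[R]_k | u ord0 l = 0]
      `&` [set u | eta <= l1dist (u ord0) f].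
    apply/seteqP; split => u.
      move=> [u0 u1 fu eu]; split; last exact: eu.
      split; last by move=> l /= fl; exact: fu.
      by split; [move=> l _; exact: u0|exact: u1].
    by move=> [[[u0 u1] fu] eu]; split => // l; exact: u0.
  have lipc l (u t : 'rV[R]_k) : `|u ord0 l - t ord0 l| <= 1 * `|u - t|.
    by rewrite mul1r; have := coord_le_norm (u - t) l; rewrite !mxE.
  apply: closedI; first apply: closedI; first apply: closedI.
  - apply: closed_bigI => l _.
    exact: (lipschitz_closed ler01 (lipc l) (@closed_ge _ 0)).
  - apply: (lipschitz_closed (ler0n R k) _ (@closed_eq _ 1)) => u t.
    apply: le_trans (l1dist_le_norm u t).
    by rewrite -sumrB; apply: ler_norm_sum.
  - apply: closed_bigI => l _.
    exact: (lipschitz_closed ler01 (lipc l) (@closed_eq _ 0)).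
  - apply: (lipschitz_closed (ler0n R k) _ (@closed_ge _ eta)) => u t.
    apply: le_trans (l1dist_le_norm u t).
    have := l1dist_triangle (u ord0) (t ord0) f.
    have := l1dist_triangle (t ord0) (u ord0) f.
    have -> : l1dist (t ord0) (u ord0) = l1dist (u ord0) (t ord0).
      by apply: eq_bigr => l _; rewrite distrC.
    by move=> *; rewrite ler_norml; lra.
have cT : {within A, continuous (fun u => mean (lratio f (u ord0)))}.
  apply: (@lipschitz_within_continuous _ _ _ _ (L * k%:R)).
    by rewrite mulr_ge0// L_ge0.
  move=> u t /As/simplex_heavy hu /As/simplex_heavy ht.
  apply: le_trans (mean_lratio_lip hu ht) _.
  by rewrite -mulrA ler_wpM2l ?L_ge0// l1dist_le_norm.
have [u0 /set_mem Au0 umin] := compact_EVT_min A0 cA cT.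
exists (mean (lratio f (u0 ord0)) - 1).
  rewrite subr_gt0; case: Au0 => p0 p1 p2 p3.
  apply: mean_lratio_gt1 => //.
  apply: contrapT => H; move: p3; rewrite /l1dist big1 ?leNgt ?eta0// => l _.
  have [->|ne] := eqVneq (u0 ord0 l) (f l); first by rewrite subrr normr0.
  by exfalso; apply: H; exists l.
move=> g sg fg eg; rewrite subrKC.
have := umin (\row_l g l); rewrite rowE; apply.
by rewrite inE; exact: farA.
Qed.

End expected_ratio.

(** * Almost sure convergence *)

Section almost_sure_convergence.
Context {R : realType} {k : nat} {dO dS : measure_display}.
Context {Omega : measurableType dO} {S : measurableType dS}.
Variable P : probability Omega R.
Variables (X : nat -> Omega -> S) (lik : S -> 'I_k -> R) (f v0 : 'I_k -> R).
Variables (w : nat -> R) (L rho A : R).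

Fixpoint pr_iter (y : nat -> 'I_k -> R) (n : nat) : 'I_k -> R :=
  if n is n'.+1 then pr_step (w n') (y n') (pr_iter y n') else v0.

Hypothesis mX : forall n, measurable_fun setT (X n).
Hypothesis mlik : forall l, measurable_fun setT (lik ^~ l).
Hypothesis lik0 : forall x l, 0 < lik x l.
Hypothesis sf : simplex f.
Hypothesis sv0 : simplex v0.
Hypothesis supp : forall l, f l = 0 <-> v0 l = 0.
Hypothesis w01 : forall n, 0 < w n <= 1.
Hypothesis wc : w i @[i --> \oo] --> (0 : R).
Hypothesis wdiv : forall B : R, exists n, B <= \sum_(0 <= i < n) w i.
Hypothesis w2 : forall n, \sum_(0 <= i < n) w i ^+ 2 <= A.
Hypothesis rho01 : 0 < rho < 1.
Hypothesis same_law : forall (g : S -> R) n, measurable_fun setT g ->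
  (forall x, 0 <= g x) ->
  (\int[P]_omega (g (X n omega))%:E = \int[P]_omega (g (X 0%N omega))%:E)%E.
Hypothesis cov : forall (g : S -> R) (e G : R), measurable_fun setT g ->
  (forall x, 0 <= g x) ->
  (\int[P]_omega (g (X 0%N omega))%:E = e%:E)%E ->
  (\int[P]_omega (g (X 0%N omega) ^+ 2)%:E <= G%:E)%E ->
  exists2 C, 0 <= C & forall i j,
    (\int[P]_omega (g (X i omega) * g (X j omega))%:E <=
     (e ^+ 2 + C * rho ^+ gap i j)%:E)%E.
Hypothesis spreadL :
  (\int[P]_omega (spread (lik (X 0%N omega)) ^+ 2)%:E <= L%:E)%E.
Hypothesis inv_le1 : forall g, simplex g ->
  (\int[P]_omega (mix g (lik (X 0%N omega)) / mix f (lik (X 0%N omega)))%:E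
   <= 1)%E.
Hypothesis ident : forall g, simplex g -> (forall l, f l = 0 -> g l = 0) ->
  {ae P, forall omega,
    mix g (lik (X 0%N omega)) = mix f (lik (X 0%N omega))} ->
  forall l, g l = f l.

Let mean := mean P (fun omega => lik (X 0%N omega)).
Let my l : measurable_fun setT (fun omega => lik (X 0%N omega) l).
Proof. exact: (measurableT_comp (mlik l) (mX 0)). Qed.
Let y0 omega l : 0 < lik (X 0%N omega) l.
Proof. exact: lik0. Qed.

Lemma functional_lln (h : ('I_k -> R) -> R) (a : nat -> nat) :
  measurable_fun setT (fun x => h (lik x)) ->
  (forall x, 0 <= h (lik x) <= spread (lik x)) ->
  (forall j, (a j < a j.+1)%N) ->
  {ae P, forall omega, \sum_(a j <= i < a j.+1)
     w i * (h (lik (X i omega)) - mean h) @[j --> \oo] --> (0 : R)}.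
Proof.
move=> mh hs aS.
have h0 x : 0 <= h (lik x) by have /andP[] := hs x.
have meanh : (\int[P]_omega (h (lik (X 0%N omega)))%:E = (mean h)%:E)%E.
  by apply: (meanE y0 sf spreadL) => omega.
have h2 : (\int[P]_omega (h (lik (X 0%N omega)) ^+ 2)%:E <= L%:E)%E.
  by apply: (@second_moment_le _ _ _ _ P _ _ spreadL) => omega.
have [C C0 hC] := cov mh h0 meanh h2.
apply: (@windowed_lln _ _ _ P (fun i omega => h (lik (X i omega))) (mean h) C
  rho w _ _ _ C0 rho01 _ hC _ A) => //.
- by move=> i; exact: (measurableT_comp mh (mX i)).
- by apply: mean_ge0.
- by move=> i; rewrite (same_law i mh h0).
- by move=> i; have /andP[/ltW] := w01 i.
Qed.

(** The law of large numbers is applied to countably many functions: the likelihood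
    ratios at all grid points of all meshes, and the oscillations. Outside one
    null set the pathwise theorem applies. *)
Theorem pr_iter_converges :
  {ae P, forall omega, forall l,
    pr_iter (fun n => lik (X n omega)) n l @[n --> \oo] --> f l}.
Proof.
have w_gt0 i : 0 < w i by have /andP[] := w01 i.
have L0 : 0 <= L := L_ge0 spreadL.

have [a aP] := choice (fun N => windows_exist w_gt0 wc wdiv (@mesh_gt0 R N)).
have a_mono N j : (a N j < a N j.+1)%N by have [] := aP N.
have slik : measurable_fun setT (fun x => spread (lik x)).
  by apply: measurable_sum => l; apply: measurable_sum => l';
    apply: measurable_funM => //; exact: measurable_inv_pos.
have mmix g : measurable_fun setT (fun x => mix g (lik x)).
  by apply: measurable_sum => l; exact: measurable_funM.
have lln1 : {ae P, forall omega, forall N,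
    forall c : {ffun 'I_k -> 'I_(k * N.+1).+2},
    heavy (grid N (fun l => c l) : 'I_k -> R) ->
    \sum_(a N j <= i < a N j.+1)
      w i * (lratio f (grid N (fun l => c l)) (lik (X i omega))
             - mean (lratio f (grid N (fun l => c l))))
        @[j --> \oo] --> (0 : R)}.
  apply/ae_foralln => N; apply: ae_forall_countable => c.
  have [hg|nhg] := pselect (heavy (grid N (fun l => c l) : 'I_k -> R)); last first.
    by apply: aeW => omega.
  have mr : measurable_fun setT
      (fun x => lratio f (grid N (fun l => c l)) (lik x)).
    apply: measurable_funM => //; apply: measurable_inv_pos => //.
    by move=> x; exact: mix_gt0.
  apply: filterS (functional_lln mr _ (a_mono N)) => [omega H _ //|x].
  by rewrite lratio_le_spread// lratio_ge0//; case: sf.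
have lln2 : {ae P, forall omega, forall N,
    \sum_(a N j <= i < a N j.+1)
      w i * (osc (osc_width N) (lik (X i omega)) - mean (osc (osc_width N)))
        @[j --> \oo] --> (0 : R)}.
  apply/ae_foralln => N; apply: functional_lln (a_mono N).
    by apply: measurable_minr => //; apply: measurable_funM => //; exact: measurable_funX.
  move=> x; rewrite ge_min lexx/= andbT le_min.
  rewrite spread_ge0/=; last by move=> l; exact: ltW.
  by rewrite mulr_ge0 ?sqr_ge0// mulr_ge0// ltW// mesh_gt0.
have sum2 : {ae P, forall omega, exists C : R, forall n,
    \sum_(0 <= i < n) w i ^+ 2 * spread (lik (X i omega)) ^+ 2 <= C}.
  apply: (@ae_bounded_series _ _ _ P
    (fun i omega => w i ^+ 2 * spread (lik (X i omega)) ^+ 2) (A * L)).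
  - move=> i; apply: measurable_funM => //; apply: measurable_funX.
    exact: (measurableT_comp slik (mX i)).
  - by move=> i omega; rewrite mulr_ge0 ?sqr_ge0.
  - move=> n; apply: (@le_trans _ _ (\sum_(0 <= i < n) (w i ^+ 2 * L)%:E)%E).
      apply: lee_sum => i _.
      under eq_integral do rewrite EFinM.
      rewrite ge0_integralZl_EFin ?sqr_ge0//.
      - rewrite [leRHS]EFinM lee_wpmul2l ?lee_fin ?sqr_ge0//.
        rewrite (same_law i (g := fun x => spread (lik x) ^+ 2))//.
          exact: measurable_funX.
        by move=> x; exact: sqr_ge0.
      - by move=> omega _; rewrite lee_fin sqr_ge0.
      - apply/measurable_EFinP; apply: measurable_funX.
        exact: (measurableT_comp slik (mX i)).
    by rewrite sumEFin lee_fin -mulr_suml ler_wpM2r.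
move: lln1 lln2 sum2; apply: filterS3 => omega l1 l2 [C hC] l.
apply: (@pr_converges _ _ f (fun n => lik (X n omega)) w
  (pr_iter (fun n => lik (X n omega))) sf _ w01 wc sv0 _ _
  (fun g => mean (lratio f g)) (fun c => mean (osc c)) L L0 _ _ _ C _ a a_mono) => //.
- move=> i fi; case: sv0 => v0ge _; rewrite lt_neqAle v0ge andbT eq_sym.
  by apply/eqP => /supp fi0; rewrite fi0 ltxx in fi.
- by move=> g g' hg hg'; exact: (mean_lratio_lip my y0 sf spreadL hg hg').
- by move=> c c0; exact: (mean_osc_le my y0 sf spreadL).
- move=> e e0.
  have [c c0 hc] := mean_lratio_gap my y0 sf spreadL inv_le1 ident e0.
  by exists c => // g sg _ gv; apply: hc => // i /supp; exact: gv.
- by move=> N j; have [] := aP N.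
- by move=> N; have [] := aP N.
Qed.

End almost_sure_convergence.

(** * Sums of weights *)

Section weights.
Context {R : realType}.

Lemma bounded_tail (u v : nat -> R) (N : nat) (B : R) :
  (forall i, 0 <= v i) ->
  (forall i, (N <= i)%N -> u i <= v i) ->
  (forall n, \sum_(0 <= i < n) v i <= B) ->
  (exists A, forall n, \sum_(0 <= i < n) u i <= A).
Proof.
move=> v0 uv vB; exists (\sum_(0 <= i < N) `|u i| + B) => n.
have [nN|/ltnW Nn] := leqP n N.
  rewrite (big_cat_nat (leq0n n) nN)/= -addrA.
  apply: (@le_trans _ _ (\sum_(0 <= i < n) `|u i|)).
    by apply: ler_sum => i _; exact: ler_norm.
  rewrite lerDl addr_ge0 ?sumr_ge0//.
  by have := vB 0%N; rewrite big_geq.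
rewrite (big_cat_nat (leq0n N) Nn)/= lerD//.
  by apply: ler_sum => i _; exact: ler_norm.
apply: le_trans (vB n).
rewrite [leRHS](big_cat_nat (leq0n N) Nn)/= -[leLHS]add0r lerD ?sumr_ge0//.
by apply: ler_sum_nat => i /andP[Ni _]; exact: uv.
Qed.


(** With [t = s - 1], the term at [i + 2] is at most [t^-1] times the decrease of
    [x `^ (- t)] from [i + 1] to [i + 2], by convexity; the decreases telescope. *)
Lemma riemann_series_bounded (s : R) : 1 < s ->
  exists A, forall n, \sum_(0 <= i < n) i.+1%:R `^ (- s) <= A.
Proof.
move=> s1; pose t := s - 1; have t0 : 0 < t by rewrite subr_gt0.
pose u i : R := expR (- t * ln i.+1%:R).
have u_step i : i.+2%:R `^ (- s) <= t^-1 * (u i - u i.+1).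
  have -> : i.+2%:R `^ (- s) = u i.+1 * i.+2%:R^-1.
    rewrite /powR ifF ?gt_eqF// /u.
    rewrite (_ : i.+2%:R^-1 = expR (- ln i.+2%:R)); last first.
      by rewrite expRN lnK ?posrE.
    by rewrite -expRD; congr expR; rewrite /t; ring.
  rewrite ler_pdivlMl//.
  have l1 : i.+2%:R^-1 <= ln i.+2%:R - ln i.+1%:R :> R.
    have : ln (i.+1%:R / i.+2%:R : R) <= i.+1%:R / i.+2%:R - 1.
      have := @le_ln1Dx R (i.+1%:R / i.+2%:R - 1); rewrite subrKC; apply.
      by rewrite ltrBrDl subrr divr_gt0.
    rewrite lnM ?posrE ?invr_gt0// lnV ?posrE//.
    have -> : (i.+1%:R / i.+2%:R - 1 : R) = - i.+2%:R^-1.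
      have i0 : (0 : R) < i.+1%:R by [].
      by rewrite -[i.+2%:R]natr1; field; apply: lt0r_neq0; lra.
    by move: (ln _) (ln _) (_^-1) => x z q; lra.
  have ui : u i = u i.+1 * expR (t * (ln i.+2%:R - ln i.+1%:R)).
    by rewrite /u -expRD; congr expR; ring.
  have u0 : 0 <= u i.+1 by exact: expR_ge0.
  have e1 := expR_ge1Dx (t * (ln i.+2%:R - ln i.+1%:R)).
  have : u i.+1 * (1 + t * i.+2%:R^-1) <= u i.
    rewrite ui ler_wpM2l//; apply: le_trans e1.
    by rewrite lerD2l ler_wpM2l// ltW.
  by move: (u i.+1) (u i) (_^-1) => x z q; lra.
exists (1 + t^-1) => -[|n]; first by rewrite big_geq// addr_ge0// invr_ge0 ltW.
rewrite big_nat_recl//= powR1 lerD2l.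
apply: (@le_trans _ _ (\sum_(0 <= i < n) t^-1 * (u i - u i.+1))).
  by apply: ler_sum => i _; exact: u_step.
rewrite -mulr_sumr ler_piMr ?invr_ge0 ?(ltW t0)//.
have -> : \sum_(0 <= i < n) (u i - u i.+1) = u 0%N - u n.
  elim: n => [|n IH]; first by rewrite big_geq// subrr.
  by rewrite big_nat_recr//= IH; ring.
have : u 0%N = 1 by rewrite /u ln1 mulr0 expR0.
have : 0 <= u n by exact: expR_ge0.
lra.
Qed.

Lemma weights_series (alpha : R) (w : nat -> R) :
  2^-1 < alpha <= 1 -> pr_weights alpha w ->
  (exists A, forall n, \sum_(0 <= i < n) w i ^+ 2 <= A) /\
  (forall B : R, exists n, B <= \sum_(0 <= i < n) w i).
Proof.
move=> /andP[a1 a2] [w01 _ _ wa].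
have pw i : 0 < i.+1%:R `^ (- alpha) :> R by rewrite powR_gt0.
have h2 : (0 : R) < 2^-1 by [].
have /cvgrPdist_le /(_ _ h2) [N _ HN] := wa.
have wlow i : (N <= i)%N -> 2^-1 * i.+1%:R `^ (- alpha) <= w i.
  move=> /HN; rewrite ler_norml => /andP[_]; rewrite -ler_pdivlMr//; lra.
have wup i : (N <= i)%N -> w i <= 2 * i.+1%:R `^ (- alpha).
  move=> /HN; rewrite ler_norml => /andP[+ _]; rewrite -ler_pdivrMr//; lra.
have w0 i : 0 < w i by have /andP[] := w01 i.
split.
  have [A hA] := @riemann_series_bounded (2 * alpha) ltac:(lra).
  apply: (@bounded_tail _ (fun i => 4 * i.+1%:R `^ (- (2 * alpha))) N (4 * A)).
  - by move=> i; rewrite mulr_ge0// powR_ge0.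
  - move=> i Ni; have := wup _ Ni.
    rewrite -(@ler_pXn2r _ 2) ?nnegrE ?(ltW (w0 _)) ?mulr_ge0 ?powR_ge0//.
    rewrite exprMn -(powR_mulrn 2 (powR_ge0 _ _)) -powRrM.
    rewrite (_ : - alpha * 2%:R = - (2 * alpha)); last by ring.
    by rewrite (_ : 2 ^+ 2 = 4)//; ring.
  - by move=> n; rewrite -mulr_sumr ler_wpM2l.
move=> B; apply: contrapT => noB.
have ltB n : \sum_(0 <= i < n) w i <= B.
  by rewrite leNgt; apply/negP => /ltW lt; apply: noB; exists n.
have [A hA] : exists A : R, forall n, \sum_(0 <= i < n) harmonic i <= A.
  apply: (@bounded_tail _ (fun i => 2 * w i) N (2 * B)).
  - by move=> i; rewrite mulr_ge0// ltW.
  - move=> i Ni; have := wlow _ Ni.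
    have : harmonic i <= i.+1%:R `^ (- alpha) :> R.
      rewrite /harmonic/= powRN lef_pV2 ?posrE ?powR_gt0//.
      by rewrite -[leRHS]powRr1// ler_powR// ler1n.
    lra.
  - by move=> n; rewrite -mulr_sumr ler_wpM2l.
apply: (@dvg_harmonic R).
apply: nondecreasing_is_cvgn.
  apply/nondecreasing_seqP => n; rewrite /series/= big_nat_recr//= lerDl.
  exact: harmonic_ge0.
by exists A => _ [n _ <-]; exact: hA.
Qed.

End weights.

(** * Common support of the component densities *)

Section common_support.
Context {R : realType} {k : nat} {d : measure_display} {S : measurableType d}.
Variables (nu : {measure set S -> \bar R}) (chi : set S) (p : 'I_k -> S -> R).
Variables (f : 'I_k -> R) (B : R).
Hypothesis mchi : measurable chi.
Hypothesis hp : forall l, density nu chi (p l).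
Hypothesis sf : simplex f.
Hypothesis hB : forall l l' l'',
  (\int[nu]_(x in chi) (((p l x)%:E / (p l' x)%:E) ^+ 2 * (p l'' x)%:E) <= B%:E)%E.

Definition positive_set : set S :=
  chi `&` \bigcap_(l in [set: 'I_k]) [set x | 0 < p l x].
Local Notation N := positive_set.

Definition pdens (l : 'I_k) : S -> R := p l \_ N.
Definition mdens (x : S) : R := \sum_l f l * pdens l x.
(** The value 1 off the support makes every likelihood vector positive everywhere;
    almost surely no observation is there. *)
Definition lik (x : S) (l : 'I_k) : R := if x \in N then p l x else 1.

Lemma measurable_positive_in (h : S -> R) : measurable_fun chi h ->
  measurable (chi `&` [set x | 0 < h x]).
Proof.
move=> mh; rewrite (_ : [set x | 0 < h x] = h @^-1` `]0, +oo[%classic).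
  exact: mh.
by apply/seteqP; split => x /=; rewrite in_itv/= andbT.
Qed.

Lemma measurable_positive_set : measurable N.
Proof.
have [l0 _] := heavy_exists (simplex_heavy sf).
rewrite (_ : N = \bigcap_(l in [set: 'I_k]) (chi `&` [set x | 0 < p l x])).
  apply: fin_bigcap_measurable => // l _.
  by apply: measurable_positive_in; have [] := hp l.
apply/seteqP; split => x; first by move=> [cx px] l _; split => //; exact: px.
by move=> H; split => [|l _]; [have [] := H l0 I|have [] := H l I].
Qed.
Hint Resolve measurable_positive_set : core.

Lemma measurable_pdens l : measurable_fun setT (pdens l).
Proof.
apply/(measurable_restrictT _ measurable_positive_set).
by apply: (measurable_funS mchi (@subIsetl _ _ _)); have [] := hp l.
Qed.

Lemma pdens_in l x : N x -> pdens l x = p l x.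
Proof. by move=> Nx; rewrite /pdens patchE mem_set. Qed.

Lemma pdens_out l x : ~ N x -> pdens l x = 0.
Proof. by move=> Nx; rewrite /pdens patchE memNset. Qed.

Lemma p_gt0 l x : N x -> 0 < p l x.
Proof. by move=> [_ /(_ l I)]. Qed.

Lemma pdens_ge0 l x : 0 <= pdens l x.
Proof.
have [Nx|Nx] := pselect (N x); last by rewrite pdens_out.
by rewrite pdens_in// ltW// p_gt0.
Qed.

Lemma mdens_ge0 x : 0 <= mdens x.
Proof. by apply: sumr_ge0 => l _; rewrite mulr_ge0 ?pdens_ge0//; case: sf. Qed.

Lemma measurable_mdens : measurable_fun setT mdens.
Proof.
by apply: measurable_sum => l; apply: measurable_funM => //; exact: measurable_pdens.
Qed.

Lemma lik_gt0 x l : 0 < lik x l.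
Proof. by rewrite /lik; case: ifPn => // /set_mem/p_gt0. Qed.

Lemma measurable_lik l : measurable_fun setT (lik ^~ l).
Proof.
rewrite (_ : lik ^~ l = fun x => pdens l x + \1_(~` N) x).
  apply: measurable_funD; first exact: measurable_pdens.
  by apply: measurable_indic; exact: measurableC.
apply/funext => x; rewrite /lik /pdens patchE indicE in_setC.
by case: (x \in N) => /=; rewrite ?addr0 ?add0r.
Qed.

Lemma mdens_gt0 x : N x -> 0 < mdens x.
Proof.
move=> Nx; rewrite (_ : mdens x = mix f (p^~ x)).
  by apply: mix_gt0; [exact: simplex_heavy|move=> l; exact: p_gt0].
by apply: eq_bigr => l _; rewrite pdens_in.
Qed.

(** Where [p l] is positive and [p l'] vanishes the likelihood ratio is infinite, so
    its finite second moment under [p l] makes that set null. *)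
Lemma ae_support : {ae nu, forall x, chi x -> forall l, 0 < p l x -> N x}.
Proof.
pose U l l' := chi `&` [set x | 0 < p l x] `&`
  ~` (chi `&` [set x | 0 < p l' x]).
have mU l l' : measurable (U l l').
  apply: measurableI; last apply: measurableC;
  by apply: measurable_positive_in; have [] := hp l; have [] := hp l'.
have U0 l l' : nu (U l l') = 0%E.
  apply/eqP; apply/negPn/negP => nU.
  have : (\int[nu]_(x in U l l') cst +oo x <= B%:E)%E.
    apply: le_trans (hB l l' l); rewrite integral_mkcond [leRHS]integral_mkcond.
    apply: le_integral_sup => x _; first by rewrite patchE; case: ifP => _ //; exact: le0y.
    have p0 : chi x -> (0 <= (p l x)%:E)%E.
      by move=> cx; rewrite lee_fin; have [_ + _] := hp l; apply.
    rewrite patchE; case: ifPn => [/set_mem[[cx px] px']|_]; last first.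
      apply: erestrict_ge0 => t ct; apply: mule_ge0.
        by rewrite -[(_ ^+ 2)%E]/(_ * _)%E sqre_ge0.
      by rewrite lee_fin; have [_ + _] := hp l; apply.
    rewrite patchE mem_set//.
    have p'0 : p l' x = 0.
      apply/eqP; rewrite eq_le; have [_ + _] := hp l' => /(_ x cx) ->.
      by rewrite andbT leNgt; apply/negP => H; apply: px'.
    rewrite p'0 inve0 gt0_muley ?lte_fin// -[(_ ^+ 2)%E]/(_ * _)%E mulyy.
    by rewrite gt0_mulye ?lte_fin.
  rewrite integral_cst// gt0_mulye ?leye_eq//.
  by rewrite lt_neqAle eq_sym nU measure_ge0.
have : {ae nu, forall x, forall l l', ~ U l l' x}.
  apply: ae_forall_countable => l; apply: ae_forall_countable => l'.
  exists (U l l'); split => // x /=; rewrite not_notE//.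
apply: filterS => x nU cx l px; split => // l' _ /=.
apply: contrapT => H; apply: (nU l l'); split => //= -[_].
exact: H.
Qed.

Lemma pdens_law l A : measurable A ->
  (\int[nu]_(x in chi `&` A) (p l x)%:E = \int[nu]_(x in A) (pdens l x)%:E)%E.
Proof.
move=> mA; have [mp p0 _] := hp l.
rewrite setIC integral_mkcondr; apply: ge0_ae_eq_integral => //.
- apply: measurable_funTS; apply/(measurable_restrictT _ mchi).
  exact/measurable_EFinP.
- by apply/measurable_EFinP; apply: measurable_funTS; exact: measurable_pdens.
- by move=> x _; apply: erestrict_ge0 => y cy; rewrite lee_fin p0.
- by move=> x _; rewrite lee_fin pdens_ge0.
- move: ae_support; apply: filterS => x H _ /=.
  rewrite patchE; case: ifPn => [/set_mem cx|/negP cx]; last first.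
    by rewrite pdens_out// => -[/mem_set].
  have [px|px] := ltP 0 (p l x); first by rewrite pdens_in//; exact: (H cx l).
  have [Nx|Nx] := pselect (N x); first by rewrite pdens_in.
  by rewrite pdens_out//; congr EFin; apply/le_anti; rewrite px p0.
Qed.

Lemma pdens_integral l : (\int[nu]_x (pdens l x)%:E = 1)%E.
Proof. by rewrite -pdens_law// setIT; have [] := hp l. Qed.

Lemma mdens_law A : measurable A ->
  (\int[nu]_(x in A) (mdens x)%:E =
   \sum_l (f l)%:E * \int[nu]_(x in A) (pdens l x)%:E)%E.
Proof.
move=> mA.
have mpl l : measurable_fun A (fun x => (pdens l x)%:E).
  by apply/measurable_EFinP; apply: measurable_funTS; exact: measurable_pdens.
have p0 l x : (0 <= (pdens l x)%:E)%E by rewrite lee_fin pdens_ge0.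
transitivity (\int[nu]_(x in A) \sum_l ((f l)%:E * (pdens l x)%:E))%E.
  by apply: eq_integral => x _; rewrite /mdens -sumEFin.
have [f0 _] := sf.
rewrite ge0_integral_sum//.
- apply: eq_bigr => l _; rewrite ge0_integralZl_EFin//.
- by move=> l; apply: emeasurable_funM.
- by move=> l x _; rewrite mule_ge0// lee_fin.
Qed.

Lemma sum_square_le (n : nat) (a : 'I_n -> R) :
  (\sum_i a i) ^+ 2 <= n%:R * \sum_i a i ^+ 2.
Proof.
apply: (@le_trans _ _ (\sum_i \sum_j (a i ^+ 2 / 2 + a j ^+ 2 / 2))).
  rewrite expr2 mulr_suml; apply: ler_sum => i _; rewrite mulr_sumr.
  by apply: ler_sum => j _; have := sqr_ge0 (a i - a j); rewrite sqrrB; lra.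
under eq_bigr do rewrite big_split/= sumr_const card_ord -mulr_suml.
rewrite big_split/= sumrMnl -mulr_suml sumr_const card_ord.
rewrite -[X in X + _]mulr_natl -[X in _ + X <= _]mulr_natl.
by move: (\sum_i _) => s; lra.
Qed.

Lemma spread_second_moment :
  (\int[nu]_x (spread (lik x) ^+ 2 * mdens x)%:E <= (k%:R ^+ 4 * B)%:E)%E.
Proof.
have [f0 f1] := sf.
pose F (l l' l'' : 'I_k) x := f l'' * ((lik x l / lik x l') ^+ 2 * pdens l'' x).
have F0 l l' l'' x : 0 <= F l l' l'' x.
  by rewrite mulr_ge0// mulr_ge0 ?sqr_ge0// pdens_ge0.
have mr l l' l'' : measurable_fun setT
    (fun x => (lik x l / lik x l') ^+ 2 * pdens l'' x).
  apply: measurable_funM; last exact: measurable_pdens.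
  apply: measurable_funX; apply: measurable_funM; first exact: measurable_lik.
  apply: measurable_inv_pos; [by move=> x; exact: lik_gt0|exact: measurable_lik].
have mF l l' l'' : measurable_fun setT (fun x => (F l l' l'' x)%:E).
  by apply/measurable_EFinP; exact: measurable_funM.
have iF l l' l'' : (\int[nu]_x (F l l' l'' x)%:E <= (f l'' * B)%:E)%E.
  under eq_integral do rewrite EFinM.
  rewrite ge0_integralZl_EFin//; last 2 first.
  - by move=> x _; rewrite lee_fin mulr_ge0 ?sqr_ge0// pdens_ge0.
  - exact/measurable_EFinP.
  rewrite [leRHS]EFinM lee_wpmul2l ?lee_fin//.
  apply: le_trans (hB l l' l''); rewrite [leRHS]integral_mkcond.
  apply: le_integral_sup => x _.
    by rewrite lee_fin mulr_ge0 ?sqr_ge0// pdens_ge0.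
  have [Nx|Nx] := pselect (N x); last first.
    rewrite pdens_out// mulr0; apply: erestrict_ge0 => t ct; apply: mule_ge0.
      by rewrite -[(_ ^+ 2)%E]/(_ * _)%E sqre_ge0.
    by rewrite lee_fin; have [_ + _] := hp l''; apply.
  rewrite patchE mem_set; last by case: Nx.
  rewrite pdens_in// /lik mem_set// inver gt_eqF ?p_gt0//.
(* The square of the double sum is at most [k ^ 2] times the sum of the squares; the
   other factor [k ^ 2] is the number of pairs. *)
apply: (@le_trans _ _ (\int[nu]_x \sum_l \sum_l' \sum_l''
    ((k%:R ^+ 2)%:E * (F l l' l'' x)%:E)))%E.
  apply: le_integral_sup => x _.
    by rewrite lee_fin mulr_ge0 ?sqr_ge0// mdens_ge0.
  under eq_bigr do under eq_bigr do
    (under eq_bigr do rewrite -EFinM; rewrite sumEFin).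
  under eq_bigr do rewrite sumEFin.
  rewrite sumEFin lee_fin.
  have -> : \sum_l \sum_l' \sum_l'' k%:R ^+ 2 * F l l' l'' x =
      k%:R ^+ 2 * (\sum_l \sum_l' (lik x l / lik x l') ^+ 2) * mdens x.
    have inner l l' : \sum_l'' k%:R ^+ 2 * F l l' l'' x =
        k%:R ^+ 2 * ((lik x l / lik x l') ^+ 2 * mdens x).
      by rewrite /mdens !mulr_sumr; apply: eq_bigr => l'' _; rewrite /F; ring.
    under eq_bigr do under eq_bigr do rewrite inner.
    under eq_bigr do rewrite -mulr_sumr -mulr_suml.
    by rewrite -mulr_sumr -mulr_suml mulrA.
  rewrite ler_wpM2r ?mdens_ge0//.
  apply: le_trans (sum_square_le _) _.
  rewrite expr2 -mulrA ler_wpM2l// mulr_sumr; apply: ler_sum => l _.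
  exact: sum_square_le.
rewrite ge0_integral_sum//; last 2 first.
- move=> l; apply: emeasurable_sum => l'; apply: emeasurable_sum => l''.
  exact: emeasurable_funM.
- move=> l x _; apply: sume_ge0 => l' _; apply: sume_ge0 => l'' _.
  by rewrite mule_ge0// lee_fin ?sqr_ge0.
apply: (@le_trans _ _ (\sum_(l < k) \sum_(l' < k) \sum_(l'' < k)
   (k%:R ^+ 2 * (f l'' * B))%:E))%E.
  apply: lee_sum => l _; rewrite ge0_integral_sum//; last 2 first.
  - by move=> l'; apply: emeasurable_sum => l''; exact: emeasurable_funM.
  - move=> l' x _; apply: sume_ge0 => l'' _.
    by rewrite mule_ge0// lee_fin ?sqr_ge0.
  apply: lee_sum => l' _; rewrite ge0_integral_sum//; last 2 first.
  - by move=> l''; exact: emeasurable_funM.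
  - by move=> l'' x _; rewrite mule_ge0// lee_fin ?sqr_ge0.
  apply: lee_sum => l'' _; rewrite ge0_integralZl_EFin ?sqr_ge0//; last first.
    by move=> x _; rewrite lee_fin.
  by rewrite [leRHS]EFinM lee_wpmul2l// lee_fin sqr_ge0.
under eq_bigr do under eq_bigr do rewrite sumEFin -mulr_sumr -mulr_suml f1 mul1r.
under eq_bigr do rewrite sumEFin sumr_const card_ord.
rewrite sumEFin lee_fin sumr_const card_ord -[leLHS]mulr_natl -[X in _ * X <= _]mulr_natl.
by rewrite le_eqVlt; apply/orP; left; apply/eqP; ring.
Qed.

Lemma inverse_ratio_mean g : simplex g ->
  (\int[nu]_x (mix g (lik x) / mix f (lik x) * mdens x)%:E <= 1)%E.
Proof.
move=> [g0 g1].
have mE l : measurable_fun setT (fun x => (pdens l x)%:E).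
  by apply/measurable_EFinP; exact: measurable_pdens.
apply: (@le_trans _ _ (\int[nu]_x \sum_l ((g l)%:E * (pdens l x)%:E)))%E.
  apply: le_integral_sup => x _.
    rewrite lee_fin mulr_ge0 ?mdens_ge0//.
    have l0 l : 0 <= lik x l by exact/ltW/lik_gt0.
    by rewrite divr_ge0 ?mix_ge0//; case: sf.
  under eq_bigr do rewrite -EFinM.
  rewrite sumEFin lee_fin.
  have [Nx|Nx] := pselect (N x); last first.
    rewrite /mdens big1 ?mulr0; last by move=> l _; rewrite pdens_out ?mulr0.
    by apply: sumr_ge0 => l _; rewrite mulr_ge0 ?pdens_ge0.
  have m0 := mdens_gt0 Nx.
  have likE l : lik x l = pdens l x by rewrite /lik mem_set// pdens_in.
  have mixE h : mix h (lik x) = \sum_l h l * pdens l x.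
    by apply: eq_bigr => l _; rewrite likE.
  by rewrite !mixE -/(mdens x) divfK ?gt_eqF.
rewrite ge0_integral_sum//; last 2 first.
- by move=> l; exact: emeasurable_funM.
- by move=> l x _; rewrite mule_ge0// lee_fin ?pdens_ge0.
rewrite (eq_bigr (fun l => (g l)%:E)); first by rewrite sumEFin g1.
move=> l _; rewrite ge0_integralZl_EFin ?pdens_integral ?mule1//.
by move=> x _; rewrite lee_fin pdens_ge0.
Qed.

(** The mixture density is positive on the common support, so a set that it does
    not charge is null there; off the common support almost every point is a zero
    of all the components. *)
Lemma mixture_ae_eq g : simplex g ->
  (\int[nu]_(x in [set x | mix g (lik x) != mix f (lik x)]) (mdens x)%:E = 0)%E ->
  {ae nu, forall x, chi x -> \sum_l g l * p l x = \sum_l f l * p l x}.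
Proof.
move=> sg H.
have mmix h : measurable_fun setT (fun x => mix h (lik x)).
  by apply: measurable_sum => l; apply: measurable_funM => //; exact: measurable_lik.
pose D := [set x | mix g (lik x) != mix f (lik x)].
have mD : measurable D.
  rewrite (_ : D = (fun x => mix g (lik x) - mix f (lik x)) @^-1` (~` [set 0])).
    rewrite -[X in measurable X]setTI.
    apply: (measurable_funB (mmix g) (mmix f)) => //.
    exact: measurableC.
  by apply/seteqP; split => x /=; rewrite /D/= -subr_eq0 => /eqP.
have : ae_eq nu D (EFin \o mdens) (cst 0%E).
  apply/(ae_eq_integral_abs nu mD).
    by apply/measurable_EFinP; apply: measurable_funTS; exact: measurable_mdens.
  rewrite -[RHS]H; apply: eq_integral => x _.
  by rewrite /= ger0_norm ?mdens_ge0.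
move: ae_support; apply: filterS2 => x Hs Hd cx.
have [Nx|Nx] := pselect (N x).
  have likE h : mix h (lik x) = \sum_l h l * p l x.
    by apply: eq_bigr => l _; rewrite /lik mem_set.
  rewrite -!likE; apply: contrapT => ne.
  have [] := Hd (introN eqP ne); have := mdens_gt0 Nx.
  by move=> /[swap] -> ; rewrite ltxx.
have pl0 l : p l x = 0.
  have [_ /(_ x cx) + _] := hp l.
  by rewrite le_eqVlt => /predU1P[<-|/(Hs cx)].
by rewrite !big1// => l _; rewrite pl0 mulr0.
Qed.

End common_support.

(** * Random selection of a component *)

Section selection.
Context {R : realType} {k : nat} {dO d : measure_display}.
Context {Omega : measurableType dO} {S : measurableType d}.
Variable P : probability Omega R.
Local Open Scope ereal_scope.

(** Total mass 1 makes the complement of the union null, so the events partition the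
    probability space up to a null set. *)
Lemma finite_partition (E : 'I_k -> set Omega) (A : set Omega) :
  (forall l, measurable (E l)) ->
  (forall l l' omega, E l omega -> E l' omega -> l = l') ->
  \sum_l P (E l) = 1 -> measurable A -> P A = \sum_l P (A `&` E l).
Proof.
move=> mE dE sumE mA.
pose s := index_enum 'I_k.
have tE (D : set Omega) : trivIset [set` s] (fun l => D `&` E l).
  apply/trivIsetP => l l' _ _ ll'; rewrite -subset0 => omega.
  by move=> [[_ El] [_ El']]; move: ll'; rewrite (dE _ _ _ El El') eqxx.
pose U := \bigcup_(l in [set` s]) E l.
have fs : finite_set [set` s] by exact: finite_seq.
have mU : measurable U by apply: fin_bigcup_measurable => // l _.
have sumD (D : set Omega) : measurable D -> P (D `&` U) = \sum_l P (D `&` E l).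
  move=> mD; rewrite /U setI_bigcupr measure_fin_bigcup//.
    by rewrite -fsbig_seq// index_enum_uniq.
  by move=> l _; exact: measurableI.
have PU : P U = 1.
  by rewrite -[U]setTI sumD// -sumE; apply: eq_bigr => l _; rewrite setTI.
transitivity (P (A `\` U) + P (A `&` U)); first exact: measureDI.
rewrite sumD// [X in X + _](_ : _ = 0) ?add0e//.
apply: (@subset_measure0 _ _ _ _ _ (~` U)) => //.
- exact: measurableD.
- exact: measurableC.
- transitivity (1 - P U); first exact: probability_setC.
  by rewrite PU subee.
Qed.

Lemma sigma_of_preimage {J : Type} (D : set J) {d' : measure_display}
    {T : measurableType d'} (Y : J -> Omega -> T) j B :
  D j -> measurable B -> sigma_of D Y (Y j @^-1` B).
Proof.
move=> Dj mB; apply: sub_sigma_algebra; exists j => //.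
by exists B => //; rewrite setTI.
Qed.

Lemma sigma_of_finite_bigcap {J : Type} (D : set J) {d' : measure_display}
    {T : measurableType d'} (Y : J -> Omega -> T) (I : finType) (F : I -> set Omega) :
  (forall i, sigma_of D Y (F i)) ->
  sigma_of D Y (\bigcap_(i in [set: I]) F i).
Proof.
move=> mF.
exact: (@fin_bigcap_measurable _ (g_sigma_algebraType
  (\bigcup_(j in D) g_sigma_algebra_preimage (Y j))) I setT F finite_finset
  (fun i _ => mF i)).
Qed.

Lemma sigma_ofI {J : Type} (D : set J) {d' : measure_display}
    {T : measurableType d'} (Y : J -> Omega -> T) A B :
  sigma_of D Y A -> sigma_of D Y B -> sigma_of D Y (A `&` B).
Proof.
exact: (@measurableI _ (g_sigma_algebraType
  (\bigcup_(j in D) g_sigma_algebra_preimage (Y j)))).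
Qed.

Variable f : 'I_k -> R.
Hypothesis sf : simplex f.
Variables (Z : nat -> 'I_k -> {RV P >-> S}) (I : nat -> 'I_k -> {RV P >-> nat}).
Variable X : nat -> {RV P >-> S}.

Definition selects (i : nat) (l : 'I_k) : set Omega :=
  [set omega | forall l', I i l' omega = (l' == l)].

Hypothesis hX : forall i l omega, selects i l omega -> X i omega = Z i l omega.
Hypothesis hI_law : forall i, multinomial_distributed P 1 f (I i).
Hypothesis hZ_indep : mutually_independent P
  (fun l => sigma_of [set: nat] (fun i => Z i l)).
Hypothesis hI_indep : mutually_independent P
  (fun i => sigma_of [set: 'I_k] (fun l => I i l)).
Hypothesis hIZ_indep : independent P
  (sigma_of [set: nat * 'I_k] (fun il => I il.1 il.2))
  (sigma_of [set: nat * 'I_k] (fun il => Z il.1 il.2)).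

Lemma selectsE i l : selects i l =
  \bigcap_(l' in [set: 'I_k]) (I i l' @^-1` [set (l' == l) : nat]).
Proof.
by apply/seteqP; split => omega H l' => [_|]; [exact: H|exact: (H l' Logic.I)].
Qed.

Lemma measurable_preimage {d' : measure_display} {T : measurableType d'}
  (Y : {RV P >-> T}) B : measurable B -> measurable (Y @^-1` B).
Proof. by move=> mB; rewrite -[X in measurable X]setTI; exact: measurable_funP. Qed.

Lemma measurable_selects i l : measurable (selects i l).
Proof.
rewrite selectsE; apply: fin_bigcap_measurable => // l' _.
exact: measurable_preimage.
Qed.

Lemma selects_uniq i l l' omega :
  selects i l omega -> selects i l' omega -> l = l'.
Proof.
move=> /(_ l) /= e1 /(_ l) /= e2; move: e1; rewrite e2 eqxx.
by case: eqP.
Qed.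

Lemma selects_law i l : P (selects i l) = (f l)%:E.
Proof.
rewrite (hI_law i (fun l' => (l' == l) : nat)) /multinomial_pmf.
have -> : (\sum_l0 (l0 == l))%N = 1%N.
  by rewrite (bigD1 l)//= eqxx big1// => i' /negPf ->.
rewrite eqxx; congr EFin.
have -> : (\prod_(l0 < k) (l0 == l)`!)%N = 1%N.
  by rewrite big1// => i' _; case: eqP.
rewrite (bigD1 l)//= eqxx expr1 big1; last by move=> i' /negPf ->; rewrite expr0.
by rewrite mulr1 divr1 mul1r.
Qed.

Lemma sum_selects i : \sum_l P (selects i l) = 1.
Proof.
rewrite (eq_bigr (fun l => (f l)%:E)); last by move=> l _; exact: selects_law.
by rewrite sumEFin; case: sf => _ ->.
Qed.

Lemma sigma_selects i l :
  sigma_of [set: nat * 'I_k] (fun il => I il.1 il.2) (selects i l).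
Proof.
rewrite selectsE; apply: sigma_of_finite_bigcap => l'.
exact: (@sigma_of_preimage _ setT _ _ (fun il => I il.1 il.2) (i, l')).
Qed.

Lemma sigma_selects_at i l : sigma_of [set: 'I_k] (fun l => I i l) (selects i l).
Proof.
rewrite selectsE; apply: sigma_of_finite_bigcap => l'.
exact: (@sigma_of_preimage _ setT _ _ (fun l => I i l) l').
Qed.

Lemma selection_law i B : measurable B ->
  P (X i @^-1` B) = \sum_l (f l)%:E * P (Z i l @^-1` B).
Proof.
move=> mB; rewrite (finite_partition (measurable_selects i)
  (@selects_uniq i) (sum_selects i)); last exact: measurable_preimage.
apply: eq_bigr => l _; rewrite -(selects_law i l).
rewrite -hIZ_indep; last 2 first.
- exact: sigma_selects.
- exact: (@sigma_of_preimage _ setT _ _ (fun il => Z il.1 il.2) (i, l)).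
congr (P _); apply/seteqP; split => omega /=.
  by move=> [XB sel]; split => //; rewrite -(hX sel).
by move=> [sel ZB]; split => //; rewrite /preimage/= (hX sel).
Qed.

(** Conditioning on the two selections, which are independent of each other and of
    the components. *)
Lemma selection_pair_law i j B C : i != j -> measurable B -> measurable C ->
  P (X i @^-1` B `&` X j @^-1` C) =
  \sum_l \sum_l' (f l * f l')%:E * P (Z i l @^-1` B `&` Z j l' @^-1` C).
Proof.
move=> ij mB mC.
have mBC : measurable (X i @^-1` B `&` X j @^-1` C).
  by apply: measurableI; exact: measurable_preimage.
rewrite (finite_partition (measurable_selects i)
  (@selects_uniq i) (sum_selects i))//.
apply: eq_bigr => l _.
rewrite (finite_partition (measurable_selects j)
  (@selects_uniq j) (sum_selects j)); last first.
  by apply: measurableI => //; exact: measurable_selects.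
apply: eq_bigr => l' _.
have Pss : P (selects i l `&` selects j l') = (f l * f l')%:E.
  have := @hI_indep [:: i; j] (fun n => if n == i then selects i l else selects j l').
  rewrite !big_cons !big_nil setIT mule1 eqxx eq_sym (negPf ij).
  rewrite !selects_law -EFinM; apply => /=.
    by rewrite inE ij.
  move=> n; rewrite !inE => /orP[/eqP->|/eqP->].
    by rewrite eqxx; exact: sigma_selects_at.
  by rewrite eq_sym (negPf ij); exact: sigma_selects_at.
rewrite -Pss -hIZ_indep; last 2 first.
- by apply: sigma_ofI; exact: sigma_selects.
- apply: sigma_ofI.
    exact: (@sigma_of_preimage _ setT _ _ (fun il => Z il.1 il.2) (i, l)).
  exact: (@sigma_of_preimage _ setT _ _ (fun il => Z il.1 il.2) (j, l')).
congr (P _); apply/seteqP; split => omega /=.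
  move=> [[[XB XC] si] sj]; split => //; split.
    by rewrite -(hX si).
  by rewrite -(hX sj).
move=> [[si sj] [ZB ZC]]; split => //; split => //; split.
  by rewrite /preimage/= (hX si).
by rewrite /preimage/= (hX sj).
Qed.

Lemma component_pair_law i j l l' B C : l != l' -> measurable B -> measurable C ->
  P (Z i l @^-1` B `&` Z j l' @^-1` C) = P (Z i l @^-1` B) * P (Z j l' @^-1` C).
Proof.
move=> ll' mB mC.
have := @hZ_indep [:: l; l'] (fun n => if n == l then Z i l @^-1` B else Z j l' @^-1` C).
rewrite !big_cons !big_nil setIT mule1 eqxx eq_sym (negPf ll').
apply => /=; first by rewrite inE ll'.
move=> n; rewrite !inE => /orP[/eqP->|/eqP->].
  rewrite eqxx; exact: (@sigma_of_preimage _ setT _ _ (fun i => Z i l) i).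
rewrite eq_sym (negPf ll').
exact: (@sigma_of_preimage _ setT _ _ (fun i => Z i l') j).
Qed.

End selection.

(** * Mixing of the observed process *)

Section observed_process.
Context {R : realType} {k : nat} {dO d : measure_display}.
Context {Omega : measurableType dO} {S : measurableType d}.
Variable P : probability Omega R.
Variables (nu : {sigma_finite_measure set S -> \bar R}) (chi : set S).
Variables (p : 'I_k -> S -> R) (f : 'I_k -> R) (B : R).
Hypothesis mchi : measurable chi.
Hypothesis hp : forall l, density nu chi (p l).
Hypothesis sf : simplex f.
Hypothesis hB : forall l l' l'',
  (\int[nu]_(x in chi) (((p l x)%:E / (p l' x)%:E) ^+ 2 * (p l'' x)%:E) <= B%:E)%E.

Local Notation N := (positive_set chi p).
Local Notation pd := (pdens chi p).
Local Notation md := (mdens chi p f).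
Local Notation lk := (lik chi p).

Lemma law_integral (V : {RV P >-> S}) (h : S -> R) (G : S -> \bar R) :
  (forall x, 0 <= h x) -> measurable_fun setT h ->
  (forall A, measurable A -> (P (V @^-1` A) = \int[nu]_(x in A) (h x)%:E)%E) ->
  measurable_fun setT G -> (forall x, (0 <= G x)%E) ->
  (\int[P]_omega G (V omega) = \int[nu]_x (G x * (h x)%:E))%E.
Proof.
move=> h0 mh law mG G0.
transitivity (\int[distribution P V]_x G x)%E.
  by rewrite ge0_integral_pushforward.
exact: (@integral_density _ _ _ (distribution P V) nu h G h0 mh law mG G0).
Qed.

Lemma product_integral (u v : S -> R) : (forall x, 0 <= u x) ->
  (forall x, 0 <= v x) -> measurable_fun setT u -> measurable_fun setT v ->
  (\int[nu \x nu]_z (u z.1 * v z.2)%:E =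
   \int[nu]_x (u x)%:E * \int[nu]_x (v x)%:E)%E.
Proof.
move=> u0 v0 mu mv.
have mE (h : S -> R) : measurable_fun setT h ->
  measurable_fun setT (fun x => (h x)%:E) by move=> ?; exact/measurable_EFinP.
rewrite fubini_tonelli1//; last 2 first.
- apply/measurable_EFinP; apply: measurable_funM.
    exact: (measurableT_comp mu).
  exact: (measurableT_comp mv).
- by move=> z; rewrite lee_fin mulr_ge0.
rewrite /fubini_F/=.
have iv0 : (0 <= \int[nu]_x (v x)%:E)%E.
  by apply: integral_ge0 => x _; rewrite lee_fin.
rewrite -ge0_integralZr//; last 2 first.
- exact: mE.
- by move=> x _; rewrite lee_fin.
apply: eq_integral => x _.
under eq_integral do rewrite EFinM.
rewrite ge0_integralZl_EFin//; last exact: mE.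
by move=> y _; rewrite lee_fin.
Qed.

Variables (Z : nat -> 'I_k -> {RV P >-> S}) (I : nat -> 'I_k -> {RV P >-> nat}).
Variable X : nat -> {RV P >-> S}.
Hypothesis hX : forall i l omega, selects I i l omega -> X i omega = Z i l omega.
Hypothesis hZ_chi : forall i l omega, chi (Z i l omega).
Hypothesis hZ_density : forall i l, has_density P nu chi (Z i l) (p l).
Hypothesis hI_law : forall i, multinomial_distributed P 1 f (I i).
Hypothesis hZ_indep : mutually_independent P
  (fun l => sigma_of [set: nat] (fun i => Z i l)).
Hypothesis hI_indep : mutually_independent P
  (fun i => sigma_of [set: 'I_k] (fun l => I i l)).
Hypothesis hIZ_indep : independent P
  (sigma_of [set: nat * 'I_k] (fun il => I il.1 il.2))
  (sigma_of [set: nat * 'I_k] (fun il => Z il.1 il.2)).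
Variable cstep : 'I_k -> nat -> nat -> S -> S -> R.
Hypothesis hcstep : forall l i n, (0 < n)%N ->
  conditional_density P nu chi chi (Z i l) (Z (i + n)%N l) (cstep l i n).
Variables (c0 rho : R).
Hypothesis hc0 : 0 <= c0.
Hypothesis hrho : 0 < rho < 1.
Hypothesis hmix : forall l i n, (0 < n)%N ->
  (\int[nu]_(x in chi) \int[nu]_(y in chi)
     (((cstep l i n x y)%:E / (p l y)%:E - 1) ^+ 2 *
      (\sum_l f l * p l y)%:E * (\sum_l f l * p l x)%:E)
   <= (c0 * rho ^+ (2 * n))%:E)%E.

Let mN : measurable N := measurable_positive_set mchi hp sf.
Let mpd l : measurable_fun setT (pd l) := measurable_pdens mchi hp sf l.
Let mmd : measurable_fun setT md := measurable_mdens mchi hp sf.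
Let pd0 l x : 0 <= pd l x := pdens_ge0 chi p l x.
Let md0 x : 0 <= md x := mdens_ge0 chi p sf x.

Lemma component_law i l A : measurable A ->
  (P (Z i l @^-1` A) = \int[nu]_(x in A) (pd l x)%:E)%E.
Proof. by move=> mA; rewrite hZ_density// (pdens_law mchi hp sf hB). Qed.

Lemma observed_law i A : measurable A ->
  (P (X i @^-1` A) = \int[nu]_(x in A) (md x)%:E)%E.
Proof.
move=> mA; rewrite (selection_law sf hX hI_law hIZ_indep i mA) mdens_law//.
by apply: eq_bigr => l _; rewrite component_law.
Qed.

Lemma observed_in_support i : {ae P, forall omega, N (X i omega)}.
Proof.
exists (X i @^-1` (~` N)); split.
- by apply: measurable_preimage; exact: measurableC.
- rewrite observed_law; last exact: measurableC.
  apply: integral0_eq => x Nx; congr EFin.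
  by apply: big1 => l _; rewrite pdens_out ?mulr0.
- by move=> omega.
Qed.

(** The conditional density is cut down to the common support in its second argument;
    there the quotient by [p l] is an honest real number. *)
Definition step_density (l : 'I_k) (i n : nat) : S * S -> R :=
  (fun z => cstep l i n z.1 z.2) \_ (chi `*` N).

Let chiN z : (chi `*` N) z -> (chi `*` chi) z.
Proof. by move=> [cx [cy _]]. Qed.

Lemma measurable_step_density l i n : (0 < n)%N ->
  measurable_fun setT (step_density l i n).
Proof.
move=> n0; have [mc _ _] := hcstep l i n0.
apply/(measurable_restrictT _ (measurableX mchi mN)).
by apply: (measurable_funS (measurableX mchi mchi)) mc => z; exact: chiN.
Qed.

Lemma step_density_ge0 l i n z : (0 < n)%N -> 0 <= step_density l i n z.
Proof.
move=> n0; have [_ c_ge0 _] := hcstep l i n0.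
rewrite /step_density patchE; case: ifPn => // /set_mem /chiN[cx cy].
exact: c_ge0.
Qed.

(** The later variable almost surely lies in the common support, so the cut does not
    change the joint law; the outer integral is transported from the probability
    space to the density of the earlier variable. *)
Lemma step_law l i n A C : (0 < n)%N -> measurable A -> measurable C ->
  (P (Z i l @^-1` A `&` Z (i + n)%N l @^-1` C) =
   \int[nu]_(x in A) \int[nu]_(y in C)
      (pd l x * step_density l i n (x, y))%:E)%E.
Proof.
move=> n0 mA mC; have [mc c_ge0 hc] := hcstep l i n0.
have mCN : measurable (C `&` N) by exact: measurableI.
have -> : (P (Z i l @^-1` A `&` Z (i + n)%N l @^-1` C) =
    P (Z i l @^-1` A `&` Z (i + n)%N l @^-1` (C `&` N)))%E.
  have mZA : measurable (Z i l @^-1` A) by exact: measurable_preimage.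
  have mZN : measurable (Z (i + n)%N l @^-1` N) by exact: measurable_preimage.
  have mZ : measurable (Z i l @^-1` A `&` Z (i + n)%N l @^-1` C).
    by apply: measurableI => //; exact: measurable_preimage.
  transitivity (P ((Z i l @^-1` A `&` Z (i + n)%N l @^-1` C) `\` Z (i + n)%N l @^-1` N)
    + P ((Z i l @^-1` A `&` Z (i + n)%N l @^-1` C) `&` Z (i + n)%N l @^-1` N))%E.
    exact: measureDI.
  rewrite [X in (X + _)%E](_ : _ = 0%E) ?add0e ?setIA//.
  apply: (@subset_measure0 _ _ _ _ _ (Z (i + n)%N l @^-1` (~` N))) => //.
  - exact: measurableD.
  - by apply: measurable_preimage; exact: measurableC.
  - transitivity (\int[nu]_(x in ~` N) (pd l x)%:E)%E.
      by apply: component_law; exact: measurableC.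
    by apply: integral0_eq => x Nx; rewrite pdens_out.
rewrite hc//.
pose G x : \bar R := (\int[nu]_(y in C) (step_density l i n (x, y))%:E)%E.
have sdm : measurable_fun setT (fun z => (step_density l i n z)%:E).
  by apply/measurable_EFinP; exact: measurable_step_density.
have mG : measurable_fun setT G.
  rewrite (_ : G = fubini_F nu ((fun z => (step_density l i n z)%:E) \_ (setT `*` C))).
    apply: measurable_fun_fubini_tonelli_F.
      apply/(measurable_restrictT _ (measurableX measurableT mC)).
      exact: measurable_funTS.
    by move=> z; apply: erestrict_ge0 => z' _; rewrite lee_fin step_density_ge0.
  apply/funext => x; rewrite /G /fubini_F [LHS]integral_mkcond.
  apply: eq_integral => y _; rewrite !patchE; case: ifPn => yC.
    by rewrite mem_set//; split => //; exact: set_mem.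
  by rewrite memNset// => -[_ /= Cy]; move/negP: yC; apply; exact: mem_set.
have G0 x : (0 <= G x)%E.
  by apply: integral_ge0 => y _; rewrite lee_fin step_density_ge0.
transitivity (\int[P]_(omega in Z i l @^-1` A) G (Z i l omega))%E.
  apply: eq_integral => omega _.
  have -> : chi `&` (C `&` N) = C `&` N.
    by apply/seteqP; split => y; [case|move=> [Cy Ny]; split => //; case: Ny].
  rewrite integral_mkcondr; apply: eq_integral => y _.
  rewrite /step_density !patchE; case: ifPn => yN.
    by rewrite mem_set//; split; [exact: hZ_chi|exact: set_mem].
  by rewrite memNset// => -[_ /= Ny]; move/negP: yN; apply; exact: mem_set.
transitivity (\int[P]_omega (G \_ A) (Z i l omega))%E.
  rewrite [LHS]integral_mkcond; apply: eq_integral => omega _.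
  by rewrite !patchE.
rewrite (@law_integral (Z i l) (pd l) (G \_ A))//.
- rewrite [RHS]integral_mkcond; apply: eq_integral => x _.
  rewrite !patchE; case: ifP => _; last by rewrite mul0e.
  rewrite /G -ge0_integralZr//; last 3 first.
  + exact/measurable_funTS/(measurableT_comp sdm)/pair1_measurable.
  + by move=> y _; rewrite lee_fin step_density_ge0.
  + by rewrite lee_fin.
  by apply: eq_integral => y _; rewrite -EFinM mulrC.
- by move=> A' mA'; exact: component_law.
- by apply/(measurable_restrictT _ mA); exact: measurable_funTS.
- by move=> x; exact: erestrict_ge0.
Qed.

Definition pair_density (i n : nat) (z : S * S) : R :=
  \sum_l \sum_l' f l * f l' *
    (pd l z.1 * (if l == l' then step_density l i n z else pd l' z.2)).

Lemma pair_density_ge0 i n z : (0 < n)%N -> 0 <= pair_density i n z.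
Proof.
have [f0 _] := sf.
move=> n0; apply: sumr_ge0 => l _; apply: sumr_ge0 => l' _.
rewrite mulr_ge0 ?mulr_ge0//; case: ifP => // _; exact: step_density_ge0.
Qed.

Lemma measurable_fst_comp (h : S -> R) : measurable_fun setT h ->
  measurable_fun setT (fun z : S * S => h z.1).
Proof. by move=> mh; exact: (measurableT_comp mh measurable_fst). Qed.

Lemma measurable_snd_comp (h : S -> R) : measurable_fun setT h ->
  measurable_fun setT (fun z : S * S => h z.2).
Proof. by move=> mh; exact: (measurableT_comp mh measurable_snd). Qed.

Let pd1 l : measurable_fun setT (fun z : S * S => pd l z.1) :=
  measurable_fst_comp (mpd l).
Let pd2 l : measurable_fun setT (fun z : S * S => pd l z.2) :=
  measurable_snd_comp (mpd l).

Lemma measurable_pair_density i n : (0 < n)%N ->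
  measurable_fun setT (pair_density i n).
Proof.
move=> n0; apply: measurable_sum => l; apply: measurable_sum => l'.
apply: measurable_funM => //; apply: measurable_funM => //.
by case: (l == l') => //; exact: measurable_step_density.
Qed.

Lemma pair_law i n A C : (0 < n)%N -> measurable A -> measurable C ->
  (P (X i @^-1` A `&` X (i + n)%N @^-1` C) =
   \int[nu]_(x in A) \int[nu]_(y in C) (pair_density i n (x, y))%:E)%E.
Proof.
move=> n0 mA mC; have [f0 _] := sf.
rewrite (selection_pair_law sf hX hI_law hI_indep hIZ_indep _ mA mC); last first.
  by rewrite neq_ltn -{1}[i]addn0 ltn_add2l n0.
pose q l l' z := pd l z.1 * (if l == l' then step_density l i n z else pd l' z.2).
have q0 l l' z : 0 <= q l l' z.
  by rewrite mulr_ge0//; case: ifP => // _; exact: step_density_ge0.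
have mq l l' : measurable_fun setT (q l l').
  by apply: measurable_funM => //; case: (l == l') => //; exact: measurable_step_density.
have mqx l l' x : measurable_fun C (fun y => (q l l' (x, y))%:E).
  apply/measurable_EFinP/measurable_funTS.
  exact/(measurableT_comp (mq l l'))/pair1_measurable.
have Pq l l' : (P (Z i l @^-1` A `&` Z (i + n)%N l' @^-1` C) =
    \int[nu]_(x in A) \int[nu]_(y in C) (q l l' (x, y))%:E)%E.
  rewrite /q; have [<-|ll'] := eqVneq l l'; first exact: step_law.
  rewrite (component_pair_law hZ_indep)// !component_law//.
  have ic0 : (0 <= \int[nu]_(y in C) (pd l' y)%:E)%E.
    by apply: integral_ge0 => y _; rewrite lee_fin.
  rewrite -ge0_integralZr//; last 2 first.
  - by apply/measurable_EFinP/measurable_funTS.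
  - by move=> x _; rewrite lee_fin.
  apply: eq_integral => x _ /=.
  under [RHS]eq_integral do rewrite EFinM.
  rewrite ge0_integralZl_EFin//.
  - by move=> y _; rewrite lee_fin.
  - by apply/measurable_EFinP/measurable_funTS.
have mI l l' : measurable_fun A (fun x => \int[nu]_(y in C) (q l l' (x, y))%:E)%E.
  apply: measurable_funTS.
  rewrite (_ : (fun x => _) = fubini_F nu ((fun z => (q l l' z)%:E) \_ (setT `*` C))).
    apply: measurable_fun_fubini_tonelli_F.
      apply/(measurable_restrictT _ (measurableX measurableT mC)).
      by apply: measurable_funTS; exact/measurable_EFinP.
    by move=> z; apply: erestrict_ge0 => z' _; rewrite lee_fin.
  apply/funext => x; rewrite /fubini_F [LHS]integral_mkcond.
  apply: eq_integral => y _; rewrite !patchE; case: ifPn => yC.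
    by rewrite mem_set//; split => //; exact: set_mem.
  by rewrite memNset// => -[_ /= Cy]; move/negP: yC; apply; exact: mem_set.
have I0 l l' x : (0 <= \int[nu]_(y in C) (q l l' (x, y))%:E)%E.
  by apply: integral_ge0 => y _; rewrite lee_fin.
have ff0 l l' : 0 <= f l * f l' by rewrite mulr_ge0.
transitivity (\int[nu]_(x in A) \sum_l \sum_l' (f l * f l')%:E *
    \int[nu]_(y in C) (q l l' (x, y))%:E)%E.
  rewrite ge0_integral_sum//; last 2 first.
  - move=> l; apply: emeasurable_sum => l'; exact: emeasurable_funM.
  - by move=> l x _; apply: sume_ge0 => l' _; rewrite mule_ge0// lee_fin.
  apply: eq_bigr => l _; rewrite ge0_integral_sum//; last 2 first.
  - by move=> l'; exact: emeasurable_funM.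
  - by move=> l' x _; rewrite mule_ge0// lee_fin.
  by apply: eq_bigr => l' _; rewrite ge0_integralZl_EFin// Pq.
apply: eq_integral => x _.
transitivity (\int[nu]_(y in C) \sum_l \sum_l'
    ((f l * f l')%:E * (q l l' (x, y))%:E))%E.
  rewrite ge0_integral_sum//; last 2 first.
  - by move=> l; apply: emeasurable_sum => l'; exact: emeasurable_funM.
  - by move=> l y _; apply: sume_ge0 => l' _; rewrite mule_ge0// lee_fin.
  apply: eq_bigr => l _; rewrite ge0_integral_sum//; last 2 first.
  - by move=> l'; exact: emeasurable_funM.
  - by move=> l' y _; rewrite mule_ge0// lee_fin.
  by apply: eq_bigr => l' _; rewrite ge0_integralZl_EFin// => y _; rewrite lee_fin.
apply: eq_integral => y _; rewrite /pair_density -sumEFin.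
by apply: eq_bigr => l _; rewrite -sumEFin; apply: eq_bigr => l' _; rewrite -EFinM.
Qed.

(** This is the integrand of the mixing condition, as a real function that vanishes
    off the common support. *)
Definition deviation (l : 'I_k) (i n : nat) (z : S * S) : R :=
  (step_density l i n z / lk z.2 l - 1) ^+ 2 * (md z.2 * md z.1).

Lemma deviation_ge0 l i n z : 0 <= deviation l i n z.
Proof. by rewrite mulr_ge0 ?sqr_ge0// mulr_ge0. Qed.

Lemma measurable_deviation l i n : (0 < n)%N ->
  measurable_fun setT (deviation l i n).
Proof.
move=> n0; apply: measurable_funM.
  apply: measurable_funX; apply: measurable_funB => //.
  apply: measurable_funM; first exact: measurable_step_density.
  apply: (measurable_snd_comp (h := fun x => (lk x l)^-1)).
  apply: measurable_inv_pos; first by move=> x; exact: lik_gt0.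
  exact: measurable_lik mchi hp sf l.
by apply: measurable_funM; [exact: measurable_snd_comp|exact: measurable_fst_comp].
Qed.

Lemma mdens_in x : N x -> md x = \sum_l f l * p l x.
Proof. by move=> Nx; apply: eq_bigr => l _; rewrite pdens_in. Qed.

Lemma mdens_out x : ~ N x -> md x = 0.
Proof. by move=> Nx; apply: big1 => l _; rewrite pdens_out// mulr0. Qed.

Lemma deviation_le l i n : (0 < n)%N ->
  (\int[nu \x nu]_z (deviation l i n z)%:E <= (c0 * rho ^+ (2 * n))%:E)%E.
Proof.
move=> n0; rewrite fubini_tonelli1//; last 2 first.
- by apply/measurable_EFinP; exact: measurable_deviation.
- by move=> z; rewrite lee_fin deviation_ge0.
have mp_ge0 x : chi x -> 0 <= \sum_l f l * p l x.
  move=> cx; apply: sumr_ge0 => l' _; have [f0 _] := sf.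
  by rewrite mulr_ge0//; have [_ + _] := hp l'; apply.
have ext0 x y : chi x -> chi y ->
    (0 <= ((cstep l i n x y)%:E / (p l y)%:E - 1) ^+ 2 *
      (\sum_l f l * p l y)%:E * (\sum_l f l * p l x)%:E)%E.
  move=> cx cy; apply: mule_ge0; last by rewrite lee_fin mp_ge0.
  apply: mule_ge0; last by rewrite lee_fin mp_ge0.
  exact: sqre_ge0.
apply: le_trans (hmix l i n0); rewrite [leRHS]integral_mkcond.
apply: le_integral_sup => x _.
  by apply: integral_ge0 => y _; rewrite lee_fin deviation_ge0.
rewrite /fubini_F; have [Nx|Nx] := pselect (N x); last first.
  rewrite integral0_eq.
    by apply: erestrict_ge0 => t ct; apply: integral_ge0 => y cy; exact: ext0.
  by move=> y _; rewrite /deviation /= (mdens_out Nx) !mulr0.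
have cx : chi x by case: Nx.
rewrite patchE mem_set// [leRHS]integral_mkcond.
apply: le_integral_sup => y _; first by rewrite lee_fin deviation_ge0.
have [Ny|Ny] := pselect (N y); last first.
  rewrite /deviation /= (mdens_out Ny) mul0r mulr0.
  by apply: erestrict_ge0 => t ct; exact: ext0.
have cy : chi y by case: Ny.
rewrite patchE mem_set// /deviation /step_density patchE mem_set//=.
rewrite !mdens_in// /lik mem_set// inver gt_eqF ?(p_gt0 _ Ny)//.
by rewrite -!(EFinM, EFinD) lee_fin expr2 !mulrA.
Qed.

Lemma young (r s t : R) : 0 < r -> s * t <= r / 2 * s ^+ 2 + r^-1 / 2 * t ^+ 2.
Proof.
move=> r0; have := sqr_ge0 (r * s - t); rewrite sqrrB exprMn => h.
rewrite -(ler_pM2l r0).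
have -> : r * (r / 2 * s ^+ 2 + r^-1 / 2 * t ^+ 2) =
  r ^+ 2 * s ^+ 2 / 2 + t ^+ 2 / 2 by field; rewrite gt_eqF.
by move: h; rewrite -mulr_natl; lra.
Qed.

(** The pair density is the product of the marginals plus, for each component, a
    term [(f l * pd l x) * (f l * pd l y) * (s / pd l y - 1)] with [s] the step
    density. The first two factors are at most the mixture density, and the
    third is separated from the observable by Young's inequality. *)
Lemma pair_density_le (r gx gy : R) i n z : (0 < n)%N -> 0 < r -> 0 <= gx -> 0 <= gy ->
  gx * gy * pair_density i n z <=
  gx * md z.1 * (gy * md z.2)
  + k%:R * (r / 2) * (gx ^+ 2 * md z.1 * (gy ^+ 2 * md z.2))
  + \sum_l r^-1 / 2 * deviation l i n z.
Proof.
move=> n0 r0 gx0 gy0; case: z => x y /=; have [f0 _] := sf.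
have rhs0 : 0 <= gx * md x * (gy * md y)
  + k%:R * (r / 2) * (gx ^+ 2 * md x * (gy ^+ 2 * md y))
  + \sum_l r^-1 / 2 * deviation l i n (x, y).
  rewrite !addr_ge0 ?mulr_ge0 ?exprn_ge0 ?invr_ge0 ?(ltW r0)//.
  apply: sumr_ge0 => l _.
  by rewrite mulr_ge0 ?deviation_ge0 ?mulr_ge0 ?invr_ge0 ?(ltW r0).
have [Nx|Nx] := pselect (N x); last first.
  rewrite /pair_density big1 ?mulr0// => l _; rewrite big1// => l' _.
  by rewrite /= pdens_out// mul0r mulr0.
have [Ny|Ny] := pselect (N y); last first.
  rewrite /pair_density big1 ?mulr0// => l _; rewrite big1// => l' _ /=.
  rewrite (pdens_out l' Ny) /step_density patchE memNset; last by case.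
  by case: ifP => _; rewrite !mulr0.
pose a l := pd l x; pose b l := pd l y.
pose s l := step_density l i n (x, y).
have b0 l : 0 < b l by rewrite /b pdens_in//; exact: p_gt0 Ny.
have lkb l : lk y l = b l by rewrite /lik mem_set// /b pdens_in.
(* Only the diagonal terms differ from the product of the two mixtures. *)
have -> : pair_density i n (x, y) =
    md x * md y + \sum_l (f l * a l) * (f l * b l) * (s l / b l - 1).
  have -> : md x * md y = \sum_l \sum_l' f l * f l' * (a l * b l').
    rewrite mulr_suml; apply: eq_bigr => l _; rewrite mulr_sumr.
    by apply: eq_bigr => l' _; rewrite /a /b; ring.
  rewrite -big_split/=; apply: eq_bigr => l _.
  rewrite (bigD1 l)//= eqxx [X in _ = X + _](bigD1 l)//= addrAC.
  congr (_ + _).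
    by rewrite /a -/(b l) -/(s l); field; rewrite gt_eqF.
  by apply: eq_bigr => l' /negPf; rewrite eq_sym => ->.
rewrite mulrDr -addrA lerD//; first by rewrite le_eqVlt; apply/orP; left; apply/eqP; ring.
have -> : k%:R * (r / 2) * (gx ^+ 2 * md x * (gy ^+ 2 * md y)) =
    \sum_(l < k) r / 2 * (gx * gy) ^+ 2 * (md x * md y).
  by rewrite sumr_const card_ord -mulr_natl; ring.
rewrite mulr_sumr -big_split/=; apply: ler_sum => l _.
have fa : f l * a l <= md x.
  by rewrite /mdens (bigD1 l)//= lerDl sumr_ge0// => l' _; rewrite mulr_ge0.
have fb : f l * b l <= md y.
  by rewrite /mdens (bigD1 l)//= lerDl sumr_ge0// => l' _; rewrite mulr_ge0.
have fafb : f l * a l * (f l * b l) <= md x * md y.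
  by rewrite ler_pM// mulr_ge0// ?pd0// ltW.
rewrite /deviation/= lkb -/(s l).
set t := s l / b l - 1.
have t2 : gx * gy * t <= r / 2 * (gx * gy) ^+ 2 + r^-1 / 2 * t ^+ 2 by exact: young.
have fafb0 : 0 <= f l * a l * (f l * b l).
  by rewrite !mulr_ge0 ?f0 ?pd0// ltW.
have q0 : 0 <= r / 2 * (gx * gy) ^+ 2 + r^-1 / 2 * t ^+ 2.
  by rewrite addr_ge0// mulr_ge0 ?sqr_ge0// mulr_ge0 ?invr_ge0 ?(ltW r0).
apply: (@le_trans _ _ (f l * a l * (f l * b l) *
    (r / 2 * (gx * gy) ^+ 2 + r^-1 / 2 * t ^+ 2))).
  rewrite mulrCA; apply: ler_wpM2l => //.
apply: (@le_trans _ _ (md x * md y *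
    (r / 2 * (gx * gy) ^+ 2 + r^-1 / 2 * t ^+ 2))).
  by rewrite ler_wpM2r.
by rewrite le_eqVlt; apply/orP; left; apply/eqP; ring.
Qed.

Section observables.
Variables (g : S -> R) (e G : R).
Hypothesis mg : measurable_fun setT g.
Hypothesis g0 : forall x, 0 <= g x.

Lemma observed_mean (h : S -> R) i : measurable_fun setT h ->
  (forall x, 0 <= h x) ->
  (\int[P]_omega (h (X i omega))%:E = \int[nu]_x (h x * md x)%:E)%E.
Proof.
move=> mh h0.
rewrite (@law_integral (X i) md (fun x => (h x)%:E))//.
- by move=> A mA; exact: observed_law.
- exact/measurable_EFinP.
Qed.

Hypothesis ge : (\int[P]_omega (g (X 0%N omega))%:E = e%:E)%E.
Hypothesis gG : (\int[P]_omega (g (X 0%N omega) ^+ 2)%:E <= G%:E)%E.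

Let mg2 : measurable_fun setT (fun x => g x ^+ 2).
Proof. exact: measurable_funX. Qed.

Lemma G_ge0 : 0 <= G.
Proof.
rewrite -lee_fin; apply: le_trans gG; apply: integral_ge0 => omega _.
by rewrite lee_fin sqr_ge0.
Qed.

(** The mixing integral is of order [rho ^+ (2 * n)] and is divided by the parameter
    of Young's inequality, whose other half is multiplied by it: the choice
    [rho ^+ n] balances the two. *)
Lemma observed_pair_moment i n : (0 < n)%N ->
  (\int[P]_omega (g (X i omega) * g (X (i + n)%N omega))%:E <=
   (e ^+ 2 + k%:R / 2 * (G ^+ 2 + c0) * rho ^+ n)%:E)%E.
Proof.
move=> n0; have /andP[rho0 _] := hrho.
have r0 : 0 < rho ^+ n by rewrite exprn_gt0.
have mpair := measurable_pair_density i n0.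
have pair0 z : 0 <= pair_density i n z by exact: pair_density_ge0.
have mgg : measurable_fun setT (fun z : S * S => (g z.1 * g z.2)%:E).
  apply/measurable_EFinP; apply: measurable_funM.
    exact: measurable_fst_comp.
  exact: measurable_snd_comp.
have gg0 (z : S * S) : (0 <= (g z.1 * g z.2)%:E)%E by rewrite lee_fin mulr_ge0.
rewrite (@expectation_pair _ _ S S R _ Omega P nu nu (X i) (X (i + n)%N)
  (pair_density i n) _ _ pair0 mpair (fun A C mA mC => pair_law i n0 mA mC)
  (fun z => (g z.1 * g z.2)%:E) mgg gg0); try exact: measurable_funP.
pose u x := g x * md x; pose v x := g x ^+ 2 * md x.
have u0 x : 0 <= u x by rewrite mulr_ge0.
have v0 x : 0 <= v x by rewrite mulr_ge0 ?sqr_ge0.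
have mu : measurable_fun setT u by exact: measurable_funM.
have mv : measurable_fun setT v by exact: measurable_funM.
have iu : (\int[nu]_x (u x)%:E = e%:E)%E by rewrite -ge observed_mean.
have iv : (\int[nu]_x (v x)%:E <= G%:E)%E.
  rewrite -(@observed_mean (fun x => g x ^+ 2) 0)//.
  by move=> x; exact: sqr_ge0.
have iv0 : (0 <= \int[nu]_x (v x)%:E)%E.
  by apply: integral_ge0 => x _; rewrite lee_fin.
pose F1 (z : S * S) := (u z.1 * u z.2)%:E.
pose F2 (z : S * S) := (v z.1 * v z.2)%:E.
pose F3 l (z : S * S) := (deviation l i n z)%:E.
pose K2 := k%:R * (rho ^+ n / 2); pose K3 := (rho ^+ n)^-1 / 2.
have K20 : 0 <= K2 by rewrite mulr_ge0// mulr_ge0// ltW.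
have K30 : 0 <= K3 by rewrite mulr_ge0// invr_ge0 ltW.
have mF1 : measurable_fun setT F1.
  apply/measurable_EFinP; apply: measurable_funM.
    exact: measurable_fst_comp.
  exact: measurable_snd_comp.
have mF2 : measurable_fun setT F2.
  apply/measurable_EFinP; apply: measurable_funM.
    exact: measurable_fst_comp.
  exact: measurable_snd_comp.
have mF3 l : measurable_fun setT (F3 l).
  by apply/measurable_EFinP; exact: measurable_deviation.
have F10 z : (0 <= F1 z)%E by rewrite lee_fin mulr_ge0.
have F20 z : (0 <= F2 z)%E by rewrite lee_fin mulr_ge0.
have F30 l z : (0 <= F3 l z)%E by rewrite lee_fin deviation_ge0.
apply: (@le_trans _ _ (\int[nu \x nu]_z
   (F1 z + (K2%:E * F2 z + \sum_l K3%:E * F3 l z))))%E.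
  apply: le_integral_sup => z _; first by rewrite mule_ge0// lee_fin.
  rewrite /F3; under eq_bigr do rewrite -EFinM.
  rewrite sumEFin -!EFinM -!EFinD lee_fin addrA.
  exact: pair_density_le.
have mS : measurable_fun setT (fun z => \sum_l K3%:E * F3 l z)%E.
  by apply: emeasurable_sum => l; exact: emeasurable_funM.
have S0 z : (0 <= \sum_l K3%:E * F3 l z)%E.
  by apply: sume_ge0 => l _; rewrite mule_ge0// lee_fin.
rewrite ge0_integralD//; last 2 first.
- by move=> z _; rewrite adde_ge0// mule_ge0// lee_fin.
- by apply: emeasurable_funD => //; exact: emeasurable_funM.
rewrite ge0_integralD//; last 2 first.
- by move=> z _; rewrite mule_ge0// lee_fin.
- exact: emeasurable_funM.
rewrite ge0_integral_sum//; last 2 first.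
- by move=> l; exact: emeasurable_funM.
- by move=> l z _; rewrite mule_ge0// lee_fin.
rewrite product_integral// iu ge0_integralZl_EFin// product_integral//.
apply: (@le_trans _ _ (e%:E * e%:E + (K2%:E * (G%:E * G%:E) +
    \sum_(l < k) K3%:E * (c0 * rho ^+ (2 * n))%:E)))%E.
  apply: leeD => //; apply: leeD.
    by rewrite lee_wpmul2l ?lee_fin// lee_pmul.
  apply: lee_sum => l _; rewrite ge0_integralZl_EFin//.
  by rewrite lee_wpmul2l ?lee_fin// deviation_le.
under eq_bigr do rewrite -EFinM.
rewrite sumEFin -!EFinM -!EFinD lee_fin sumr_const card_ord -[X in _ + (_ + X) <= _]mulr_natl.
rewrite /K2 /K3 (_ : rho ^+ (2 * n) = rho ^+ n * rho ^+ n); last first.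
  by rewrite mul2n -addnn exprD.
rewrite le_eqVlt; apply/orP; left; apply/eqP.
by field; rewrite gt_eqF.
Qed.

Lemma observed_covariance : exists2 C, 0 <= C & forall i j,
  (\int[P]_omega (g (X i omega) * g (X j omega))%:E <=
   (e ^+ 2 + C * rho ^+ gap i j)%:E)%E.
Proof.
have /andP[rho0 _] := hrho; have G0 := G_ge0.
pose C1 := k%:R / 2 * (G ^+ 2 + c0).
have C10 : 0 <= C1 by rewrite mulr_ge0 ?mulr_ge0// addr_ge0 ?sqr_ge0.
exists (G + C1); first by rewrite addr_ge0.
have lt_case i j : (i < j)%N ->
    (\int[P]_omega (g (X i omega) * g (X j omega))%:E <=
     (e ^+ 2 + (G + C1) * rho ^+ gap i j)%:E)%E.
  move=> ij; have -> : gap i j = (j - i)%N by rewrite /gap; lia.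
  have := @observed_pair_moment i (j - i).
  rewrite subn_gt0 subnKC ?(ltnW ij)// => /(_ ij) /le_trans; apply.
  rewrite lee_fin lerD2l ler_wpM2r ?exprn_ge0 ?(ltW rho0)//.
  by rewrite lerDr.
move=> i j; case: (ltngtP i j) => [|ji|<-]; first exact: lt_case.
  have -> : gap i j = gap j i by rewrite /gap addnC.
  under eq_integral do rewrite mulrC.
  exact: lt_case.
rewrite /gap subnn expr0 mulr1.
under eq_integral do rewrite -expr2.
rewrite (@observed_mean (fun x => g x ^+ 2) i)//; last by move=> x; exact: sqr_ge0.
rewrite -(@observed_mean (fun x => g x ^+ 2) 0)//; last by move=> x; exact: sqr_ge0.
apply: le_trans gG _; rewrite lee_fin.
by have := sqr_ge0 e; lra.
Qed.

End observables.

End observed_process.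

(** * The recursion on a finite parameter set *)

Section finite_parameter_set.
Context {R : realType} {k : nat} {d : measure_display} {T : measurableType d}.
Variables (mu : {measure set T -> \bar R}) (theta : 'I_k -> T).
Hypothesis theta_inj : injective theta.
Hypothesis mtheta : forall l, measurable [set theta l].
Hypothesis mu1 : forall l, mu [set theta l] = 1%E.

Lemma range_bigsetU : range theta = \big[setU/set0]_(l <- index_enum 'I_k) [set theta l].
Proof.
rewrite -bigcup_seq; apply/seteqP; split => t.
  by move=> [l _ <-]; exists l => //=; rewrite mem_index_enum.
by move=> [l _ ->]; exists l.
Qed.

Lemma measurable_fun_finite {d' : measure_display} {T' : measurableType d'}
  (phi : T -> T') : measurable_fun (range theta) phi.
Proof.
move=> _ Y mY.
rewrite (_ : range theta `&` phi @^-1` Y =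
    \big[setU/set0]_(l <- index_enum 'I_k | `[< Y (phi (theta l)) >]) [set theta l]).
  by apply: bigsetU_measurable => l _; exact: mtheta.
apply/seteqP; split => t.
  move=> [[l _ <-] /asboolP Yl]; rewrite -big_filter -bigcup_seq.
  by exists l => //=; rewrite mem_filter Yl mem_index_enum.
rewrite -big_filter -bigcup_seq => -[l /=].
by rewrite mem_filter => /andP[/asboolP Yl _] ->; split => //; exists l.
Qed.

Lemma integral_finite (phi : T -> R) :
  (\int[mu]_(t in range theta) (phi t)%:E = (\sum_l phi (theta l))%:E)%E.
Proof.
rewrite range_bigsetU integral_bigsetU_EFin//.
- rewrite -sumEFin; apply: eq_bigr => l _.
  rewrite (eq_integral (cst (phi (theta l))%:E)).
    by rewrite integral_cst// [X in (_ * X)%E]mu1 mule1.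
  by move=> t /set_mem ->.
- exact: index_enum_uniq.
- apply/trivIsetP => l l' _ _ ll'; rewrite -subset0 => t [-> /theta_inj].
  by move/eqP; rewrite (negPf ll').
- rewrite -range_bigsetU; exact/measurable_EFinP/measurable_fun_finite.
Qed.

Lemma marginal_finite {dX : measure_display} {X : measurableType dX} (x : X)
    (q : X -> T -> R) (g : T -> R) :
  marginal mu (range theta) q g x = \sum_l q x (theta l) * g (theta l).
Proof. by rewrite /marginal /Rintegral integral_finite. Qed.

End finite_parameter_set.

Theorem proposition3
  (R : realType)
  (* sample space chi, a Borel subset of a normed space *)
  (E : normedModType R) (chi : set (borel E)) (hchi : measurable chi)
  (nu : {sigma_finite_measure set (borel E) -> \bar R})
  (* parameter space *)
  (q k : nat)
  (mu : {sigma_finite_measure set (borel 'rV[R]_q) -> \bar R})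
  (ThetaHat : set 'rV[R]_q) (hThetaHat_closed : closed ThetaHat)
  (hThetaHat_convex : convex_set (ThetaHat : set (convex_lmodType 'rV[R]_q)))
  (theta : 'I_k -> borel 'rV[R]_q) (htheta_inj : injective theta)
  (hTheta : range theta `<=` ThetaHat)
  (hmu : forall l, mu [set theta l] = 1%E)
  (p : borel E -> borel 'rV[R]_q -> R)
  (hp : forall t, ThetaHat t -> density nu chi (p ^~ t))
  (* the true mixing density *)
  (prob : 'I_k -> R) (hprob_ge0 : forall l, 0 <= prob l)
  (hprob_sum : \sum_l prob l = 1)
  (f : borel 'rV[R]_q -> R) (hf : forall l, f (theta l) = prob l)
  (m : borel E -> R) (hm : forall x, m x = \sum_l prob l * p x (theta l))
  (hident : identifiable nu mu chi (range theta) p f)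
  (* the observed process *)
  (dO : measure_display) (Omega : measurableType dO) (P : probability Omega R)
  (Z : nat -> 'I_k -> {RV P >-> borel E})
  (I : nat -> 'I_k -> {RV P >-> nat})
  (X : nat -> {RV P >-> borel E})
  (hX : forall i omega,
     X i omega = \sum_l ((Z i l omega : E) *+ I i l omega) :> E)
  (hZ_chi : forall i l omega, chi (Z i l omega))
  (hZ_markov : forall l, markov_process P (fun i => Z i l))
  (hZ_density : forall i l, has_density P nu chi (Z i l) (p ^~ (theta l)))
  (hZ_indep : mutually_independent P
     (fun l => sigma_of [set: nat] (fun i => Z i l)))
  (hI_law : forall i, multinomial_distributed P 1 prob (I i))
  (hI_indep : mutually_independent P
     (fun i => sigma_of [set: 'I_k] (fun l => I i l)))
  (hIZ_indep : independent P
     (sigma_of [set: nat * 'I_k] (fun il => I il.1 il.2))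
     (sigma_of [set: nat * 'I_k] (fun il => Z il.1 il.2)))
  (* conditional densities of Z (i + n) l given (Z 0 l, ..., Z i l) and
     given Z i l, and joint density of (X 0, ..., X i) *)
  (cpath : 'I_k -> forall i n : nat, i.+1.-tuple (borel E) -> borel E -> R)
  (hcpath : forall l i n, (0 < n)%N ->
     conditional_density P nu (tuples_in chi i.+1) chi
       (path_of (fun j => Z j l) i.+1) (Z (i + n)%N l) (@cpath l i n))
  (cstep : 'I_k -> nat -> nat -> borel E -> borel E -> R)
  (hcstep : forall l i n, (0 < n)%N ->
     conditional_density P nu chi chi (Z i l) (Z (i + n)%N l) (cstep l i n))
  (mpath : forall i : nat, i.+1.-tuple (borel E) -> R)
  (hmpath : forall i, joint_density P nu chi X (@mpath i))
  (* mixing rate *)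
  (c0 rho : R) (hc0 : 0 < c0) (hrho : 0 < rho < 1)
  (hmix : forall (l : 'I_k) (n : nat), (0 < n)%N ->
     let sup_path :=
       ereal_sup (range (fun i : nat =>
         integral_tuple nu chi (fun t : i.+1.-tuple (borel E) =>
           (\int[nu]_(y in chi)
              (((@cpath l i n t y)%:E / (p y (theta l))%:E - 1) ^+ 2 *
               (m y)%:E * (@mpath i t)%:E))%E))) in
     let sup_step :=
       ereal_sup (range (fun i : nat =>
         (\int[nu]_(x in chi) \int[nu]_(y in chi)
            (((cstep l i n x y)%:E / (p y (theta l))%:E - 1) ^+ 2 *
             (m y)%:E * (m x)%:E))%E)) in
     sup_path = sup_step /\ (sup_step <= (c0 * rho ^+ (2 * n))%:E)%E)
  (* weights and initial estimate *)
  (alpha : R) (halpha : 2^-1 < alpha <= 1)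
  (w : nat -> R) (hw : pr_weights alpha w)
  (f0 : borel 'rV[R]_q -> R) (hf0 : density mu (range theta) f0)
  (hsupp : [set t | range theta t /\ f0 t != 0] =
           [set t | range theta t /\ f t != 0])
  (hK0 : relative_entropy mu (range theta) f f0 \is a fin_num)
  (hK0' : relative_entropy nu chi m (marginal mu (range theta) p f0)
          \is a fin_num)
  (* moment and continuity conditions on the likelihood ratios *)
  (b0 : R) (hb0 : 0 < b0)
  (hprod : forall l,
     ratio_products_bounded P ThetaHat p (fun i => Z i l) b0)
  (hmoment : ratio_second_moment_bounded nu chi p ThetaHat)
  (hcont : forall x, chi x ->
     {within ThetaHat, continuous (p x : 'rV[R]_q -> R)} /\
     exists M : R, forall t, ThetaHat t -> `|p x t| <= M)
  (* behaviour off and on a compact set *)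
  (ThetaH : set 'rV[R]_q) (hThetaH_fin : finite_set ThetaH)
  (hThetaH : ThetaH `<=` ThetaHat)
  (chic : set E) (hchic_compact : compact chic) (hchic : chic `<=` chi)
  (cu : R) (hcu : 1 < cu)
  (htail : ratio_dominated chi (range theta) p chic ThetaH cu)
  (a : R) (ha : 0 < a)
  (hlow : (a%:E < ereal_inf [set (p z.1 z.2)%:E
                            | z in chic `*` range theta])%E)
  (b : R)
  (hup : (ereal_sup [set (p z.1 z.2)%:E
                    | z in chic `*` range theta] < b%:E)%E) :
  {ae P, forall omega, forall t, range theta t ->
     predictive_recursion mu (range theta) p w f0 (fun i => X i omega) n t
       @[n --> \oo] --> f t}.
Proof.
pose pl l x := p x (theta l).
have sf : simplex prob by [].
have hpl l : density nu chi (pl l).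
  by apply: hp; apply: hTheta; exists l.
have mth l : measurable ([set theta l] : set (borel 'rV[R]_q)).
  rewrite -[X in measurable X]setCK; apply: measurableC.
  apply: sub_sigma_algebra; apply: closed_openC.
  exact: (accessible_closed_set1 (hausdorff_accessible (@norm_hausdorff _ _))).
have [w01 _ wc _] := hw.
have [[A w2] wdiv] := weights_series halpha hw.
have [B hB] := hmoment.
have hB' l l' l'' : (\int[nu]_(x in chi)
    (((pl l x)%:E / (pl l' x)%:E) ^+ 2 * (pl l'' x)%:E) <= B%:E)%E.
  apply: le_trans (ltW hB); apply: ereal_sup_ubound.
  exists ((theta l, theta l'), theta l'') => //=.
  by split; [split|]; apply: hTheta; [exists l|exists l'|exists l''].
have hsel i l omega : selects I i l omega -> X i omega = Z i l omega.
  move=> sel; rewrite hX (bigD1 l)//= big1 ?addr0; last first.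
    by move=> l' /negPf ll'; rewrite sel ll'.
  by rewrite sel eqxx.
have mE : m = fun x => \sum_l prob l * pl l x by apply/funext => x; exact: hm.
have hmix' l i n : (0 < n)%N ->
  (\int[nu]_(x in chi) \int[nu]_(y in chi)
     (((cstep l i n x y)%:E / (pl l y)%:E - 1) ^+ 2 *
      (\sum_l prob l * pl l y)%:E * (\sum_l prob l * pl l x)%:E)
   <= (c0 * rho ^+ (2 * n))%:E)%E.
  move=> n0; have [_ le_sup] := hmix l n n0.
  apply: le_trans le_sup; apply: ereal_sup_ubound.
  exists i; first exact: Logic.I.
  rewrite mE; reflexivity.
pose v0 l := f0 (theta l).
have sumf0 : \sum_l v0 l = 1.
  have [_ _] := hf0; rewrite (integral_finite htheta_inj mth hmu).
  by move=> [].
have sv0 : simplex v0.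
  by split => // l; have [_ + _] := hf0; apply; exists l.
have supp l : prob l = 0 <-> v0 l = 0.
  have := congr1 (fun A => A (theta l)) hsupp; rewrite /= hf /v0 => E'.
  have rl : range theta (theta l) by exists l.
  split => /eqP z0; apply/eqP; apply/negPn/negP => nz.
    have : range theta (theta l) /\ f0 (theta l) != 0 by [].
    by rewrite E' => -[_]; rewrite z0.
  have : range theta (theta l) /\ prob l != 0 by [].
  by rewrite -E' => -[_]; rewrite z0.
have mX n : measurable_fun setT (X n) by exact: measurable_funP.
have mlik l : measurable_fun setT (fun x => lik chi pl x l).
  exact: (measurable_lik hchi hpl sf l).
have lik0 x l : 0 < lik chi pl x l by exact: lik_gt0.
have mmix g : measurable_fun setT (fun x => mix g (lik chi pl x)).
  by apply: measurable_sum => l; exact: measurable_funM.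
have ml : measurable_fun setT (fun x => spread (lik chi pl x)).
  exact: (measurable_spread mlik lik0).
have obs (h : borel E -> R) i : measurable_fun setT h -> (forall x, 0 <= h x) ->
  (\int[P]_omega (h (X i omega))%:E = \int[nu]_x (h x * mdens chi pl prob x)%:E)%E.
  exact: (observed_mean hchi hpl sf hB' hsel hZ_density hI_law hIZ_indep).
have law0 i D : measurable D ->
    (P (X i @^-1` D) = \int[nu]_(x in D) (mdens chi pl prob x)%:E)%E.
  exact: (observed_law hchi hpl sf hB' hsel hZ_density hI_law hIZ_indep).
have ident g : simplex g -> (forall l, prob l = 0 -> g l = 0) ->
    {ae P, forall omega,
      mix g (lik chi pl (X 0%N omega)) = mix prob (lik chi pl (X 0%N omega))} ->
    forall l, g l = prob l.
  move=> sg _ gae l.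
  pose D := [set x | mix g (lik chi pl x) != mix prob (lik chi pl x)].
  have mD : measurable D.
    rewrite (_ : D = (fun x => mix g (lik chi pl x) - mix prob (lik chi pl x))
                       @^-1` (~` [set 0])).
      rewrite -[X in measurable X]setTI.
      apply: (measurable_funB (mmix g) (mmix prob)) => //.
      exact: measurableC.
    by apply/seteqP; split => x /=; rewrite /D/= -subr_eq0 => /eqP.
  have D0 : (\int[nu]_(x in D) (mdens chi pl prob x)%:E = 0)%E.
    rewrite -(law0 0%N)//; apply: measure_negligible.
      exact: measurable_preimage.
    apply: negligibleS gae => omega /= /eqP ne eqm; exact: ne.
  have aeq := mixture_ae_eq hchi hpl sf hB' sg D0.
  (* The mixing density with masses [g] at the points of the parameter set. *)
  pose gam (t : borel 'rV[R]_q) := \sum_l g l * (`[< t = theta l >])%:R.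
  have gamE i : gam (theta i) = g i.
    rewrite /gam (bigD1 i)//= asboolT// mulr1 big1 ?addr0// => j ji.
    rewrite asboolF ?mulr0// => /htheta_inj ij.
    by rewrite ij eqxx in ji.
  have margE h x : marginal mu (range theta) p h x = \sum_l p x (theta l) * h (theta l).
    exact: (marginal_finite htheta_inj mth hmu).
  have dgam : density mu (range theta) gam.
    split.
    - exact: (measurable_fun_finite mth).
    - by move=> t [i _ <-]; rewrite gamE; case: sg.
    - rewrite (integral_finite htheta_inj mth hmu); congr EFin.
      by rewrite -(proj2 sg); apply: eq_bigr => i _.
  rewrite -gamE -hf; apply: (hident gam dgam); last by exists l.
  apply: filterS aeq => x eqx cx; rewrite !margE.
  under eq_bigr do rewrite gamE mulrC.
  rewrite [LHS](eqx cx); apply: eq_bigr => i _.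
  by rewrite hf mulrC.
have := @pr_iter_converges R k _ _ Omega (borel E) P (fun n => X n) (lik chi pl) prob v0 w
  (k%:R ^+ 4 * B) rho A mX mlik lik0 sf sv0 supp w01 wc wdiv w2 hrho.
have same_law (g : borel E -> R) n : measurable_fun setT g -> (forall x, 0 <= g x) ->
  (\int[P]_omega (g (X n omega))%:E = \int[P]_omega (g (X 0%N omega))%:E)%E.
  by move=> mg g0; rewrite !obs.
move=> /(_ same_law).
have cov (g : borel E -> R) (e G : R) : measurable_fun setT g ->
  (forall x, 0 <= g x) ->
  (\int[P]_omega (g (X 0%N omega))%:E = e%:E)%E ->
  (\int[P]_omega (g (X 0%N omega) ^+ 2)%:E <= G%:E)%E ->
  exists2 C, 0 <= C & forall i j,
    (\int[P]_omega (g (X i omega) * g (X j omega))%:E <=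
     (e ^+ 2 + C * rho ^+ gap i j)%:E)%E.
  move=> mg g0 ge gG.
  exact: (observed_covariance hchi hpl sf hB' hsel hZ_chi hZ_density hI_law
    hZ_indep hI_indep hIZ_indep hcstep (ltW hc0) hrho hmix' mg g0 ge gG).
move=> /(_ cov).
have sl : (\int[P]_omega (spread (lik chi pl (X 0%N omega)) ^+ 2)%:E <=
           (k%:R ^+ 4 * B)%:E)%E.
  rewrite (obs (fun x => spread (lik chi pl x) ^+ 2)).
  - exact: (spread_second_moment hchi hpl sf hB').
  - exact: measurable_funX.
  - by move=> x; exact: sqr_ge0.
move=> /(_ sl).
have inv1 g : simplex g ->
  (\int[P]_omega (mix g (lik chi pl (X 0%N omega)) /
                  mix prob (lik chi pl (X 0%N omega)))%:E <= 1)%E.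
  move=> sg.
  rewrite (obs (fun x => mix g (lik chi pl x) / mix prob (lik chi pl x))).
  - exact: (inverse_ratio_mean hchi hpl sf hB').
  - apply: measurable_funM => //; apply: measurable_inv_pos => // x.
    exact: mix_gt0 (simplex_heavy sf) _.
  - move=> x; rewrite divr_ge0 ?mix_ge0//; try by move=> l; exact: ltW.
    by case: sg.
move=> /(_ inv1 ident).
have : {ae P, forall omega, forall n, positive_set chi pl (X n omega)}.
  apply/ae_foralln => n.
  exact: (observed_in_support hchi hpl sf hB' hsel hZ_density hI_law hIZ_indep).
apply: filterS2 => omega inN conv _ [l _ <-]; rewrite hf.
have prE n : forall i, predictive_recursion mu (range theta) p w f0
    (fun i => X i omega) n (theta i) =
    pr_iter v0 w (fun n => lik chi pl (X n omega)) n i.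
  elim: n => [//|n IH] i /=.
  rewrite (marginal_finite htheta_inj mth hmu) IH /pr_step.
  have likE j : p (X n omega) (theta j) = lik chi pl (X n omega) j.
    by rewrite /lik mem_set.
  rewrite likE; congr (_ + _ * (_ / _)).
  by apply: eq_bigr => j _; rewrite likE IH mulrC.
rewrite (_ : (fun n => _) = (fun n =>
  pr_iter v0 w (fun n => lik chi pl (X n omega)) n l)); first exact: conv.
by apply/funext => n; exact: prE.
Qed.
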